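(* Let $k$ be an algebraically closed field of characteristic $p>0$, let $G$ be a countably based profinite group with a chain $N_1\ge N_2\ge\cdots$ of open normal subgroups with $\bigcap_i N_i=1$, let $b$ be a block idempotent of $k[[G]]$, let $D$ be a defect group of $k[[G]]b$, and let $(D,\hat e)$, $\hat e=[(e_i)_{i}]_\sim$, be a maximal $(G,b)$-Brauer pair. Define $\mathcal F_i=\mathcal F_{(DN_i/N_i,e_i)}(G/N_i,b_i)$ (defined for all but finitely many $i$). Then there are a strictly increasing function $\mu:\mathbb N\to\mathbb N$ and an $i_0\in\mathbb N$ such that $$\mathcal F_{(D,\hat e)}(G,b)=\varprojlim_{i\ge i_0}\ \mathcal F_{\mu(i)}/\big((D\cap N_i)N_{\mu(i)}/N_{\mu(i)}\big),$$ and $$\mathcal F_{(D,\hat e)}(G,b)/(D\cap N_i)=\mathcal F_{\mu(i)}/\big((D\cap N_i)N_{\mu(i)}/N_{\mu(i)}\big)$$ as fusion systems on $D/(D\cap N_i)$ for all $i\ge i_0$.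
   Context: **Conventions.** $x^g=g^{-1}xg$; $[g,X]=\{[g,x]:x\in X\}$ is the set of commutators. **Finite groups.** Let $H$ be a finite group. A Brauer pair for $kH$ is a pair $(P,e)$ with $P\le H$ a $p$-subgroup and $e$ a primitive idempotent of $Z(kC_H(P))$. For $p$-subgroups $P\unlhd Q$ of $H$ the Brauer map $\mathrm{Br}_Q: Z(kC_H(P))^Q\to Z(kC_H(Q))$ sends $\sum_{g\in C_H(P)}a_g g$ to $\sum_{g\in C_H(Q)}a_g g$. If $(Q,f)$ is a Brauer pair and $P\unlhd Q$, there is a unique $Q$-stable primitive idempotent $e$ of $Z(kC_H(P))$ with $\mathrm{Br}_Q(e)f=f$; one declares $(P,e)\le(Q,f)$, and $\le$ is the transitive closure of this relation (a partial order). For every $P\le Q$ there is a unique $e$ with $(P,e)\le (Q,f)$. A block idempotent is a primitive idempotent of the centre of the group algebra. For a block idempotent $c$ of $kH$, an $(H,c)$-Brauer pair is a Brauer pair $(P,e)$ with $(1,c)\le(P,e)$; the first components of the maximal ones are exactly the defect groups of $kHc$. Given a maximal $(H,c)$-Brauer pair $(D,e)$ and, for $Q\le D$, the unique $(Q,e_Q)\le(D,e)$, the block fusion system $\mathcal F_{(D,e)}(H,c)$ has as objects the subgroups of $D$, and $\mathrm{Hom}(P,Q)$ consists of the homomorphisms $x\mapsto x^g$ with $g\in H$ and $(P^g,e_P^g)\le(Q,e_Q)$. It is a saturated fusion system. **Quotients and inverse limits.** A subgroup $S\le P$ is strongly closed in a fusion system $\mathcal F$ on a finite $p$-group $P$ if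 $\varphi(Q)\le S$ for all $Q\le S$ and $\varphi\in\mathrm{Hom}_{\mathcal F}(Q,P)$. Then $\mathcal F/S$ is the fusion system on $P/S$ in which $\mathrm{Hom}_{\mathcal F/S}(Q/S,R/S)$ is the image of $\mathrm{Hom}_{\mathcal F}(Q,R)$, for $S\le Q,R\le P$; the same definition is used for $\mathcal F_{(D,\hat e)}(G,b)/(D\cap N_i)$ below. A morphism of fusion systems from $\mathcal F$ on $P$ to $\mathcal F'$ on $P'$ is a homomorphism $\alpha:P\to P'$ together with a functor $\Phi$ with $\Phi(R)=\alpha(R)$ and $\Phi(\varphi)\circ\alpha=\alpha\circ\varphi$. For an inverse system of fusion systems $\mathcal F_i$ on finite $p$-groups $P_i$ with $P=\varprojlim P_i$, $\varprojlim\mathcal F_i$ is the category whose objects are the closed subgroups of $P$ and with $\mathrm{Hom}(R,S)=\varprojlim_i\mathrm{Hom}_{\mathcal F_i}(R_i,S_i)$, $R_i,S_i$ being the images in $P_i$. **The maps $\nu^-$.** Let $H$ be finite, $N\unlhd H$, $\nu:kH\to kH/N$ the natural map, and $Q\le H$ a $p$-subgroup such that $Q\cap N$ is a Sylow $p$-subgroup of $N$. Put $C_{Q,N}=\{g\in H: [g,Q]\subseteq Q\cap N\}$. For each primitive idempotent $c$ of $Z(kC_{H/N}(QN/N))$, $\nu^-_Q(c)$ is the unique primitive idempotent of $Z(kC_H(Q))^{C_{Q,N}}$ with $\nu(\nu^-_Q(c))\cdot c=c$. **Blocks of profinite groups.** $k[[G]]=\varprojlim_N k[G/N]$ over the open normal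 subgroups $N$; a block idempotent is a primitive idempotent of $Z(k[[G]])$. A defect group of $k[[G]]b$ is a closed pro-$p$ subgroup $D$ of $G$, unique up to conjugation, characterized as follows: there are an open normal subgroup $N_0$ of $G$ and a block idempotent $b_0\in Z(kG/N_0)$ such that the image of $b$ in $kG/N_0$ has non-zero product with $b_0$, and for every open normal subgroup $N\subseteq N_0$ of $G$ the block $k(G/N)b_N$ has defect group $DN/N$, where $b_N$ is the unique block idempotent of $Z(kG/N)$ whose image in $Z(kG/N_0)$ has non-zero product with $b_0$. Put $b_i=b_{N_i}$ whenever $N_i\subseteq N_0$. **Brauer pairs for profinite groups.** A Brauer pair for $k[[G]]$ is a pair $(P,\hat e)$ where $P$ is an open subgroup of a Sylow $p$-subgroup of $G$ and $\hat e=[(e_i)_{i\in\mathbb N}]_\sim$ is an equivalence class of sequences of primitive idempotents $e_i\in Z(kC_{G/N_i}(PN_i/N_i))$ (equivalent if equal in all but finitely many terms), such that for all but finitely many $i$ for which $N_i\cap P$ is a Sylow $p$-subgroup of $N_i$ one has $\nu^-_{PN_{i+1}/N_{i+1}}(e_i)\cdot e_{i+1}\ne0$ (with $\nu^-$ taken for the finite group $G/N_{i+1}$ and its normal subgroup $N_i/N_{i+1}$). Put $(P,\hat e)\le(Q,\hat f)$ if $(PN_i/N_i,e_i)\le(QN_i/N_i,f_i)$ for all but finitely many $i$. $G$ acts by conjugation. A Brauer pair $(P,\hat e)$ is a $(G,b)$-Brauer pair if $(1,b_i)\le(PN_i/N_i,e_i)$ for all but finitely many $i$. **The category $\mathcal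 F_{(D,\hat e)}(G,b)$.** For each open $P\le D$ let $(P,\hat e_P)$ be the unique Brauer pair with $(P,\hat e_P)\le(D,\hat e)$. The objects are the open subgroups of $D$, and $\mathrm{Hom}(P,Q)$ is the set of homomorphisms $P\to Q$, $x\mapsto x^g$, induced by elements $g\in G$ with $(P,\hat e_P)^g\le(Q,\hat e_Q)$. **Identifications.** One has $(D\cap N_i)N_{\mu(i)}=DN_{\mu(i)}\cap N_i$, so $\mathcal F_{\mu(i)}/((D\cap N_i)N_{\mu(i)}/N_{\mu(i)})$ is regarded as a fusion system on $DN_{\mu(i)}/(DN_{\mu(i)}\cap N_i)\cong DN_i/N_i\cong D/(D\cap N_i)$. The inverse system is formed with the morphisms induced by the natural projections $DN_j/N_j\to DN_i/N_i$ ($j\ge i$). The displayed equality with the inverse limit is an equality of categories on the open subgroups of $D$, via the natural maps on Hom-sets (the inverse limit being restricted to open subgroups). *)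

(* Defs.v *)
From HB Require Import structures.
From Stdlib Require Import Relation_Operators.
From mathcomp Require Import all_boot all_algebra all_fingroup all_solvable.
From mathcomp Require Import generic_quotient.
From mathcomp Require Import all_classical topology.

Set Implicit Arguments.
Unset Strict Implicit.
Unset Printing Implicit Defensive.

Import GRing.Theory.
Local Open Scope classical_set_scope.
Local Open Scope quotient_scope.
Local Open Scope group_scope.

(* Homomorphisms between subgroups are represented by functions on the ambient
   groups, and Hom-sets are closed under changing such a function outside its
   source; hence equality of Hom-sets is equality of sets of homomorphisms. *)

Definition subgroup (gT : groupType) (A : set gT) : Prop :=
  A 1 /\ forall x y, A x -> A y -> A (x * y^-1).

Definition conj_set (gT : groupType) (A : set gT) (g : gT) : set gT :=
  (fun x => x ^ g) @` A.

Definition asfin (gT : finGroupType) (A : set gT) : {set gT} :=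
  [set x | x \in A]%SET.

HB.mixin Record isProfiniteGroup G of monoid.Group G & Topological G := {
  mulg_continuous : continuous (fun x : G * G => x.1 * x.2);
  invg_continuous : continuous (fun x : G => x^-1);
  profinite_compact : compact [set: G];
  profinite_hausdorff : hausdorff_space G;
  profinite_disconnected : totally_disconnected [set: G]
}.

#[short(type="profiniteGroupType")]
HB.structure Definition ProfiniteGroup :=
  {G of monoid.Group G & Topological G & isProfiniteGroup G}.

Record openNormal (G : profiniteGroupType) := OpenNormal {
  on_set :> set G;
  on_open : open on_set;
  on_subgroup : subgroup on_set;
  on_normal : forall x g, on_set x -> on_set (x ^ g)
}.

Section Quotient.
Variables (G : profiniteGroupType) (N : openNormal G).
Implicit Types x y z : G.

Lemma on1 : on_set N 1. Proof. by case: (on_subgroup N). Qed.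

Lemma onV x : on_set N x -> on_set N x^-1.
Proof.
by case: (on_subgroup N) => n1 nd nx; rewrite -[x^-1]mul1g; apply: nd.
Qed.

Lemma onM x y : on_set N x -> on_set N y -> on_set N (x * y).
Proof.
move=> nx ny; rewrite -[y]invgK; case: (on_subgroup N) => _; apply=> //.
exact: onV.
Qed.

Definition on_rel x y : bool := `[< on_set N (x^-1 * y) >].

Lemma on_rel_equiv : equiv_class_of on_rel.
Proof.
split=> [x|x y|y x z].
- by apply/asboolP; rewrite mulVg; exact: on1.
- by apply/asboolP/asboolP => /onV; rewrite invgM invgK.
- move=> /asboolP xy /asboolP yz; apply/asboolP.
  by have := onM xy yz; rewrite -mulgA mulKVg.
Qed.

Canonical on_rel_equiv_rel := EquivRelPack on_rel_equiv.

(* The finite group G/N. *)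
Definition quo := {eq_quot on_rel}.
HB.instance Definition _ := Choice.on quo.

Definition qproj (x : G) : quo := \pi_quo x.

Lemma qproj_eq x y : (qproj x = qproj y) <-> on_set N (x^-1 * y).
Proof.
by split=> [/eqP|h]; [|apply/eqP]; rewrite /qproj /quo eqmodE /= ?asboolE.
Qed.

Lemma qreprK (u : quo) : qproj (repr u) = u.
Proof. exact: reprK. Qed.

Definition qmul (u v : quo) : quo := qproj (repr u * repr v).
Definition qinv (u : quo) : quo := qproj (repr u)^-1.

Lemma qprojM x y : qproj (x * y) = qmul (qproj x) (qproj y).
Proof.
apply/qproj_eq.
have /qproj_eq hx := esym (qreprK (qproj x)).
have /qproj_eq hy := esym (qreprK (qproj y)).
move: (repr _) (repr _) hx hy => x' y' hx hy.
have := onM (on_normal y hx) hy.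
by rewrite conjgE invgM !mulgA mulgK.
Qed.

Lemma qprojV x : qproj x^-1 = qinv (qproj x).
Proof.
apply/qproj_eq.
have /qproj_eq := qreprK (qproj x); move: (repr _) => x' hx.
have := on_normal x^-1 hx.
by rewrite conjgE mulgK.
Qed.

Lemma qmulA : associative qmul.
Proof.
move=> u v w; rewrite -(qreprK u) -(qreprK v) -(qreprK w).
by rewrite -!qprojM mulgA.
Qed.

Lemma qmul1 : left_id (qproj 1) qmul.
Proof. by move=> u; rewrite -(qreprK u) -!qprojM mul1g. Qed.

Lemma qmulV : left_inverse (qproj 1) qinv qmul.
Proof. by move=> u; rewrite -(qreprK u) -qprojV -!qprojM mulVg. Qed.

Lemma quo_finite : finite_set [set: quo].
Proof.
have opF (u : quo) : [set: quo] u -> open (@qproj @^-1` [set u]).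
  move=> _; have -> : qproj @^-1` [set u] =
      (fun x : G => (repr u)^-1 * x) @^-1` N.
    apply/seteqP; split=> x /=.
      by move=> <-; apply/qproj_eq; rewrite qreprK.
    by move/qproj_eq => <-; rewrite qreprK.
  apply: open_comp; last exact: on_open.
  move=> x _.
  apply: (@continuous2_cvg _ _ _ _ _ _ (fun=> (repr u)^-1) id
    (fun a b : G => a * b)); [exact: (mulg_continuous (_, _)) | exact: cvg_cst |].
  exact: cvg_id.
have cpt : @compact (G : topologicalType) setT := profinite_compact.
pose Gp : ptopologicalType :=
  HB.pack (G : Type) (Topological.class G) (isPointed.Build G 1).
have cvr : @cover_compact Gp setT by rewrite -compact_cover.
have [|A _ hA] := cvr quo setT _ opF.
  by move=> x _; exists (qproj x).
apply: (sub_finite_set _ (finite_fset A)).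
by move=> u _; have [v hv /=] := hA (repr u) I; rewrite qreprK => ->.
Qed.

Lemma quo_enum : {s : seq quo | forall u, u \in s}.
Proof.
apply: cid; have /finite_fsetP [A hA] := quo_finite.
exists (finmap.enum_fset A) => u; have : [set: quo] u by [].
by rewrite hA.
Qed.

Definition quo_seq_sub (u : quo) : seq_sub (sval quo_enum) :=
  SeqSub (svalP quo_enum u).

Lemma quo_seq_subK : cancel quo_seq_sub val.
Proof. by []. Qed.

HB.instance Definition _ := Countable.copy quo (can_type quo_seq_subK).
HB.instance Definition _ : isFinite quo := CanIsFinite quo_seq_subK.
HB.instance Definition _ := Finite_isGroup.Build quo qmulA qmul1 qmulV.

Lemma qprojMg x y : qproj (x * y) = qproj x * qproj y.
Proof. exact: qprojM. Qed.

End Quotient.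

Section Projections.
Variable G : profiniteGroupType.
Implicit Types M N : openNormal G.

(* The natural map G/M -> G/N, for M contained in N. *)
Definition qmap M N (u : quo M) : quo N := qproj N (repr u).

Lemma qmapE M N (x : G) : M `<=` N -> qmap N (qproj M x) = qproj N x.
Proof.
by move=> sMN; apply/qproj_eq/sMN/qproj_eq; rewrite qreprK.
Qed.

(* DN/N *)
Definition qimg N (D : set G) : {set quo N} := asfin (qproj N @` D).

End Projections.

Section GroupAlgebra.
Variables (k : closedFieldType) (H : finGroupType).
Local Open Scope ring_scope.

(* kH, as functions H -> k with the convolution product. *)
Definition galg := {ffun H -> k}.
HB.instance Definition _ := GRing.Zmodule.on galg.
Implicit Types a b c : galg.

Definition galg_one : galg := [ffun x => (x == 1%g)%:R].
Definition galg_mul a b : galg := [ffun x => \sum_y a y * b (y^-1 * x)%g].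

Lemma galg_mulA : associative galg_mul.
Proof.
move=> a b c; apply/ffunP => x; rewrite !ffunE.
under eq_bigr do rewrite ffunE big_distrr.
under [RHS]eq_bigr do rewrite ffunE big_distrl.
rewrite [RHS]exchange_big; apply: eq_bigr => y _ /=.
rewrite [RHS](reindex_inj (mulgI y)) /=.
by apply: eq_bigr => z _; rewrite mulrA mulKg invMg mulgA.
Qed.

Lemma galg_mul1l : left_id galg_one galg_mul.
Proof.
move=> a; apply/ffunP => x; rewrite ffunE (bigD1 1%g) //= ffunE eqxx mul1r.
rewrite invg1 mul1g big1 ?addr0 // => y /negbTE y1.
by rewrite ffunE y1 mul0r.
Qed.

Lemma galg_mul1r : right_id galg_one galg_mul.
Proof.
move=> a; apply/ffunP => x; rewrite ffunE (bigD1 x) //= ffunE mulVg eqxx mulr1.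
rewrite big1 ?addr0 // => y yx; rewrite ffunE -eq_mulVg1.
by rewrite (negbTE yx) mulr0.
Qed.

Lemma galg_mulDl : left_distributive galg_mul +%R.
Proof.
move=> a b c; apply/ffunP => x; rewrite !ffunE -big_split.
by apply: eq_bigr => y _; rewrite ffunE mulrDl.
Qed.

Lemma galg_mulDr : right_distributive galg_mul +%R.
Proof.
move=> a b c; apply/ffunP => x; rewrite !ffunE -big_split.
by apply: eq_bigr => y _; rewrite ffunE mulrDr.
Qed.

Lemma galg_one_neq0 : galg_one != 0.
Proof.
by apply/eqP => /ffunP /(_ 1%g) /eqP; rewrite !ffunE eqxx oner_eq0.
Qed.

HB.instance Definition _ := GRing.Zmodule_isNzRing.Build galg
  galg_mulA galg_mul1l galg_mul1r galg_mulDl galg_mulDr galg_one_neq0.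

End GroupAlgebra.

(* The linear extension kH -> kK of a map H -> K. *)
Definition push (k : closedFieldType) (H K : finGroupType) (f : H -> K)
    (a : galg k H) : galg k K :=
  [ffun y => \sum_(x | f x == y) a x]%R.

Section Push.
Variables (k : closedFieldType) (H K : finGroupType) (f : H -> K).
Hypothesis fM : {morph f : x y / x * y}.
Implicit Types a b : galg k H.
Local Open Scope ring_scope.

Lemma push0 : push f (0 : galg k H) = 0.
Proof. by apply/ffunP => y; rewrite !ffunE big1 // => x; rewrite ffunE. Qed.

Lemma pushD a b : push f (a + b) = push f a + push f b.
Proof.
apply/ffunP => y; rewrite !ffunE -big_split.
by apply: eq_bigr => x _; rewrite ffunE.
Qed.

Lemma pushN a : push f (- a) = - push f a.
Proof.
apply/ffunP => y; rewrite !ffunE -sumrN.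
by apply: eq_bigr => x _; rewrite ffunE.
Qed.

Lemma fV1 : (f 1 = 1)%g.
Proof. by apply: (mulgI (f 1%g)); rewrite -fM !mulg1. Qed.

Lemma fV x : (f x^-1 = (f x)^-1)%g.
Proof. by apply: (mulgI (f x)); rewrite -fM !mulgV fV1. Qed.

Lemma push1 : push f (1 : galg k H) = 1.
Proof.
apply/ffunP => y; rewrite !ffunE.
case: (eqVneq y 1%g) => [->|ny].
  rewrite (bigD1 1%g) ?fV1 //= ffunE eqxx big1 ?addr0 // => x /andP [_ nx].
  by rewrite ffunE (negbTE nx).
rewrite big1 // => x /eqP fx; rewrite ffunE; case: (eqVneq x 1%g) => // x1.
by move: ny; rewrite -fx x1 fV1 eqxx.
Qed.

Lemma pushM a b : push f (a * b) = push f a * push f b.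
Proof.
apply/ffunP => y; rewrite !ffunE.
under eq_bigr do rewrite ffunE.
under [RHS]eq_bigr do rewrite !ffunE big_distrl.
rewrite exchange_big [RHS](exchange_big_dep predT) //=.
apply: eq_bigr => u _.
rewrite [RHS](big_pred1 (f u)) => [|z]; last by rewrite eq_sym.
rewrite big_distrr (reindex_inj (mulgI u)) /=; apply: eq_big => v.
  by rewrite fM -(inj_eq (mulgI (f u)^-1%g)) mulKg.
by rewrite mulKg.
Qed.

End Push.

Section CompletedGroupAlgebra.
Variables (k : closedFieldType) (G : profiniteGroupType).
Local Open Scope ring_scope.

Record cgalg := Cgalg {
  cg_at :> forall N : openNormal G, galg k (quo N);
  cg_compat : forall M N : openNormal G, M `<=` N -> push (qmap N) (cg_at M) = cg_at N
}.

Lemma cgalg_ext (a b : cgalg) : (forall N, a N = b N) -> a = b.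
Proof.
case: a b => [a ha] [b hb] /= eab.
have e : a = b by apply: functional_extensionality_dep.
by case: _ / e hb => hb; rewrite (Prop_irrelevance ha hb).
Qed.

Lemma qmapM (M N : openNormal G) : M `<=` N ->
  {morph (@qmap G M N) : x y / (x * y)%g}.
Proof.
move=> sMN x y; rewrite -(qreprK x) -(qreprK y) -qprojMg.
by rewrite !(qmapE _ sMN) qprojMg.
Qed.

HB.instance Definition _ := gen_eqMixin cgalg.
HB.instance Definition _ := gen_choiceMixin cgalg.

Program Definition cg_zero := @Cgalg (fun _ => 0) _.
Next Obligation. by move=> M N _; exact: push0. Qed.
Program Definition cg_one := @Cgalg (fun _ => 1) _.
Next Obligation. by move=> M N h; exact: (push1 _ (qmapM h)). Qed.
Program Definition cg_opp (a : cgalg) := @Cgalg (fun N => - a N) _.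
Next Obligation. by move=> a M N h /=; rewrite pushN (cg_compat a h). Qed.
Program Definition cg_add (a b : cgalg) := @Cgalg (fun N => a N + b N) _.
Next Obligation. by move=> a b M N h /=; rewrite pushD !cg_compat. Qed.
Program Definition cg_mul (a b : cgalg) := @Cgalg (fun N => a N * b N) _.
Next Obligation.
by move=> a b M N h /=; rewrite (pushM (qmapM h)) !cg_compat.
Qed.

Lemma cg_addA : associative cg_add.
Proof. by move=> a b c; apply: cgalg_ext => N /=; rewrite addrA. Qed.
Lemma cg_addC : commutative cg_add.
Proof. by move=> a b; apply: cgalg_ext => N /=; rewrite addrC. Qed.
Lemma cg_add0 : left_id cg_zero cg_add.
Proof. by move=> a; apply: cgalg_ext => N /=; rewrite add0r. Qed.
Lemma cg_addN : left_inverse cg_zero cg_opp cg_add.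
Proof. by move=> a; apply: cgalg_ext => N /=; rewrite addNr. Qed.
Lemma cg_mulA : associative cg_mul.
Proof. by move=> a b c; apply: cgalg_ext => N /=; rewrite mulrA. Qed.
Lemma cg_mul1l : left_id cg_one cg_mul.
Proof. by move=> a; apply: cgalg_ext => N /=; rewrite mul1r. Qed.
Lemma cg_mul1r : right_id cg_one cg_mul.
Proof. by move=> a; apply: cgalg_ext => N /=; rewrite mulr1. Qed.
Lemma cg_mulDl : left_distributive cg_mul cg_add.
Proof. by move=> a b c; apply: cgalg_ext => N /=; rewrite mulrDl. Qed.
Lemma cg_mulDr : right_distributive cg_mul cg_add.
Proof. by move=> a b c; apply: cgalg_ext => N /=; rewrite mulrDr. Qed.

HB.instance Definition _ :=
  GRing.isZmodule.Build cgalg cg_addA cg_addC cg_add0 cg_addN.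
HB.instance Definition _ := GRing.Zmodule_isPzRing.Build cgalg
  cg_mulA cg_mul1l cg_mul1r cg_mulDl cg_mulDr.

End CompletedGroupAlgebra.

Definition center_of (R : pzRingType) (A : set R) : set R :=
  [set z | A z /\ forall a, A a -> z * a = a * z]%R.

(* Primitive idempotents of the subring Z (whose unit need not be checked: it
   plays no role in the definition). *)
Definition primitive_idem (R : pzRingType) (Z : set R) (e : R) : Prop :=
  ([/\ Z e, e <> 0, e * e = e &
    forall f g, Z f -> Z g -> f * f = f -> g * g = g ->
      f * g = 0 -> g * f = 0 -> e = f + g -> f = 0 \/ g = 0])%R.

Definition block_idem (R : pzRingType) (e : R) : Prop :=
  primitive_idem (center_of [set: R]) e.

Section FiniteGroup.
Variables (k : closedFieldType) (p : nat) (H : finGroupType).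
Implicit Types (P Q A : {set H}) (a e f : galg k H).

(* kA inside kH, for a subgroup A of H. *)
Definition galg_on A : set (galg k H) :=
  [set a | forall x, x \notin A -> a x = 0%R].

Definition ZkC P : set (galg k H) := center_of (galg_on 'C(P)).

Definition galg_conj (g : H) a : galg k H := push (fun x => x ^ g) a.

Definition fixed_by A : set (galg k H) :=
  [set a | forall g, g \in A -> galg_conj g a = a].

Definition Br Q a : galg k H := [ffun x => if x \in 'C(Q) then a x else 0%R].

Definition bpair : Type := ({set H} * galg k H)%type.

Definition is_bpair (x : bpair) : Prop :=
  [/\ group_set x.1, p.-group x.1 & primitive_idem (ZkC x.1) x.2].

Definition bp_normal (x y : bpair) : Prop :=
  [/\ is_bpair x, is_bpair y, x.1 <| y.1, fixed_by y.1 x.2 &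
    (Br y.1 x.2 * y.2 = y.2)%R].

(* Reflexive on Brauer pairs, since bp_normal is. *)
Definition bp_le : bpair -> bpair -> Prop := clos_trans bpair bp_normal.

Definition bp_conj (x : bpair) (g : H) : bpair := (x.1 :^ g, galg_conj g x.2).

Definition block_bpair (c : galg k H) (x : bpair) : Prop :=
  is_bpair x /\ bp_le ([set 1]%SET, c) x.

Definition max_block_bpair (c : galg k H) (x : bpair) : Prop :=
  block_bpair c x /\ forall y, block_bpair c y -> bp_le x y -> y = x.

Definition block_defect_group (c : galg k H) P : Prop :=
  exists e, max_block_bpair c (P, e).

End FiniteGroup.

(* The map nu^-_Q for the normal subgroup N = ker nu of H, where H/N is given
   as the image K of a surjective morphism nu : H -> K. *)
Section NuMinus.
Variables (k : closedFieldType) (H K : finGroupType) (nu : H -> K).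

Definition CQN (Q : {set H}) : {set H} :=
  [set g | [forall x in Q, ([~ g, x] \in Q) && (nu [~ g, x] == 1)]]%SET.

Definition nu_minus (Q : {set H}) (c : galg k K) : galg k H :=
  xget 0%R [set f | primitive_idem (ZkC Q `&` fixed_by (CQN Q)) f /\
                  (push nu f * c = c)%R].

End NuMinus.

(* A fusion system on the group fus_grp, a subgroup of gT. *)
Record fusion (gT : groupType) := Fusion {
  fus_grp : set gT;
  fus_obj : set (set gT);
  fus_hom : set gT -> set gT -> set (gT -> gT)
}.

Definition strongly_closed (gT : groupType) (F : fusion gT) (S : set gT) :=
  [/\ subgroup S, S `<=` fus_grp F &
    forall Q f, fus_obj F Q -> Q `<=` S -> fus_hom F Q (fus_grp F) f ->
      f @` Q `<=` S].

(* F/S, transported to the image of the group P of F under al : gT -> rT; here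
   al is a morphism on P with kernel S, so that this image is P/S and the
   subgroups Q of P containing S correspond to their images al(Q) = Q/S. *)
Definition quot_fusion (gT rT : groupType) (al : gT -> rT) (S : set gT)
    (F : fusion gT) : fusion rT :=
  Fusion (al @` fus_grp F)
    [set Qb | exists Q, [/\ fus_obj F Q, S `<=` Q & Qb = al @` Q]]
    (fun Qb Rb => [set fb | exists Q R f,
      [/\ (fus_obj F Q /\ fus_obj F R), (S `<=` Q /\ S `<=` R),
          (Qb = al @` Q /\ Rb = al @` R), fus_hom F Q R f &
          forall x, Q x -> fb (al x) = al (f x)]]).

(* al : gT -> rT induces a morphism of fusion systems; the functor is unique if
   it exists, as its effect on morphisms is determined by al. *)
Definition fusion_morphism (gT rT : groupType) (F : fusion gT)
    (F' : fusion rT) (al : gT -> rT) : Prop :=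
  [/\ forall x y, fus_grp F x -> fus_grp F y -> al (x * y) = al x * al y,
      al @` fus_grp F `<=` fus_grp F',
      forall R, fus_obj F R -> fus_obj F' (al @` R) &
      forall R S f, fus_obj F R -> fus_obj F S -> fus_hom F R S f ->
        exists2 f', fus_hom F' (al @` R) (al @` S) f' &
          forall x, R x -> f' (al x) = al (f x)].

Section InverseLimit.
Variables (gT : groupType) (T : nat -> finGroupType) (i0 : nat).
Variables (al : forall i, gT -> T i) (pr : forall j i, T j -> T i).
Variables (F : fusion gT) (Fi : forall i, fusion (T i)).
Local Arguments pr : clear implicits.

(* Elements of lim_(i >= i0) Hom_(Fi i)(R_i, S_i); the components of index
   less than i0 are irrelevant. *)
Definition lim_hom (R S : set gT) : set (forall i, T i -> T i) :=
  [set f | (forall i, (i0 <= i)%N ->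
              fus_hom (Fi i) (al i @` R) (al i @` S) (f i)) /\
           (forall i j x, (i0 <= i <= j)%N -> (al j @` R) x ->
              f i (pr j i x) = pr j i (f j x))].

(* F is the inverse limit of the Fi, i >= i0, along pr, restricted to the
   objects of F and via the natural maps al: the Fi form an inverse system, the
   group of F is the limit of the groups of the Fi, and the natural maps
   Hom_F(R, S) -> lim Hom_(Fi i)(R_i, S_i) are well defined and bijective. *)
Definition is_invlim : Prop :=
  [/\ forall i j, (i0 <= i <= j)%N -> fusion_morphism (Fi j) (Fi i) (pr j i),
      forall i j x, (i0 <= i <= j)%N -> fus_grp F x ->
        pr j i (al j x) = al i x,
      forall u : forall i, T i,
        (forall i, (i0 <= i)%N -> fus_grp (Fi i) (u i)) ->
        (forall i j, (i0 <= i <= j)%N -> pr j i (u j) = u i) ->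
        exists! x, fus_grp F x /\ forall i, (i0 <= i)%N -> al i x = u i,
      forall i, (i0 <= i)%N -> fusion_morphism F (Fi i) (al i) &
      forall R S, fus_obj F R -> fus_obj F S ->
        forall f, lim_hom R S f ->
        exists phi,
          let lifts psi := fus_hom F R S psi /\ forall i x, (i0 <= i)%N ->
            R x -> f i (al i x) = al i (psi x) in
          lifts phi /\
          forall psi, lifts psi -> forall x, R x -> psi x = phi x].

End InverseLimit.

(* F_(D,e)(H,c), for a maximal (H,c)-Brauer pair (D,e). *)
Definition block_fusion (k : closedFieldType) (p : nat) (H : finGroupType)
    (De : bpair k H) : fusion H :=
  Fusion [set` De.1] [set P | subgroup P /\ P `<=` [set` De.1]]
    (fun P Q => [set f | exists g eP eQ,
      [/\ bp_le p (asfin P, eP) De, bp_le p (asfin Q, eQ) De,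
          bp_le p (bp_conj (asfin P, eP) g) (asfin Q, eQ) &
          forall x, P x -> f x = x ^ g]]).

Section Profinite.
Variables (k : closedFieldType) (p : nat) (G : profiniteGroupType).
Implicit Types (P Q D S : set G) (M : openNormal G).

Definition pro_p D : Prop := forall M, p.-group (qimg M D).

(* Sylow p-subgroups of a closed subgroup A of G *)
Definition profinite_Sylow (A S : set G) : Prop :=
  [/\ subgroup S, closed S, S `<=` A &
    forall M, p.-Sylow(qimg M A) (qimg M S)].

Definition open_subgroup_of D P : Prop :=
  subgroup P /\ exists2 U, open U & P = D `&` U.

(* b_M, for M contained in N0 *)
Definition block_over (N0 : openNormal G) (b0 : galg k (quo N0)) M :
    galg k (quo M) :=
  xget 0%R [set c | block_idem c /\ (push (qmap N0) c * b0 <> 0)%R].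

(* D is a defect group of k[[G]]b, as witnessed by N0 and b0. *)
Definition defect_group (b : cgalg k G) D (N0 : openNormal G)
    (b0 : galg k (quo N0)) : Prop :=
  [/\ subgroup D /\ closed D, pro_p D,
      block_idem b0 /\ (b N0 * b0 <> 0)%R &
      forall M, M `<=` N0 ->
        block_defect_group p (block_over b0 M) (qimg M D)].

Variable N : nat -> openNormal G.

(* A class [(e_i)]_~ is given by a representative; equality of classes is
   idem_seq_eq. *)
Definition idem_seq : Type := forall i, galg k (quo (N i)).
Implicit Types e f : idem_seq.

Definition idem_seq_eq e f : Prop := \forall i \near \oo, e i = f i.

Definition is_pbpair P e : Prop :=
  [/\ exists2 S, profinite_Sylow setT S & open_subgroup_of S P,
      forall i, primitive_idem (ZkC (qimg (N i) P)) (e i) &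
      \forall i \near \oo, profinite_Sylow (N i) (N i `&` P) ->
        (nu_minus (qmap (M := N i.+1) (N i)) (qimg (N i.+1) P) (e i)
           * e i.+1 <> 0)%R].

Definition pbp_le P e Q f : Prop :=
  \forall i \near \oo, bp_le p (qimg (N i) P, e i) (qimg (N i) Q, f i).

Definition idem_seq_conj e (g : G) : idem_seq :=
  fun i => galg_conj (qproj (N i) g) (e i).

Section Block.
Variables (N0 : openNormal G) (b0 : galg k (quo N0)).

Definition block_pbpair P e : Prop :=
  is_pbpair P e /\ \forall i \near \oo,
    bp_le p ([set 1]%SET, block_over b0 (N i)) (qimg (N i) P, e i).

Definition max_block_pbpair P e : Prop :=
  block_pbpair P e /\ forall Q f, block_pbpair Q f -> pbp_le P e Q f ->
    Q = P /\ idem_seq_eq f e.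

End Block.

(* F_(D,e)(G,b), for a maximal (G,b)-Brauer pair (D,e). *)
Definition profinite_fusion D e : fusion G :=
  Fusion D [set P | open_subgroup_of D P]
    (fun P Q => [set phi | exists g eP eQ,
      [/\ (open_subgroup_of D P /\ open_subgroup_of D Q),
          (is_pbpair P eP /\ pbp_le P eP D e),
          (is_pbpair Q eQ /\ pbp_le Q eQ D e),
          pbp_le (conj_set P g) (idem_seq_conj eP g) Q eQ &
          forall x, P x -> phi x = x ^ g]]).

Definition level_fusion D e (i : nat) : fusion (quo (N i)) :=
  block_fusion p (qimg (N i) D, e i).

Definition level_defined (N0 : openNormal G) (b0 : galg k (quo N0)) D e
    (i : nat) : Prop :=
  N i `<=` N0 /\ max_block_bpair p (block_over b0 (N i)) (qimg (N i) D, e i).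

(* (D n N_i)N_m/N_m *)
Definition level_ker D (m i : nat) : set (quo (N m)) :=
  qproj (N m) @` (D `&` N i).
Arguments level_ker : clear implicits.

Lemma level_kerE D m i : N m `<=` N i -> level_ker D m i =
  [set u | u \in qimg (N m) D /\ qmap (N i) u = 1].
Proof.
move=> sNmi; apply/seteqP; split=> u /=.
  move=> [x [Dx Nx] <-]; rewrite inE; split; first exact/mem_set/imageP.
  rewrite qmapE //; apply/qproj_eq.
  by rewrite mulg1; apply: onV.
rewrite inE => -[/set_mem [x Dx <-]]; rewrite qmapE // => /qproj_eq.
by rewrite mulg1 => /onV; rewrite invgK => Nx; exists x.
Qed.

(* F_m/((D n N_i)N_m/N_m) for m >= i, as a fusion system on DN_i/N_i *)
Definition level_quot D e (m i : nat) : fusion (quo (N i)) :=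
  quot_fusion (qmap (N i)) (level_ker D m i) (level_fusion D e m).

End Profinite.

Arguments level_ker {G} N D m i.

(* Main.v *)
From HB Require Import structures.
From Stdlib Require Import Relation_Operators Operators_Properties.
Require Import Defs.
From mathcomp Require Import all_classical topology.
From mathcomp Require Import all_boot all_algebra all_fingroup all_solvable.

Set Implicit Arguments.
Unset Strict Implicit.
Unset Printing Implicit Defensive.

Import GRing.Theory.

(** For an open subgroup [Q] of [D] let [Q_j] be its image in [G/N_j] and [e_Q,j]
    the idempotent of the unique Brauer pair on [Q_j] below [(D_j, e_j)]. Say
    that [g] transports [Q] to [R] at level [j] if it conjugates
    [(Q_j, e_Q,j)] below [(R_j, e_R,j)]. Morphisms of the profinite fusion
    system are the conjugations by elements that transport at almost all
    levels ([profinite_homP]), and morphisms of the fusion system at level [j]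
    are the conjugations by elements that transport at this level
    ([level_homP]). The theorem therefore compares transporters at different
    levels, for groups [Q] and [R] containing [D n N_i] with [i] so large that
    [D n N_i] is a Sylow subgroup of [N_i].

    Upwards, the condition linking [e_j] and [e_(j+1)] is that [e_j] is covered
    by [e_(j+1)] (the predicate [covers]); it is inherited by all subgroups
    ([covers_le]). Two idempotents covering the same one are conjugate by an
    element centralising [Q] modulo [N_j], so a transporter at level [j] can be
    changed into a transporter at level [j+1] that acts in the same way on [Q_j]
    ([transports_lift]).

    Downwards, a transporter at level [j+1] may fail to be one at level [j],
    because an idempotent can cover several others. But the images in [G/N_i]
    of the centralisers of the [Q_j] decrease with [j], and the images in the
    group algebra of [G/N_i] of the idempotents [e_Q,j] increase. Both sequences
    become constant, and from then on the covered idempotent is determined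
    ([transports_mono]). As only finitely many groups lie between [D n N_i] and
    [D], one level [mu i] serves them all. From this level on, lifting and
    compactness of [G] identify the quotient of the profinite fusion system with
    that of the level fusion system ([quot_fusion_level]).

    For the inverse limit one also needs that a morphism between arbitrary open
    subgroups [Q] and [R] extends, modulo [N_i], to the products of [Q] and [R]
    with [D n N_i] ([transports_saturate]). This rests on a form of Sylow's
    theorem for Brauer pairs ([sylow_bpair_conj]). Compatible families of
    morphisms are then realised by a single element of [G], again by
    compactness.

    The facts about a finite group that enter are the uniqueness of the Brauer
    pair on a given subgroup below a given pair ([bp_le_unique]) and the
    conjugacy of the maximal pairs of a block ([max_bpair_conj]), which is also
    why the pairs [(D_j, e_j)] are maximal ([block_bpair_defect_max]). *)

(** * Conjugation in group algebras *)

Section GroupAlgebraBasics.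
Variables (k : closedFieldType) (H : finGroupType).
Implicit Types (a b z : galg k H) (g h : H).
Local Open Scope ring_scope.

Lemma galg_conjE g a y : galg_conj g a y = a (y ^ g^-1)%g.
Proof.
rewrite ffunE (big_pred1 (y ^ g^-1)%g) // => x.
by rewrite (can2_eq (conjgK g) (conjgKV g)).
Qed.

Lemma galg_conj1 a : galg_conj 1%g a = a.
Proof. by apply/ffunP => y; rewrite galg_conjE invg1 conjg1. Qed.

Lemma galg_conj_comp g h a :
  galg_conj (g * h)%g a = galg_conj h (galg_conj g a).
Proof. by apply/ffunP => y; rewrite !galg_conjE invMg conjgM. Qed.

Lemma galg_conjK g : cancel (galg_conj g) (@galg_conj k H g^-1%g).
Proof. by move=> a; rewrite -galg_conj_comp mulgV galg_conj1. Qed.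

Lemma galg_conjKV g : cancel (@galg_conj k H g^-1%g) (galg_conj g).
Proof. by move=> a; rewrite -galg_conj_comp mulVg galg_conj1. Qed.

End GroupAlgebraBasics.

HB.instance Definition _ (k : closedFieldType) (H K : finGroupType)
    (f : H -> K) := GRing.isNmodMorphism.Build (galg k H) (galg k K) (push f)
  (conj (push0 k f) (pushD (k := k) f)).

HB.instance Definition _ (k : closedFieldType) (H : finGroupType) (g : H) :=
  GRing.isNmodMorphism.Build (galg k H) (galg k H) (galg_conj g)
  (conj (push0 k _) (pushD (k := k) _)).

HB.instance Definition _ (k : closedFieldType) (H : finGroupType) (g : H) :=
  GRing.isMonoidMorphism.Build (galg k H) (galg k H) (galg_conj g)
  (conj (push1 k (fun x y => conjMg x y g))
        (pushM (k := k) (fun x y => conjMg x y g))).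

(** * Primitive idempotents of commutative subalgebras *)

Section Subalgebras.
Variables (k : closedFieldType) (H : finGroupType).
Implicit Types (a b e f z : galg k H) (Z : set (galg k H)).
Local Open Scope ring_scope.

(** [kH] is used as a mere ring: that a set is closed under scaling is expressed
    by products with these elements. *)
Definition scal (c : k) : galg k H := [ffun x => c *+ (x == 1%g)].

Lemma scalM c a x : (scal c * a) x = c * a x.
Proof.
rewrite ffunE (bigD1 1%g) //= ffunE eqxx mulr1n invg1 mul1g big1 ?addr0 //.
by move=> y /negbTE y1; rewrite ffunE y1 mulr0n mul0r.
Qed.

Lemma scalMr c a x : (a * scal c) x = a x * c.
Proof.
rewrite ffunE (bigD1 x) //= ffunE mulVg eqxx mulr1n big1 ?addr0 // => y yx.
by rewrite ffunE -eq_mulVg1 (negbTE yx) mulr0n mulr0.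
Qed.

Record comm_subalg Z : Prop := CommSubalg {
  comm_subalg_scal : forall c, Z (scal c);
  comm_subalgB : forall a b, Z a -> Z b -> Z (a - b);
  comm_subalgM : forall a b, Z a -> Z b -> Z (a * b);
  comm_subalgC : forall a b, Z a -> Z b -> a * b = b * a
}.

Section Closure.
Variables (Z : set (galg k H)) (hZ : comm_subalg Z).

Lemma comm_subalg1 : Z 1.
Proof.
suff -> : 1 = scal 1 by apply: (comm_subalg_scal hZ).
by apply/ffunP => x; rewrite !ffunE; case: eqP.
Qed.

Lemma comm_subalg0 : Z 0.
Proof. by rewrite -(subrr 1); apply: (comm_subalgB hZ);
  apply: comm_subalg1. Qed.

Lemma comm_subalgN a : Z a -> Z (- a).
Proof. by move=> Za; rewrite -sub0r;
  apply: (comm_subalgB hZ) (comm_subalg0) _. Qed.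

Lemma comm_subalgD a b : Z a -> Z b -> Z (a + b).
Proof.
by move=> Za Zb; rewrite -[b]opprK;
  apply: (comm_subalgB hZ) Za (comm_subalgN _).
Qed.

Lemma comm_subalg_sum (I : Type) (r : seq I) (P : pred I) (F : I -> galg k H) :
  (forall i, P i -> Z (F i)) -> Z (\sum_(i <- r | P i) F i).
Proof.
by move=> ZF; elim/big_ind: _ => //; [apply: comm_subalg0|apply: comm_subalgD].
Qed.

Lemma comm_subalgX a n : Z a -> Z (a ^+ n).
Proof.
move=> Za; elim: n => [|n IH]; first by rewrite expr0; apply: comm_subalg1.
by rewrite exprS; apply: (comm_subalgM hZ).
Qed.

(** [e = e * f + e * (1 - f)] is an orthogonal decomposition. *)
Lemma primitive_idem_dich e f : primitive_idem Z e -> Z f -> f * f = f ->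
  e * f = 0 \/ e * f = e.
Proof.
move=> [Ze e0 ee ind] Zf ff.
have ef : e * f = f * e := comm_subalgC hZ Ze Zf.
have efef : e * f * (e * f) = e * f by rewrite mulrA -(mulrA e) -ef mulrA ee
  -mulrA ff.
have e_ef : e * (e * f) = e * f by rewrite mulrA ee.
have ef_e : e * f * e = e * f by rewrite -mulrA -ef.
have Zef := comm_subalgM hZ Ze Zf.
case: (ind (e * f) (e - e * f)) => //.
- exact: comm_subalgB.
- by rewrite mulrBl !mulrBr ee ef_e efef e_ef subrr subr0.
- by rewrite mulrBr ef_e efef subrr.
- by rewrite mulrBl e_ef efef subrr.
- by rewrite addrCA subrr addr0.
- by left.
- by move/subr0_eq; right.
Qed.

Lemma primitive_idem_eq e f : primitive_idem Z e -> primitive_idem Z f ->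
  e * f <> 0 -> e = f.
Proof.
move=> pe pf ef0.
have [Ze _ ee _] := pe; have [Zf _ ff _] := pf.
have [//|h1] := primitive_idem_dich pe Zf ff.
have := primitive_idem_dich pf Ze ee; rewrite (comm_subalgC hZ Zf Ze) h1.
by case=> // e0; case: ef0; rewrite h1.
Qed.

End Closure.

(** The row space of this matrix is the right ideal generated by [a], so that
    ranks detect strict inclusions of such ideals. *)
Definition lmul_mx a : 'M[k]_#|H| :=
  \matrix_(i, j) a (enum_val j * (enum_val i)^-1)%g.

Definition galg_row a : 'rV[k]_#|H| := \row_j a (enum_val j).
Definition row_galg (v : 'rV[k]_#|H|) : galg k H := [ffun x =>
  v 0 (enum_rank x)].

Lemma row_galgK v : galg_row (row_galg v) = v.
Proof. by apply/rowP => j; rewrite mxE ffunE enum_valK. Qed.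

Lemma galg_row_inj : injective galg_row.
Proof.
move=> a b ab; apply/ffunP => x; have /rowP/(_ (enum_rank x)) := ab.
by rewrite !mxE enum_rankK.
Qed.

Lemma galg_row_mul x a : galg_row x *m lmul_mx a = galg_row (a * x).
Proof.
apply/rowP => j; rewrite !mxE ffunE; set g := enum_val j.
under eq_bigr do rewrite !mxE.
have -> : \sum_(i < #|H|) x (enum_val i) * a (g * (enum_val i)^-1)%g =
    \sum_h x h * a (g * h^-1)%g.
  rewrite [RHS](reindex (@enum_val H H)) //.
  exact: onW_bij (@enum_val_bij H).
rewrite (reindex_inj (@invg_inj H)) /= (reindex_inj (mulgI g^-1%g)) /=.
by apply: eq_bigr => y _; rewrite !invMg !invgK mulKVg mulrC.
Qed.

Lemma lmul_mxM a b : lmul_mx (a * b) = lmul_mx b *m lmul_mx a.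
Proof.
apply/row_matrixP => i; rewrite !rowE mulmxA.
by rewrite -(row_galgK (delta_mx _ _)) !galg_row_mul mulrA.
Qed.

Definition galg_rank a := \rank (lmul_mx a).

Lemma galg_rank_mul a x : (galg_rank (a * x)%R <= galg_rank a)%N.
Proof. by apply: mxrankS; rewrite lmul_mxM submxMl. Qed.

Lemma galg_rank_ge a x : (galg_rank a <= galg_rank (a * x)%R)%N ->
  exists y, a = a * x * y.
Proof.
move=> le_a; have sub : (lmul_mx (a * x)%R <= lmul_mx a)%MS.
  by rewrite lmul_mxM submxMl.
case: (mxrank_leqif_sup sub) => _; rewrite -/(galg_rank _) -/(galg_rank a).
rewrite eqn_leq galg_rank_mul le_a /= => /esym/submxP [X hX].
exists (row_galg (galg_row 1 *m X)).
by apply: galg_row_inj;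
  rewrite -galg_row_mul row_galgK -mulmxA -hX galg_row_mul mulr1.
Qed.

(** Splitting a non-primitive idempotent lowers the rank, and an additive map
    that does not kill the sum does not kill both summands. *)
Lemma primitive_idem_exists (V : zmodType) (th : galg k H -> V) Z u :
    comm_subalg Z -> (forall f g, th (f + g) = th f + th g) ->
    Z u -> u * u = u -> th u <> 0 ->
  exists2 e, primitive_idem Z e & e * u = e /\ th e <> 0.
Proof.
move=> hZ thD; have [n] := ubnP (galg_rank u); elim: n => // n IH in u *.
rewrite ltnS => le_un Zu uu thu.
have th0 : th 0 = 0 by apply: (addrI (th 0)); rewrite -thD !addr0.
have u0 : u <> 0 by move=> u0; apply: thu; rewrite u0.
have split f g : Z f -> f * f = f -> f * g = 0 -> g * f = 0 -> u = f + g ->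
    g * g = g -> g <> 0 -> th f <> 0 ->
  exists2 e, primitive_idem Z e & e * u = e /\ th e <> 0.
  move=> Zf ff fg gf ufg gg g0 thf.
  have uf : u * f = f by rewrite ufg mulrDl gf ff addr0.
  have fu : f * u = f by rewrite ufg mulrDr fg ff addr0.
  have [|e pe [ef the]] := IH f _ Zf ff thf; last first.
    by exists e => //; split=> //; rewrite -ef -mulrA fu.
  apply: leq_trans le_un; rewrite ltnNge; apply/negP => le_uf.
  rewrite -uf in le_uf; have [y] := galg_rank_ge le_uf.
  rewrite uf => uy; apply: g0.
  have gu : g * u = g by rewrite ufg mulrDr gf gg add0r.
  by rewrite -gu uy mulrA gf mul0r.
have [prim|nprim] := pselect (primitive_idem Z u); first by exists u.
have [f [g [Zf Zg ff gg [fg gf ufg f0 g0]]]] : exists f g, [/\ Z f, Z g,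
    f * f = f, g * g = g & [/\ f * g = 0, g * f = 0, u = f + g, f <> 0 & g <>
      0]].
  apply: contra_notP nprim => nex; split=> // f g Zf Zg ff gg fg gf ufg.
  have [->|/eqP f0] := eqVneq f 0; first by left.
  have [->|/eqP g0] := eqVneq g 0; first by right.
  by case: nex; exists f, g.
have [thf|/eqP thf] := eqVneq (th f) 0; last exact: (split f g).
apply: (split g f) => //; first by rewrite addrC.
by move: thu; rewrite ufg thD thf add0r.
Qed.

(** The powers of [z] are linearly dependent; divide a dependency by its lowest
    term. *)
Lemma power_dependency Z z : comm_subalg Z -> Z z ->
  exists m w, Z w /\ z ^+ m = z ^+ m.+1 * w.
Proof.
move=> hZ Zz; pose n := #|H|.
pose M := \matrix_(i < n.+1) galg_row (z ^+ i).
have kM : kermx M != 0.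
  by rewrite kermx_eq0 /row_free neq_ltn ltnS rank_leq_col.
have [c cM c0] : exists2 c : 'rV_n.+1, c *m M = 0 & c != 0.
  have /rowV0Pn [c /sub_kermxP] := kM; by exists c.
have sum0 : \sum_(i < n.+1) scal (c 0 i) * z ^+ i = 0.
  apply: galg_row_inj; rewrite (_ : galg_row 0 = 0); last first.
    by apply/rowP => j; rewrite !mxE ffunE.
  rewrite -[RHS]cM; apply/rowP => j; rewrite !mxE sum_ffunE.
  by apply: eq_bigr => i _; rewrite scalM !mxE.
have [i0 ci0] : exists i, c 0 i != 0 by apply/rV0Pn.
pose m := [arg min_(i < i0 | c 0 i != 0) (i : nat)].
have [cm mmin] : c 0 m != 0 /\ forall i, c 0 i != 0 -> (m <= i)%N.
  by rewrite /m; case: arg_minnP.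
pose w := - \sum_(i < n.+1 | (m < i)%N) scal (c 0 i / c 0 m) * z ^+ (i - m.+1).
exists m, w; split.
  apply: (comm_subalgN hZ); apply: (comm_subalg_sum hZ) => i _.
  apply: (comm_subalgM hZ); first exact: comm_subalg_scal.
  exact: comm_subalgX.
have scalMM x y (a : galg k H) : scal x * (scal y * a) = scal (x * y) * a.
  by apply/ffunP => g; rewrite !scalM mulrA.
have scal1 (a : galg k H) : scal 1 * a = a.
  by apply/ffunP => g; rewrite scalM mul1r.
have scalC x (a : galg k H) : a * scal x = scal x * a.
  by apply/ffunP => g; rewrite scalM scalMr mulrC.
rewrite -[LHS]scal1 -(mulVf cm) -scalMM.
have -> : scal (c 0 m) * z ^+ m =
    - \sum_(i < n.+1 | (m < i)%N) scal (c 0 i) * z ^+ i.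
  apply/eqP; rewrite -addr_eq0 -[X in _ == X]sum0 [X in
    _ == X](bigID (fun i : 'I__ => m < i)%N) /=.
  rewrite [X in _ == _ + X](bigD1 m) ?ltnn //= [X in _ == _ + (_ + X)]big1.
    by rewrite addr0 addrC.
  move=> i; rewrite -leqNgt => /andP [lim nim].
  have [->|/mmin lmi] := eqVneq (c 0 i) 0.
    by apply/ffunP => g; rewrite scalM mul0r ffunE.
  by move: nim; rewrite -val_eqE /= eqn_leq lim lmi.
rewrite /w !mulrN !big_distrr /=; congr (- _); apply: eq_bigr => i lim.
by rewrite scalMM mulrA scalC -mulrA -exprD subnKC // mulrC.
Qed.

(** Fitting's lemma: a suitable power of [z] is associated to an idempotent,
    which [b] divides unless [z] is nilpotent on [b]. *)
Lemma primitive_idem_dvd Z b z : comm_subalg Z -> primitive_idem Z b -> Z z ->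
  (forall n, b * z ^+ n <> 0) -> exists2 w, Z w & b = z * w.
Proof.
move=> hZ pb Zz bz; have [Zb b0 bb _] := pb.
have [m [w [Zw zw]]] := power_dependency hZ Zz.
have cz n : GRing.comm (z ^+ n) w.
  by apply: (comm_subalgC hZ) => //; apply: comm_subalgX.
have zmw n : z ^+ m = z ^+ (n + m) * w ^+ n.
  elim: n => [|n IH]; first by rewrite mulr1.
  by rewrite {1}IH exprD zw mulrA -exprD addnS exprSr -mulrA -exprS.
have zw2 : z ^+ m.+1 * w ^+ m.+1 * (z ^+ m.+1 * w ^+ m.+1) = z ^+ m.+1 * w ^+
  m.+1.
  have e1 : z ^+ m.+1 = z ^+ m.+1 * z ^+ m.+1 * w ^+ m.+1.
    by rewrite {1}exprS {1}(zmw m.+1) mulrA -exprS -addSn -exprD addnS.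
  have cc : GRing.comm (z ^+ m.+1) (w ^+ m.+1) by apply: commrX.
  by move: e1 cc; move: (z ^+ m.+1) (w ^+ m.+1) => x y e1 cc;
    rewrite mulrA -(mulrA x y) -cc mulrA -e1.
have Zzw : Z (z ^+ m.+1 * w ^+ m.+1).
  by apply: (comm_subalgM hZ); apply: comm_subalgX.
have [h0|h1] := primitive_idem_dich hZ pb Zzw zw2; last first.
  exists (z ^+ m * w ^+ m.+1 * b).
    by do !apply: (comm_subalgM hZ) => //; apply: comm_subalgX.
  by rewrite -{1}h1 (comm_subalgC hZ Zb Zzw) exprS !mulrA.
case: (bz m); rewrite (zmw m.+1) exprD.
have -> : z ^+ m.+1 * z ^+ m * w ^+ m.+1 = z ^+ m.+1 * w ^+ m.+1 * z ^+ m.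
  rewrite -!mulrA; congr (_ * _); exact/commrX/cz.
by rewrite mulrA h0 mul0r.
Qed.

End Subalgebras.

(** * Centres of group algebras of subgroups *)

Section Centralisers.
Variables (k : closedFieldType) (H : finGroupType).
Implicit Types (a b e f z : galg k H) (A B P Q R : {set H}) (g h : H) (c : k).
Local Open Scope group_scope.
Local Open Scope ring_scope.

Lemma galg_onS A B a : A \subset B -> galg_on A a -> galg_on B a.
Proof. by move=> sAB Aa x xB; apply: Aa; apply: contra xB;
  apply: (subsetP sAB). Qed.

Lemma galg_on_scal (A : {group H}) c : galg_on A (scal H c).
Proof.
by move=> x; rewrite ffunE; case: eqP => // ->; rewrite group1.
Qed.

Lemma galg_onB A a b : galg_on A a -> galg_on A b -> galg_on A (a - b).
Proof. by move=> Aa Ab x xA; rewrite !ffunE Aa // Ab // subr0. Qed.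

Lemma galg_onM (A : {group H}) a b : galg_on A a -> galg_on A b ->
  galg_on A (a * b).
Proof.
move=> Aa Ab x xA; rewrite ffunE big1 // => y _.
have [yA|/Aa->] := boolP (y \in A); last by rewrite mul0r.
by rewrite Ab ?mulr0 // groupMl ?groupV.
Qed.

Lemma fixed_byE A a g x : fixed_by A a -> g \in A -> a (x ^ g)%g = a x.
Proof.
by move=> fa gA; rewrite -{1}(fa _ gA) galg_conjE conjgK.
Qed.

Lemma fixed_byS A B a : A \subset B -> fixed_by B a -> fixed_by A a.
Proof. by move=> sAB fa g /(subsetP sAB); apply: fa. Qed.

Lemma fixed_byM A a b : fixed_by A a -> fixed_by A b -> fixed_by A (a * b).
Proof. by move=> fa fb g gA; rewrite rmorphM /= fa // fb. Qed.

(** Commuting with the basis elements of [kA] amounts to being fixed under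
    conjugation. *)
Lemma center_galg_on (A : {group H}) z :
  center_of (galg_on A) z <-> galg_on A z /\ fixed_by A z.
Proof.
split=> [[Az cz]|[Az fz]]; [split=> // g gA | split=> // a Aa]; last first.
  apply/ffunP => x; rewrite !ffunE.
  rewrite (reindex_inj (inj_comp (mulgI x) (@invg_inj H))) /=.
  apply: eq_bigr => y _; rewrite invMg invgK mulgKV.
  have [yA|/Aa->] := boolP (y \in A); last by rewrite mulr0 mul0r.
  by rewrite mulrC -[in LHS](fixed_byE _ fz yA) conjgE mulgKV.
pose d : galg k H := [ffun x => (x == g)%:R].
have dA : galg_on A d.
  by move=> x xA; rewrite ffunE; case: eqP xA => // ->; rewrite gA.
have dl x : (z * d) x = z (x * g^-1)%g.
  rewrite ffunE (bigD1 (x * g^-1)%g) //= ffunE invMg invgK mulgKV eqxx mulr1.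
  rewrite big1 ?addr0 // => y yx; rewrite ffunE.
  case: eqP => [yg|_]; last by rewrite mulr0.
  by move: yx; rewrite -yg invMg invgK mulKVg eqxx.
have dr x : (d * z) x = z (g^-1 * x)%g.
  rewrite ffunE (bigD1 g) //= ffunE eqxx mul1r big1 ?addr0 // => y /negbTE yg.
  by rewrite ffunE yg mul0r.
apply/ffunP => x; rewrite galg_conjE conjgE invgK mulgA -dl cz // dr.
by rewrite !mulgA mulVg mul1g.
Qed.

Lemma ZkCP P z : ZkC P z <-> galg_on 'C(P) z /\ fixed_by 'C(P) z.
Proof. exact: center_galg_on. Qed.

Lemma comm_subalg_center (A : {group H}) : comm_subalg (center_of (@galg_on k H
  A)).
Proof.
split=> [c|a b [Aa ca] [Ab cb]|a b [Aa ca] [Ab cb]|a b [Aa ca] [Ab _]].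
- split=> [|a _]; first exact: galg_on_scal.
  by apply/ffunP => x; rewrite scalM scalMr mulrC.
- split=> [|c Ac]; first exact: galg_onB.
  by rewrite mulrBl mulrBr ca // cb.
- split=> [|c Ac]; first exact: galg_onM.
  by rewrite -mulrA cb // mulrA ca // mulrA.
- exact: ca.
Qed.

Lemma comm_subalg_ZkC P : comm_subalg (@ZkC k H P).
Proof. exact: comm_subalg_center. Qed.

Lemma galg_conj_scal g c : galg_conj g (scal H c) = scal H c.
Proof. by apply/ffunP => x; rewrite galg_conjE !ffunE conjg_eq1. Qed.

Lemma comm_subalg_fixed (Z : set (galg k H)) A :
  comm_subalg Z -> comm_subalg (Z `&` fixed_by A)%classic.
Proof.
move=> hZ; split=> [c|a b [Za fa] [Zb fb]|a b [Za fa] [Zb fb]|a b [Za _] [Zb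
  _]].
- by split=> [|g _]; [exact: comm_subalg_scal|exact: galg_conj_scal].
- split=> [|g gA]; first exact: comm_subalgB.
  by rewrite raddfB /= fa // fb.
- by split; [exact: comm_subalgM|exact: fixed_byM].
- exact: comm_subalgC hZ _ _ _ _.
Qed.

Lemma galg_on_conj A a g : galg_on A a -> galg_on (A :^ g) (galg_conj g a).
Proof.
by move=> Aa x; rewrite mem_conjg galg_conjE => xA; apply: Aa.
Qed.

Lemma fixed_by_conj A a g : fixed_by A a -> fixed_by (A :^ g) (galg_conj g a).
Proof.
move=> fa _ /imsetP [h hA ->]; rewrite -galg_conj_comp.
by rewrite conjgE mulKVg galg_conj_comp fa.
Qed.

Lemma ZkC_conj P a g : ZkC P a -> ZkC (P :^ g) (galg_conj g a).
Proof.
move=> /ZkCP [Ca fa]; apply/ZkCP; rewrite centJ.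
by split; [apply: galg_on_conj|apply: fixed_by_conj].
Qed.

Lemma primitive_idem_conj P e g :
  primitive_idem (ZkC P) e -> primitive_idem (ZkC (P :^ g)) (galg_conj g e).
Proof.
move=> [Ze e0 ee ind]; split; first exact: ZkC_conj.
- by move=> h; apply: e0; rewrite -[e](galg_conjK g) h raddf0.
- by rewrite -rmorphM /= ee.
move=> f1 f2 Z1 Z2 f11 f22 f12 f21 ef.
have Zg f : ZkC (P :^ g) f -> ZkC P (galg_conj g^-1%g f).
  by move=> /(ZkC_conj g^-1%g); rewrite conjsgK.
have e12 : e = galg_conj g^-1%g f1 + galg_conj g^-1%g f2.
  by rewrite -raddfD /= -ef galg_conjK.
case: (ind _ _ (Zg _ Z1) (Zg _ Z2)) => //.
- by rewrite -rmorphM /= f11.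
- by rewrite -rmorphM /= f22.
- by rewrite -rmorphM /= f12 raddf0.
- by rewrite -rmorphM /= f21 raddf0.
- by move=> h; left; rewrite -[f1](galg_conjKV g) h raddf0.
- by move=> h; right; rewrite -[f2](galg_conjKV g) h raddf0.
Qed.

End Centralisers.

Section FixedPointSums.
Variables (k : closedFieldType) (p : nat) (hp : p \in [pchar k]%R).
Variable H : finGroupType.
Local Open Scope group_scope.

(** In characteristic [p] the non-trivial orbits of a [p]-group contribute
    nothing to a sum of an invariant function. *)
Lemma pgroup_sum_cent (Q : {group H}) (F : H -> k) : p.-group Q ->
    (forall q y, q \in Q -> F (y ^ q)%g = F y) ->
  (\sum_y F y = \sum_(y in 'C(Q)%g) F y)%R.
Proof.
move=> pQ FQ; rewrite (bigID (mem 'C(Q)%g)) /= [X in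
  (_ + X)%R = _](_ : _ = 0%R) ?addr0 //.
rewrite (partition_big_imset (orbit 'J%act Q)) /=.
apply: big1 => _ /imsetP [y0 y0C ->].
have oy y : (orbit 'J%act Q y == orbit 'J%act Q y0) = (y \in orbit 'J%act Q y0).
  by apply/eqP/orbit_eqP.
have FO y : y \in orbit 'J%act Q y0 -> F y = F y0.
  by case/imsetP => q qQ ->; apply: FQ.
have CO y : y \in orbit 'J%act Q y0 -> y \notin 'C(Q)%g.
  rewrite -!afixJ => /orbit_eqP yO; apply: contra y0C => /orbit1P y1.
  rewrite -afixJ; apply/orbit1P; rewrite -yO y1.
  by have := orbit_refl 'J%act Q y0; rewrite -yO y1 => /set1P ->.
rewrite (eq_big (fun y => y \in orbit 'J%act Q y0) (fun=> F y0)); first last.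
- by move=> y /andP [_]; rewrite oy; apply: FO.
- by move=> y; rewrite oy andb_idl // => /CO.
rewrite big_const iter_addr_0 -mulr_natr.
suff /eqP -> : (#|orbit 'J%act Q y0|%:R == 0 :> k)%R by rewrite mulr0.
rewrite -(dvdn_pcharf hp).
have /p_natP [n on] := pnat_dvd (dvdn_orbit 'J%act Q y0) pQ.
have p_pr := pcharf_prime hp.
rewrite on; case: n on => [|n] on; last by rewrite dvdn_exp.
move: y0C; rewrite -afixJ; case/negP; apply/orbit1P.
apply/eqP; rewrite eq_sym eqEcard sub1set orbit_refl cards1 on.
by rewrite expn0.
Qed.

End FixedPointSums.

(** * The Brauer map *)

Lemma Br_nmod_morphism (k : closedFieldType) (H : finGroupType) (Q : {set H}) :
  nmod_morphism (Br Q : galg k H -> galg k H).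
Proof.
split=> [|a b]; apply/ffunP => x; rewrite !ffunE; case: ifP => //.
by rewrite addr0.
Qed.

HB.instance Definition _ (k : closedFieldType) (H : finGroupType)
    (Q : {set H}) := GRing.isNmodMorphism.Build (galg k H) (galg k H) (Br Q)
  (Br_nmod_morphism k Q).

Section BrauerMap.
Variables (k : closedFieldType) (p : nat) (hp : p \in [pchar k]%R).
Variable H : finGroupType.
Implicit Types (a b e f z : galg k H) (A B P Q R : {set H}) (g h : H).
Local Open Scope group_scope.
Local Open Scope ring_scope.

Lemma Br_on Q a : galg_on 'C(Q) (Br Q a).
Proof. by move=> x /negbTE xQ; rewrite ffunE xQ. Qed.

Lemma Br_id Q a : galg_on 'C(Q) a -> Br Q a = a.
Proof.
by move=> Ca; apply/ffunP => x; rewrite ffunE; case: ifPn => // /Ca ->.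
Qed.

Lemma Br_Br P Q a : P \subset Q -> Br Q (Br P a) = Br Q a.
Proof.
move=> sPQ; apply/ffunP => x; rewrite !ffunE; case: ifP => // xQ.
by rewrite (subsetP (centS sPQ) _ xQ).
Qed.

(** The product [a * b] at a point centralised by [Q] is a [Q]-invariant sum over
    [H], of which only the terms centralised by [Q] survive. *)
Lemma BrM (Q : {group H}) a b : p.-group Q -> fixed_by Q a -> fixed_by Q b ->
  Br Q (a * b) = Br Q a * Br Q b.
Proof.
move=> pQ fa fb; apply/ffunP => x; rewrite [LHS]ffunE; case: ifPn => [xQ|xQ].
  rewrite !ffunE (pgroup_sum_cent hp pQ) => [|q y qQ].
    rewrite [RHS](bigID (mem 'C(Q)%g)) /= [X in _ = _ + X]big1 ?addr0.
      by apply: eq_bigr => y yQ; rewrite !ffunE yQ groupMl ?groupV // xQ.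
    by move=> y /negbTE yQ; rewrite !ffunE yQ mul0r.
  rewrite (fixed_byE _ fa qQ) -{1}(_ : x ^ q = x)%g; last first.
    by rewrite conjgE (centP xQ q qQ) mulKg.
  by rewrite -conjVg -conjMg (fixed_byE _ fb qQ).
by rewrite (galg_onM (@Br_on Q a) (@Br_on Q b) xQ).
Qed.

Lemma Br_conj Q a g : galg_conj g (Br Q a) = Br (Q :^ g) (galg_conj g a).
Proof.
by apply/ffunP => x; rewrite galg_conjE !ffunE centJ mem_conjg -galg_conjE
  ffunE.
Qed.

Lemma Br_fixed A Q a : A \subset 'N(Q) -> fixed_by A a -> fixed_by A (Br Q a).
Proof.
by move=> /subsetP nQ fa g gA; rewrite Br_conj (normP (nQ _ gA)) fa.
Qed.

Lemma Br_ZkC Q a : fixed_by 'C(Q) a -> ZkC Q (Br Q a).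
Proof.
by move=> fa; apply/ZkCP; split; [exact: Br_on|apply: Br_fixed => //;
  exact: cent_sub].
Qed.

Lemma Br1 Q : Br Q 1 = 1 :> galg k H.
Proof.
by apply/ffunP => x; rewrite !ffunE; case: eqP => [->|_];
  rewrite ?group1 ?if_same.
Qed.

End BrauerMap.

(** * Orbit sums of idempotents *)

Section OrbitSums.
Variables (k : closedFieldType) (H : finGroupType).
Implicit Types (a b e f z : galg k H) (A B P Q R : {set H}) (g h : H).
Local Open Scope group_scope.
Local Open Scope ring_scope.

Definition conj_orbit A e : seq (galg k H) :=
  undup [seq galg_conj g e | g <- enum A].

(** Each conjugate is counted once, so that the sum is idempotent when the
    conjugates are primitive idempotents of a commutative algebra. *)
Definition orbit_sum A e : galg k H := \sum_(x <- conj_orbit A e) x.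

Lemma mem_conj_orbit A e x :
  reflect (exists2 g, g \in A & x = galg_conj g e) (x \in conj_orbit A e).
Proof.
rewrite mem_undup; apply: (iffP mapP) => -[g gA ->]; exists g => //.
  by rewrite mem_enum in gA.
by rewrite mem_enum.
Qed.

Lemma orbit_sum_fixed (A : {group H}) e : fixed_by A (orbit_sum A e).
Proof.
move=> g gA; rewrite /orbit_sum raddf_sum /=.
rewrite -(big_map (galg_conj g) xpredT id) /=; apply: perm_big.
apply: uniq_perm; rewrite ?undup_uniq //.
  by rewrite map_inj_uniq ?undup_uniq //; apply: can_inj (galg_conjK g).
move=> x; apply/mapP/mem_conj_orbit =>
  [[y /mem_conj_orbit [h hA ->] ->]|[h hA ->]].
  by exists (h * g)%g; rewrite ?groupM // galg_conj_comp.
exists (galg_conj (h * g^-1)%g e); first by apply/mem_conj_orbit;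
  exists (h * g^-1)%g; rewrite // groupM ?groupV.
by rewrite -galg_conj_comp mulgKV.
Qed.

Section Primitive.
Variables (Z : set (galg k H)) (A : {group H}) (e : galg k H).
Hypotheses (hZ : comm_subalg Z)
  (prim : forall g, g \in A -> primitive_idem Z (galg_conj g e)).

Lemma orbit_sum_mem : Z (orbit_sum A e).
Proof.
rewrite /orbit_sum big_seq; apply: comm_subalg_sum => // x.
by case/mem_conj_orbit => g /prim [? _ _ _] ->.
Qed.

Lemma orbit_sum_mul g : g \in A ->
  orbit_sum A e * galg_conj g e = galg_conj g e.
Proof.
move=> gA; rewrite /orbit_sum big_distrl /= (bigD1_seq (galg_conj g e)) /=;
  last exact: undup_uniq.
  have [_ _ -> _] := prim gA; rewrite big_seq_cond big1 ?addr0 // => x.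
  case/andP => /mem_conj_orbit [h hA ->] ne; apply: contrapT => he.
  by case/eqP: ne; apply: (primitive_idem_eq hZ) he; apply: prim.
by apply/mem_conj_orbit; exists g.
Qed.

Lemma orbit_sum_idem : orbit_sum A e * orbit_sum A e = orbit_sum A e.
Proof.
rewrite {2 3}/orbit_sum big_distrr /= big_seq [RHS]big_seq; apply: eq_bigr => x.
by case/mem_conj_orbit => g gA ->; apply: orbit_sum_mul.
Qed.

Lemma orbit_sum_mul1 : orbit_sum A e * e = e.
Proof. by have := orbit_sum_mul (group1 A); rewrite galg_conj1. Qed.

Lemma orbit_sum_neq0 : orbit_sum A e <> 0.
Proof.
move=> s0; have := orbit_sum_mul1; rewrite s0 mul0r => e0.
by have [_] := prim (group1 A); rewrite galg_conj1 -e0.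
Qed.

End Primitive.

Lemma orbit_sum_fixed_pt (A : {group H}) e : fixed_by A e -> orbit_sum A e = e.
Proof.
move=> fe; rewrite /orbit_sum (perm_big [:: e]) ?big_seq1 //.
apply: uniq_perm; rewrite ?undup_uniq // => x; rewrite inE.
apply/mem_conj_orbit/eqP => [[g gA ->]|->]; first exact: fe.
by exists 1%g; rewrite ?galg_conj1.
Qed.

Lemma size_conj_orbit (A : {group H}) e :
  (size (conj_orbit A e) * #|[set g in A | galg_conj g e == e]%SET| = #|A|)%N.
Proof.
set S := [set g in A | _]%SET.
rewrite -[RHS]sum1_card [RHS](eq_bigr (fun g =>
  \sum_(x <- conj_orbit A e | x == galg_conj g e) 1)%N); last first.
  move=> g gA; rewrite sum1_count (eq_count (a2 := pred1 (galg_conj g e))) //.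
have m : galg_conj g e \in conj_orbit A e by apply/mem_conj_orbit; exists g.
  by rewrite count_uniq_mem ?undup_uniq // m.
rewrite [RHS](exchange_big_dep xpredT) //= -sum1_size big_distrl /= big_seq
  [RHS]big_seq.
apply: eq_bigr => x /mem_conj_orbit [h hA ->].
rewrite mul1n sum1dep_card -(card_rcoset S h); apply: eq_card => g.
rewrite mem_rcoset !inE groupMr ?groupV //; case gA: (g \in A) => //=.
rewrite galg_conj_comp [RHS]eq_sym.
by rewrite (can2_eq (@galg_conjKV _ _ h) (@galg_conjK _ _ h)).
Qed.

Variables (p : nat) (hp : p \in [pchar k]%R).

(** All conjugates of [e] under [Q] agree on the centraliser of [Q], and their
    number is divisible by [p]. *)
Lemma Br_orbit_sum_eq0 (Q : {group H}) e g : p.-group Q -> g \in Q ->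
  galg_conj g e <> e -> Br Q (orbit_sum Q e) = 0.
Proof.
move=> pQ gQ ge; apply/ffunP => x; rewrite !ffunE; case: ifP => // xQ.
rewrite sum_ffunE big_seq (eq_bigr (fun=> e x)); last first.
  move=> _ /mem_conj_orbit [h hQ ->]; rewrite galg_conjE conjgE invgK.
  by rewrite mulgA -(centP xQ h hQ) mulgK.
rewrite -big_seq big_const_seq count_predT iter_addr_0 -mulr_natr.
suff /eqP -> : ((size (conj_orbit Q e))%:R == 0 :> k)%R by rewrite mulr0.
rewrite -(dvdn_pcharf hp).
have so := size_conj_orbit Q e.
have dv : (size (conj_orbit Q e) %| #|Q|)%N by rewrite -so dvdn_mulr.
have /p_natP [n on] := pnat_dvd dv pQ.
have p_pr := pcharf_prime hp.
rewrite on; case: n on => [|n] on; last by rewrite dvdn_exp.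
move: so; rewrite on expn0 mul1n => cS.
have : [set g0 in Q | galg_conj g0 e == e]%SET == Q.
  by rewrite eqEcard cS leqnn andbT; apply/subsetP => y;
    rewrite inE => /andP [].
by move/eqP/setP/(_ g); rewrite inE gQ => /eqP.
Qed.

End OrbitSums.

Section OrbitSumsMore.
Variables (k : closedFieldType) (H : finGroupType).
Implicit Types (a b e f z : galg k H) (A B P Q R : {set H}) (g h : H).
Local Open Scope group_scope.
Local Open Scope ring_scope.

Lemma orbit_sum_conj A e g :
  orbit_sum (A :^ g) (galg_conj g e) = galg_conj g (orbit_sum A e).
Proof.
rewrite /orbit_sum raddf_sum /= -(big_map (galg_conj g) xpredT id) /=.
apply: perm_big; apply: uniq_perm; rewrite ?undup_uniq //.
  by rewrite map_inj_uniq ?undup_uniq //; apply: (can_inj (galg_conjK g)).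
move=> x; apply/mem_conj_orbit/mapP =>
  [[_ /imsetP [h hA ->] ->]|[y /mem_conj_orbit [h hA ->] ->]].
  exists (galg_conj h e); first by apply/mem_conj_orbit; exists h.
  by rewrite -!galg_conj_comp conjgE mulKVg.
exists (h ^ g)%g; first by rewrite memJ_conjg.
by rewrite -!galg_conj_comp conjgE mulKVg.
Qed.

(** If the orbit sum is decomposed into orthogonal idempotents fixed by [A], then
    all conjugates of [e] divide the same summand. *)
Lemma orbit_sum_primitive (Z : set (galg k H)) (A : {group H}) e :
    comm_subalg Z -> (forall g, g \in A -> primitive_idem Z (galg_conj g e)) ->
  primitive_idem (Z `&` fixed_by A)%classic (orbit_sum A e).
Proof.
move=> hZ prim; set s := orbit_sum A e.
have Zs : Z s by exact: orbit_sum_mem.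
have s0 := orbit_sum_neq0 hZ prim.
have key f : Z f -> fixed_by A f -> f * f = f -> e * f = 0 \/ e * f = e.
  move=> Zf _ ff; have := prim _ (group1 A); rewrite galg_conj1 => pe.
  exact: (primitive_idem_dich hZ pe Zf ff).
have sf f : Z f -> fixed_by A f -> e * f = 0 -> s * f = 0.
  move=> Zf fA ef; rewrite /s /orbit_sum big_distrl /= big_seq big1 // => x.
  by case/mem_conj_orbit => g gA ->; rewrite -(fA g gA) -rmorphM /= ef raddf0.
split.
- by split=> //; exact: orbit_sum_fixed.
- exact: s0.
- exact: (orbit_sum_idem hZ prim).
move=> f g [Zf fA] [Zg gA] ff gg fg gf sfg.
have sf1 : s * f = f by rewrite sfg mulrDl ff gf addr0.
have sg1 : s * g = g by rewrite sfg mulrDl gg fg add0r.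
have [ef|ef] := key f Zf fA ff; first by left; rewrite -sf1 sf.
by right; rewrite -sg1 sf // -ef -mulrA fg mulr0.
Qed.

End OrbitSumsMore.

(** * The order on Brauer pairs *)

Section BrauerPairs.
Variables (k : closedFieldType) (p : nat) (hp : p \in [pchar k]%R).
Variable H : finGroupType.
Implicit Types (a e f u m : galg k H) (A P Q R : {set H}) (g h : H).
Implicit Types (x y z : bpair k H).
Local Open Scope group_scope.
Local Open Scope ring_scope.

Lemma bp_conj1 x : bp_conj x 1%g = x.
Proof. by case: x => P e; rewrite /bp_conj /= conjsg1 galg_conj1. Qed.

Lemma bp_conj_comp x g h : bp_conj x (g * h)%g = bp_conj (bp_conj x g) h.
Proof. by rewrite /bp_conj /= conjsgM galg_conj_comp. Qed.

Lemma is_bpair_conj x g : is_bpair p x -> is_bpair p (bp_conj x g).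
Proof.
move=> [gP pP pe]; split => /=.
- by rewrite (group_setJ (Group gP)).
- by rewrite /pgroup cardJg.
- exact: primitive_idem_conj.
Qed.

Lemma bp_normal_conj x y g :
  bp_normal p x y -> bp_normal p (bp_conj x g) (bp_conj y g).
Proof.
move=> [bx bY nxy fy bf]; split => /=; try exact: is_bpair_conj.
- by rewrite normalJ.
- exact: fixed_by_conj.
- by rewrite -Br_conj -rmorphM /= bf.
Qed.

Lemma bp_le_conj x y g : bp_le p x y -> bp_le p (bp_conj x g) (bp_conj y g).
Proof.
elim=> {x y} [x y xy|x y z _ xy _ yz]; first exact/t_step/bp_normal_conj.
exact: t_trans xy yz.
Qed.

Lemma bp_normal_refl x : is_bpair p x -> bp_normal p x x.
Proof.
move=> bx; case: (bx) => gP pP [/ZkCP [Ce fe] e0 ee _].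
pose P := Group gP; have sPx (h : H) : h \in x.1 -> galg_conj h x.2 = x.2.
  move=> hP; apply/ffunP => y; rewrite galg_conjE.
  have [yC|yC] := boolP (y \in 'C(x.1)).
    by rewrite conjgE invgK mulgA -(centP yC h hP) mulgK.
  rewrite !Ce //; apply: contra yC.
  by rewrite memJ_norm // groupV (subsetP (norms_cent (normG P))).
split=> //; first exact: (normal_refl P).
by rewrite Br_id.
Qed.

Lemma bp_le_refl x : is_bpair p x -> bp_le p x x.
Proof. by move=> bx; apply/t_step/bp_normal_refl. Qed.

Lemma bp_le_trans x y z : bp_le p x y -> bp_le p y z -> bp_le p x z.
Proof. exact: t_trans. Qed.

Lemma bp_leP x y : bp_le p x y ->
  [/\ is_bpair p x, is_bpair p y & x.1 \subset y.1].
Proof.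
elim=> {x y} [x y [bx bY /andP [sxy _] _ _] //|x y z _ [bx _ sxy] _ [_ bz syz]].
by split=> //; apply: subset_trans syz.
Qed.

(** Let [y = (Q, f)]. If [e <> e'] then [e * e' = 0], whereas [Br_Q (e * e')]
    fixes [f <> 0]. *)
Lemma bp_normal_unique P e e' y :
  bp_normal p (P, e) y -> bp_normal p (P, e') y -> e = e'.
Proof.
move=> [[_ _ /= pe] [gQ pQ [_ f0 _ _]] _ fe bf] [[_ _ /= pe'] _ _ fe' bf'].
apply: (primitive_idem_eq (comm_subalg_ZkC k P) pe pe') => ee'.
apply: f0; rewrite -[y.2]bf -bf' mulrA.
by rewrite -(BrM hp (Q := Group gQ)) //= ee' raddf0 mul0r.
Qed.

Lemma bp_le_eq P e f : bp_le p (P, e) (P, f) -> e = f.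
Proof.
move=> le; suff : forall x y, bp_le p x y -> x.1 = y.1 -> x = y.
  by move/(_ _ _ le erefl) => [].
move=> x y; elim=> {x y le} [[Q u] [R v] xy /= QR|x y z xy IH yz IH' xz].
  subst R; case: (xy) => _ bv _ _ _.
  by rewrite (bp_normal_unique xy (bp_normal_refl bv)).
have [_ _ s1] := bp_leP xy; have [_ _ s2] := bp_leP yz.
have e1 : x.1 = y.1 by apply/eqP; rewrite eqEsubset s1 xz.
by rewrite (IH e1) IH' // -e1.
Qed.

(** For [x = (P, e)] and [y = (Q, f)] this is [Br_Q (Br_P a * e) = Br_Q a * Br_Q e];
    it lets divisibility by the images of [a] propagate along inclusions of
    Brauer pairs. *)
Lemma bp_normal_Br x y a : bp_normal p x y -> fixed_by y.1 a ->
  Br y.1 (Br x.1 a * x.2) * y.2 = Br y.1 a * y.2.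
Proof.
move=> [_ [gQ pQ _] /andP [sPQ nPQ] fe bf] fa.
rewrite (BrM hp (Q := Group gQ)) //; last exact: Br_fixed.
by rewrite /= Br_Br // -mulrA bf.
Qed.

Lemma bp_le_Br_up x y a : bp_le p x y -> fixed_by y.1 a ->
  Br x.1 a * x.2 = x.2 -> Br y.1 a * y.2 = y.2.
Proof.
elim=> {x y} [x y xy fa ax|x y z xy IH yz IH' fa ax].
  by rewrite -(bp_normal_Br xy) // ax; case: xy.
apply: IH' => //; apply: IH => //.
by have [_ _ s] := bp_leP yz; apply: fixed_byS fa.
Qed.

(** For a normal inclusion, were [Br x.1 a] orthogonal to [x.2], then [Br y.1 a]
    would be orthogonal to [y.2]. The invariance of [a] under the centraliser of
    [P] keeps its images in the centres in which the idempotents of the pairs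
    between [x] and [y] are primitive. *)
Lemma bp_le_Br_down P x y a : bp_le p x y -> P \subset x.1 ->
  fixed_by y.1 a -> fixed_by 'C(P) a -> a * a = a ->
  Br y.1 a * y.2 = y.2 -> Br x.1 a * x.2 = x.2.
Proof.
move=> xy sP fa fCa aa;
  elim: xy sP fa => {x y} [x y xy|x y z xy IH yz IH'] sP fa ay.
  have [[gx px pe] [gy py [_ f0 _ _]] /andP [sxy _] _ bf] := xy.
  have aax : Br x.1 a * Br x.1 a = Br x.1 a.
    by rewrite -(BrM hp (Q := Group gx)) ?aa //; apply: fixed_byS fa.
  have Zax : ZkC x.1 (Br x.1 a).
    by apply: Br_ZkC; apply: fixed_byS fCa; apply: centS.
  have hZ := comm_subalg_ZkC k x.1.
  have [Ze _ _ _] := pe; rewrite (comm_subalgC hZ Zax Ze).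
  have [e0|//] := primitive_idem_dich hZ pe Zax aax.
  case: f0; rewrite -ay -(bp_normal_Br xy) // (comm_subalgC hZ Zax Ze) e0.
  by rewrite raddf0 mul0r.
have [_ _ sxy] := bp_leP xy; have [_ _ syz] := bp_leP yz.
apply: IH => //; first exact: fixed_byS fa.
by apply: IH' => //; apply: subset_trans sxy.
Qed.

(** Let [y = (Q, f)]. The idempotent [1] is a sum of primitive idempotents of the
    [Q]-fixed part of the centre of [kC(P)], and some summand [s] has [Br_Q s * f = f]. It is the
    orbit sum of a primitive idempotent [e] of the whole centre. Since [Br_Q]
    kills the sums over non-trivial orbits, [e] is fixed by [Q] and equals [s]. *)
Lemma bp_normal_exists (P : {group H}) y : is_bpair p y -> P <| y.1 ->
  exists e, bp_normal p (P : {set H}, e) y.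
Proof.
case: y => Q0 f bQ; have [/= gQ pQ pf] := bQ; pose Q := Group gQ.
rewrite -[Q0]/(Q : {set H}) in bQ pQ pf *;
  move: Q bQ pQ pf => {gQ Q0} Q bQ pQ pf.
move=> nPQ; have /andP [sPQ nPQ'] := nPQ.
have hZ := comm_subalg_ZkC k P.
have hZ' := comm_subalg_fixed Q hZ; set Z' := (_ `&` _)%classic in hZ'.
have [Zf f0 ff _] := pf.
have thD : forall a b, Br Q (a + b) * f = Br Q a * f + Br Q b * f.
  by move=> a b; rewrite raddfD mulrDl.
have th1 : Br Q 1 * f <> 0 by rewrite Br1 mul1r.
have [s ps [_ sf]] := primitive_idem_exists hZ' thD (comm_subalg1 hZ') (mulr1
  1) th1.
have [[Zs fs] _ ss _] := ps.
have bsf : Br Q s * f = f.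
  have Zbs : ZkC Q (Br Q s).
    by apply: Br_ZkC; have /ZkCP [_] := Zs; apply: fixed_byS; apply: centS.
  have bb : Br Q s * Br Q s = Br Q s by rewrite -(BrM hp) ?ss.
  rewrite (comm_subalgC (comm_subalg_ZkC k Q) Zbs Zf) in sf *.
  by have [|//] := primitive_idem_dich (comm_subalg_ZkC k Q) pf Zbs bb.
have s0 : s <> 0 by move=> s0; apply: sf; rewrite s0 raddf0 mul0r.
have [e pe [es _]] := primitive_idem_exists hZ (fun a b =>
  erefl (a + b)) Zs ss s0.
have prim g : g \in Q -> primitive_idem (ZkC P) (galg_conj g e).
  by move=> gQ; have := primitive_idem_conj g pe; rewrite (normsP nPQ').
have Zt : Z' (orbit_sum Q e).
  by split; [exact: orbit_sum_mem|exact: orbit_sum_fixed].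
have tt := orbit_sum_idem hZ prim.
have ts : orbit_sum Q e * s = orbit_sum Q e.
  rewrite /orbit_sum big_distrl /= big_seq [RHS]big_seq; apply: eq_bigr => x.
  by case/mem_conj_orbit => g gQ ->; rewrite -{1}(fs g gQ) -rmorphM /= es.
have ets : orbit_sum Q e = s.
  have [Zt1 _] := Zt.
  rewrite -ts (comm_subalgC hZ Zt1 Zs).
  have [|//] := primitive_idem_dich hZ' ps Zt tt.
  by rewrite (comm_subalgC hZ Zs Zt1) ts => /(orbit_sum_neq0 hZ prim).
have fe : fixed_by Q e.
  move=> g gQ; apply: contrapT => ne; apply: sf.
  by rewrite -ets (Br_orbit_sum_eq0 hp pQ gQ ne) mul0r.
exists e; split=> //; last by rewrite /= -(orbit_sum_fixed_pt fe) ets.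
by split=> //=; [exact: groupP|apply: pgroupS pQ].
Qed.

(** The normal case, climbing through normalisers in the [p]-group [y.1]. *)
Lemma bp_le_exists (P : {group H}) y : is_bpair p y -> P \subset y.1 ->
  exists e, bp_le p (P : {set H}, e) y.
Proof.
case: y => Q0 f bQ; have [/= gQ pQ pf] := bQ; pose Q := Group gQ.
rewrite -[Q0]/(Q : {set H}) in bQ pQ pf *;
  move: Q bQ pQ pf => {gQ Q0} Q bQ pQ pf.
have [n] := ubnP (#|Q| - #|P|)%N; elim: n P => // n IH P;
  rewrite ltnS => le_n sPQ.
have [eqPQ|nPQ] := eqVneq (P : {set H}) Q.
  by exists f; rewrite eqPQ; apply: bp_le_refl.
have prPQ : P \proper Q by rewrite properEneq nPQ.
have prN := nilpotent_proper_norm (pgroup_nil pQ) prPQ.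
have [|u le_u] := IH ('N_Q(P))%G _ (subsetIl _ _).
  apply: leq_trans le_n; have := proper_card prN; have := proper_card prPQ.
  move=> h1 h2; rewrite ltn_sub2l //.
have [bN _ _] := bp_leP le_u.
have [|e] := @bp_normal_exists P _ bN;
  first by rewrite /normal subsetI sPQ normG subsetIr.
by exists e; apply: bp_le_trans le_u; apply: t_step.
Qed.

Lemma bp_le_first_step x y : bp_le p x y ->
  x = y \/ exists z, [/\ bp_normal p x z, x.1 <> z.1 & bp_le p z y].
Proof.
move/clos_trans_t1n_iff; elim=> {x y} [x y xy|x y z xy yz IH].
  have [_ bY _ _ _] := xy.
  have [e1|/eqP n1] := eqVneq x.1 y.1; last by right; exists y; split=> //;
    apply: bp_le_refl.
  left; case: x y xy bY e1 => P e [Q f] /= xy bY e1; subst Q.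
  by rewrite (bp_normal_unique xy (bp_normal_refl bY)).
have [_ bY _ _ _] := xy.
have [e1|/eqP n1] := eqVneq x.1 y.1; last first.
  by right; exists y; split=> //; apply/clos_trans_t1n_iff.
suff -> : x = y by [].
case: x y xy bY e1 {yz IH} => P e [Q f] /= xy bY e1; subst Q.
by rewrite (bp_normal_unique xy (bp_normal_refl bY)).
Qed.

(** Uniqueness of the pair below [(Q, f)]: both chains from [P] to [Q] start
    with a step inside [M = N_Q(P)], so by induction they can be routed through
    the pair [(M, m)] below [(Q, f)]; and there the [M]-stable idempotent under
    [m] propagates downwards. *)
Theorem bp_le_unique P e e' y :
  bp_le p (P, e) y -> bp_le p (P, e') y -> e = e'.
Proof.
case: y => Q f le1 le2.
have [n] := ubnP (#|Q| - #|P|)%N;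
  elim: n P e e' le1 le2 => // n IH P e e' le1 le2.
rewrite ltnS => le_n.
have [be bQ /= sPQ] := bp_leP le1.
have [gP _ _] := be; have [gQ pQ _] := bQ.
have [eqPQ|nPQ] := eqVneq P Q.
  by rewrite -eqPQ in le1 le2; rewrite (bp_le_eq le1) (bp_le_eq le2).
pose M := ('N_(Group gQ)(Group gP))%G.
have sMQ : M \subset Q := subsetIl _ _.
have nPM : Group gP <| M by rewrite /normal subsetI sPQ normG subsetIr.
have [m le_m] := bp_le_exists (P := M) bQ sMQ.
have [bM _ _] := bp_leP le_m.
have [eh hnorm] := bp_normal_exists bM nPM.
suff main u : bp_le p (P, u) (Q, f) -> u = eh by rewrite (main e) // (main e').
move=> /bp_le_first_step [[/eqP]|[[R v] [stp neR leR]]];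
  first by rewrite (negbTE nPQ).
have [_ bR /= nPR _ _] := stp; have [gR _ _] := bR.
have [_ _ /= sRQ] := bp_leP leR; have /andP [sPR nPR'] := nPR.
have sRM : R \subset M by rewrite subsetI sRQ.
have [v' lev'] := bp_le_exists (P := Group gR) bM sRM.
have ev : v' = v.
  apply: (IH R) => //; first exact: bp_le_trans lev' le_m.
  apply: leq_trans le_n; rewrite ltn_sub2l //.
    by apply: leq_trans (subset_leq_card sRQ); apply: proper_card;
      rewrite properEneq sPR andbT; apply/eqP.
  by apply: proper_card; rewrite properEneq sPR andbT; apply/eqP.
subst v'; have [bP _ _ fM bm] := hnorm;
  have [_ _ [/ZkCP [Ceh feh] _ ehh _]] := bP.
have := bp_le_Br_down lev' sPR fM feh ehh bm => /= beh.
apply: (bp_normal_unique stp); split=> //=.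
exact: fixed_byS fM.
Qed.

Corollary bp_le_normal P e y : bp_le p (P, e) y -> P <| y.1 ->
  bp_normal p (P, e) y.
Proof.
move=> le nP; have [[gP _ _] bY _] := bp_leP le.
have [e' h] := bp_normal_exists (P := Group gP) bY nP.
by rewrite (bp_le_unique le (t_step _ _ _ _ h)).
Qed.

Corollary bp_le_between P e R u y : bp_le p (P, e) y -> bp_le p (R, u) y ->
  P \subset R -> bp_le p (P, e) (R, u).
Proof.
move=> le1 le2 sPR; have [[gP _ _] _ _] := bp_leP le1;
  have [bR _ _] := bp_leP le2.
have [e' h] := bp_le_exists (P := Group gP) bR sPR.
by rewrite (bp_le_unique le1 (bp_le_trans h le2)).
Qed.

End BrauerPairs.

(** * Maximal Brauer pairs of a block *)

Section MaximalPairs.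
Variables (k : closedFieldType) (p : nat) (hp : p \in [pchar k]%R).
Variables (H : finGroupType) (L : {group H}).
Implicit Types (a e f u m : galg k H) (A P Q R : {set H}) (g h : H).
Local Open Scope group_scope.
Local Open Scope ring_scope.

(** Brauer pairs that are maximal among those of the subgroup [L]. The condition
    on centralisers makes Brauer pairs of [L] and of [H] on this group agree. *)
Definition max_bpair_in (x : bpair k H) : Prop :=
  [/\ is_bpair p x, x.1 \subset L, 'C(x.1) \subset L &
    forall y, bp_normal p x y -> y.1 \subset L -> y.1 = x.1].

Local Notation ZL := (center_of (@galg_on k H L)).

Section Extend.
Variables (P : {group H}) (e : galg k H).
Hypothesis (maxP : max_bpair_in (P : {set H}, e)).

Let T := ('N_L(P))%G.
Let et := orbit_sum T e.

Let pP : p.-group P. Proof. by case: maxP => [[]]. Qed.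
Let sPL : P \subset L. Proof. by case: maxP. Qed.
Let sCL : 'C(P) \subset L. Proof. by case: maxP. Qed.
Let pe : primitive_idem (ZkC P) e. Proof. by case: maxP => [[]]. Qed.
Let sPT : P \subset T. Proof. by rewrite subsetI sPL normG. Qed.
Let sCT : 'C(P) \subset T. Proof. by rewrite subsetI sCL cent_sub. Qed.

Let prim g : g \in T -> primitive_idem (ZkC P) (galg_conj g e).
Proof.
by case/setIP => _ gN; have := primitive_idem_conj g pe; rewrite (normP gN).
Qed.

Let et_fixed : fixed_by T et. Proof. exact: orbit_sum_fixed. Qed.

Let et_mem : ZkC P et.
Proof. exact: orbit_sum_mem (comm_subalg_ZkC k P) prim. Qed.

(** A [p]-subgroup [R] of [C_L(y)] normalising [P] and larger than [P] would
    leave the orbit sum with a non-zero image under [Br_R], hence carry a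
    Brauer pair above a conjugate of [(P, e)]. *)
Lemma orbit_sum_supp_Sylow y : et y != 0 -> p.-Sylow('C_L[y]) P.
Proof.
move=> ety.
have yC : y \in 'C(P).
  by have /ZkCP [h _] := et_mem; apply: contraR ety => /h ->.
have sPC : P \subset 'C_L[y] by rewrite subsetI sPL sub_cent1.
have [S sylS sPS] := Sylow_superset sPC pP.
have [-> //|nPS] := eqVneq (P : {set H}) S.
have prPS : P \proper S by rewrite properEneq nPS.
have pS := pHall_pgroup sylS.
have prN := nilpotent_proper_norm (pgroup_nil pS) prPS.
pose R := ('N_S(P))%G; have sRS : R \subset S := subsetIl _ _.
have pR : p.-group R := pgroupS sRS pS.
have sPR := proper_sub prN.
have sRT : R \subset T.
  by rewrite setSI // (subset_trans (pHall_sub sylS)) ?subsetIl.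
have yR : y \in 'C(R).
  rewrite -sub_cent1 (subset_trans sRS) // (subset_trans (pHall_sub sylS)) //.
  exact: subsetIr.
have fR : fixed_by R et := fixed_byS sRT et_fixed.
have hZ := comm_subalg_ZkC k P.
have ett : et * et = et by exact: (orbit_sum_idem hZ prim).
have bb : Br R et * Br R et = Br R et by rewrite -(BrM hp) ?ett.
have b0 : Br R et <> 0.
  by move/ffunP/(_ y); rewrite !ffunE yR => /eqP; rewrite (negbTE ety).
have Zb : ZkC R (Br R et).
  apply: Br_ZkC; apply: fixed_byS et_fixed.
  by apply: subset_trans sCT; apply: centS.
have [f pf [fb _]] :=
  primitive_idem_exists (comm_subalg_ZkC k R) (fun a b =>
    erefl (a + b)) Zb bb b0.
have bR : is_bpair p (R : {set H}, f) by split=> //=; exact: groupP.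
have nPR : P <| R by rewrite /normal sPR subsetIr.
have [e1 ne1] := bp_normal_exists hp bR nPR.
have [[_ _ /= pe1] _ _ /= fe1 be1] := ne1.
have [Zf f0 _ _] := pf; have [Ze1 _ _ _] := pe1.
have [g gT e1g] : exists2 g, g \in T & e1 = galg_conj g e.
  apply: contrapT => ne; apply: f0; rewrite -be1 -fb.
  rewrite (comm_subalgC (comm_subalg_ZkC k R) Zf Zb) mulrA -(BrM hp) //.
  rewrite (_ : e1 * et = 0) ?raddf0 ?mul0r //.
  rewrite /et /orbit_sum big_distrr /= big_seq big1 // =>
    _ /mem_conj_orbit [g gT ->].
  apply: contrapT => h0; apply: ne; exists g => //.
  exact: (primitive_idem_eq hZ pe1 (prim gT) h0).
have := bp_normal_conj g^-1%g ne1.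
rewrite /bp_conj /= e1g galg_conjK.
have [gL gN] := setIP gT; rewrite (normP (groupVr gN)) => nconj.
have [_ _ _ /(_ _ nconj) /=] := maxP.
have -> : R :^ g^-1 \subset L.
  rewrite sub_conjgV; apply: subset_trans (subset_trans sRT (subsetIl _ _)) _.
  by rewrite conjGid.
move=> /(_ isT) /(congr1 (fun A : {set H} => #|A|)); rewrite cardJg => eRP.
by have := proper_card prN; rewrite eRP ltnn.
Qed.

(** The class function on [L] that extends the orbit sum of [e]; it is an inverse
    image of this sum under [Br_P]. *)
Definition class_extension : galg k H :=
  [ffun x => if [pick l in L | p.-Sylow('C_L[x ^ l]) P] is Some l
             then et (x ^ l)%g else 0].

(** Independence of the choice: two conjugates of [x] whose centralisers have [P]
    as a Sylow subgroup are conjugate under ['N_L(P)], by Sylow's theorem in the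
    centraliser of one of them. *)
Lemma class_extensionE x l : l \in L -> p.-Sylow('C_L[x ^ l]) P ->
  class_extension x = et (x ^ l)%g.
Proof.
move=> lL syl; rewrite ffunE; case: pickP => [m /andP [mL sylm]|/(_ l)];
  last first.
  by rewrite lL syl.
pose h := (l^-1 * m)%g; have hL : h \in L by rewrite groupM ?groupV.
have xh : (x ^ m = (x ^ l) ^ h)%g by rewrite -conjgM mulKVg.
have sylh : p.-Sylow('C_L[x ^ m]) (P :^ h)%G.
  by rewrite xh cent1J -{1}(conjGid hL) -conjIg pHallJ2.
have [n /setIP [nL nC] /= ePh] := Sylow_trans sylm sylh.
have hnT : (h * n^-1)%g \in T.
  rewrite inE groupM ?groupV //=; apply/normP.
  by rewrite conjsgM ePh conjsgK.
rewrite -[in RHS](fixed_byE _ et_fixed hnT) conjgM -xh; congr (et _).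
apply/esym/conjg_fixP/commgP.
by have /cent1P := groupVr nC.
Qed.

Lemma class_extension_neq0 x : class_extension x != 0 ->
  exists2 l, l \in L & p.-Sylow('C_L[x ^ l]) P.
Proof.
by rewrite ffunE; case: pickP => [l /andP [lL syl] _|_ /eqP //]; exists l.
Qed.

Lemma class_extension_center : ZL class_extension.
Proof.
apply/center_galg_on; split=> [x xL|g gL].
  apply/eqP; apply: contraNT xL => zx;
    have [l lL syl] := class_extension_neq0 zx.
  move: zx; rewrite (class_extensionE lL syl) => ez.
  have /ZkCP [h _] := et_mem.
  have : (x ^ l)%g \in 'C(P) by apply: contraR ez => /h ->.
  by move/(subsetP sCL); rewrite groupJr.
apply/ffunP => x; rewrite galg_conjE.
have [zx|zx] := eqVneq (class_extension x) 0; last first.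
  have [l lL syl] := class_extension_neq0 zx.
  rewrite (class_extensionE lL syl) (class_extensionE (l :=
    (g * l)%g)) ?groupM //.
    by rewrite -conjgM mulKg.
  by rewrite -conjgM mulKg.
rewrite zx; apply/eqP; apply: contraT => zx'.
have [l lL syl] := class_extension_neq0 zx'.
case/eqP: zx'; rewrite (class_extensionE lL syl) -zx.
rewrite -conjgM in syl *.
by rewrite (class_extensionE _ syl) // groupM ?groupV.
Qed.

Lemma Br_class_extension : Br P class_extension = et.
Proof.
have /ZkCP [Cet _] := et_mem.
apply/ffunP => y; rewrite ffunE; case: ifPn => [yC|/Cet -> //].
have [ety|ety] := eqVneq (et y) 0; last first.
  have syl := orbit_sum_supp_Sylow ety.
  by rewrite (class_extensionE (group1 L)) conjg1.
rewrite ety; apply/eqP; apply: contraT => zy.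
have [l lL syl] := class_extension_neq0 zy.
have sylP : p.-Sylow('C_L[y]) P.
  have sPC : P \subset 'C_L[y] by rewrite subsetI sPL sub_cent1.
  rewrite pHallE sPC /=; have /= -> := card_Hall syl.
  by rewrite cent1J -{1}(conjGid lL) -conjIg cardJg.
by case/eqP: zy; rewrite (class_extensionE (group1 L)) conjg1.
Qed.

Variable c : galg k H.
Hypotheses (pc : primitive_idem ZL c) (ce : Br P c * e = e).

(** [Br_P] maps [c] times any power of the class function to an element fixing
    [e], so that the class function is not nilpotent on [c]. *)
Lemma block_idem_dvd : exists2 w, ZL w & c = class_extension * w.
Proof.
have hZ := comm_subalg_center k L; have Zz := class_extension_center.
have [Zc _ _ _] := pc.
apply: (primitive_idem_dvd hZ pc Zz) => n c0.
have fP a : ZL a -> fixed_by P a.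
  by move=> /center_galg_on [_]; apply: fixed_byS.
suff be : Br P (c * class_extension ^+ n) * e = e.
  by have [_ e0 _ _] := pe; apply: e0; rewrite -be c0 raddf0 mul0r.
elim: n {c0} => [|n IH]; first by rewrite mulr1.
rewrite exprSr mulrA (BrM hp) //; last 2 first.
- by apply: fP; apply: (comm_subalgM hZ) => //; exact: comm_subalgX.
- exact: fP.
by rewrite Br_class_extension -mulrA (orbit_sum_mul1 (comm_subalg_ZkC k P)
  prim).
Qed.

(** If [Br_Q c] is non-zero then so is [Br_Q] of the class function dividing [c],
    and the centralisers of the points of its support have conjugates of [P] as
    Sylow subgroups. *)
Lemma block_support_subconj (Q : {group H}) : p.-group Q -> Q \subset L ->
  Br Q c <> 0 -> exists2 l, l \in L & Q :^ l \subset P.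
Proof.
move=> pQ sQL bc0; have [w Zw cw] := block_idem_dvd.
have fQ a : ZL a -> fixed_by Q a.
  by move=> /center_galg_on [_]; apply: fixed_byS.
have [x xQ zx] : exists2 x, x \in 'C(Q) & class_extension x != 0.
  apply: contrapT => nex; apply: bc0; rewrite cw (BrM hp) //; last 2 first.
  - exact/fQ/class_extension_center.
  - exact: fQ.
  rewrite (_ : Br Q class_extension = 0) ?mul0r //; apply/ffunP => x.
  rewrite [LHS]ffunE [RHS]ffunE; case: ifP => // xQ; apply/eqP.
  by apply: contra_notT nex => zx; exists x.
have [l lL syl] := class_extension_neq0 zx.
have sQl : Q :^ l \subset 'C_L[x ^ l].
  by rewrite cent1J -{1}(conjGid lL) -conjIg conjSg subsetI sQL sub_cent1.
have [n /setIP [nL _]] := Sylow_subJ syl sQl (etrans (congr1 (pnat p) (cardJg Q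
  l)) pQ).
rewrite -sub_conjgV -conjsgM => sub.
by exists (l * n^-1)%g; rewrite ?groupM ?groupV.
Qed.

End Extend.

(** Both maximal pairs supply class functions dividing [c]; were the pairs not
    conjugate, the product of these functions would be killed by [Br_P]. *)
Theorem max_bpair_conj c (x y : bpair k H) : primitive_idem ZL c ->
    max_bpair_in x -> max_bpair_in y ->
    Br x.1 c * x.2 = x.2 -> Br y.1 c * y.2 = y.2 ->
  exists2 l, l \in L & y = bp_conj x l.
Proof.
case: x y => P0 e [Q0 f] pc mP mQ /= ce cf.
have [[/= gP pP pe] sPL _ _] := mP; have [[/= gQ pQ pf] sQL _ _] := mQ.
pose P := Group gP; pose Q := Group gQ.
have bP : Br P c <> 0.
  by move=> b0; have [_ e0 _ _] := pe; apply: e0; rewrite -ce b0 mul0r.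
have bQ : Br Q c <> 0.
  by move=> b0; have [_ f0 _ _] := pf; apply: f0; rewrite -cf b0 mul0r.
have [l lL sl] := block_support_subconj (P := P) (Q := Q) mP pc ce pQ sQL bQ.
have [l' lL' sl'] := block_support_subconj (P := Q) (Q := P) mQ pc cf pP sPL bP.
have eQP : Q :^ l = P.
  apply/eqP; rewrite eqEcard sl cardJg.
  by have := subset_leq_card sl'; rewrite cardJg.
have [fl fle] : exists fl, bp_conj (Q0, f) l = (P0, fl).
  by exists (galg_conj l f); rewrite /bp_conj /= [Q0 :^ l]eQP.
have mQ' : max_bpair_in (P0, fl).
  have [bQ1 _ sCL mx] := mQ.
  rewrite -fle; split=> /=; first exact: is_bpair_conj.
  - by rewrite [Q0 :^ l]eQP.
  - by rewrite centJ -(conjGid lL) conjSg.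
  move=> y /(bp_normal_conj l^-1%g).
  rewrite -bp_conj_comp mulgV bp_conj1 => /mx /= h sy.
  rewrite -h ?conjsgKV //.
  by rewrite -(conjGid (groupVr lL)) conjSg.
have cf' : Br P0 c * fl = fl.
  have [/center_galg_on [_ fc] _ _ _] := pc.
  by case: fle => <- <-; rewrite -{1}(fc l lL) -Br_conj -rmorphM /= cf.
have [w Zw cw] := block_idem_dvd (P := P) mP pc ce.
have [w' Zw' cw'] := block_idem_dvd (P := P) mQ' pc cf'.
have Zz := class_extension_center (P := P) mP.
have Zz' := class_extension_center (P := P) mQ'.
have hZ := comm_subalg_center k L; have hP := comm_subalg_ZkC k P.
have [_ _ cc _] := pc.
have fP a : ZL a -> fixed_by P a.
  by move=> /center_galg_on [_]; apply: fixed_byS.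
have prime1 g u : max_bpair_in (P0, u) -> g \in 'N_L(P) ->
    primitive_idem (ZkC P) (galg_conj g u).
  move=> [[_ _ /= ph] _ _ _] /setIP [_ gN].
  by have := primitive_idem_conj g ph; rewrite -[P0]/(P : {set H}) (normP gN).
have [g gT flg] : exists2 g, g \in 'N_L(P) & fl = galg_conj g e.
  apply: contrapT => ne; apply: bP; rewrite -cc {1}cw cw'.
  set z1 := class_extension P e in cw Zz *;
    set z2 := class_extension P fl in cw' Zz' *.
  have -> : z1 * w * (z2 * w') = z1 * z2 * (w * w').
    by rewrite !mulrA -(mulrA z1 w) (comm_subalgC hZ Zw Zz') !mulrA.
  rewrite (BrM hp) //; last 2 first.
  - by apply: fP; apply: (comm_subalgM hZ).
  - by apply: fP; apply: (comm_subalgM hZ).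
  rewrite (BrM hp) //; [|exact: fP|exact: fP].
  rewrite (Br_class_extension (P := P) mP) (Br_class_extension (P := P) mQ').
  rewrite (_ : _ * orbit_sum _ fl = 0) ?mul0r //.
  rewrite /orbit_sum big_distrl /= big_seq big1 // =>
    _ /mem_conj_orbit [h hT ->].
  rewrite big_distrr /= big_seq big1 // => _ /mem_conj_orbit [h2 hT2 ->].
  apply: contrapT => /(primitive_idem_eq hP (prime1 _ _ mP hT) (prime1 _ _ mQ'
    hT2)) eq.
  apply: ne; exists (h * h2^-1)%g; first by rewrite groupM ?groupV.
  by rewrite galg_conj_comp eq galg_conjK.
have [gL gN] := setIP gT.
exists (g * l^-1)%g; first by rewrite groupM ?groupV.
rewrite bp_conj_comp (_ : bp_conj (P0, e) g = (P0, fl)); last first.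
  by rewrite /bp_conj /= -[P0]/(P : {set H}) (normP gN) -flg.
by rewrite -fle -bp_conj_comp mulgV bp_conj1.
Qed.

End MaximalPairs.

Section MaximalExtension.
Variables (k : closedFieldType) (p : nat) (hp : p \in [pchar k]%R).
Variables (H : finGroupType).
Implicit Types (a c e f u : galg k H) (A P Q R : {set H}) (g h : H).
Local Open Scope group_scope.
Local Open Scope ring_scope.

Lemma bp_le_max_in (L : {group H}) (x : bpair k H) : is_bpair p x ->
    x.1 \subset L -> 'C(x.1) \subset L ->
  exists2 y, bp_le p x y & max_bpair_in p L y.
Proof.
have [n] := ubnP (#|H| - #|x.1|)%N; elim: n x => // n IH x;
  rewrite ltnS => le_n.
move=> bx sxL sCL.
have [mx|/existsNP [y /not_implyP [xy /not_implyP [syL nxy]]]] :=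
  pselect (forall y, bp_normal p x y -> y.1 \subset L -> y.1 = x.1).
  by exists x => //; exact: bp_le_refl.
have [_ bY /andP [sxy _] _ _] := xy.
have prxy : x.1 \proper y.1 by rewrite properEneq sxy andbT eq_sym; apply/eqP.
have [||z le_yz mz] := IH y _ bY syL _.
- apply: leq_trans le_n; rewrite ltn_sub2l ?proper_card //.
  by apply: (proper_sub_trans prxy); apply: subset_predT.
- exact: (subset_trans (centS sxy) sCL).
by exists z => //; apply: bp_le_trans le_yz; apply: t_step.
Qed.

(** All maximal pairs of a block are conjugate, so a pair of the block whose
    group has the order of a defect group cannot be enlarged. *)
Lemma block_bpair_defect_max c P e : block_defect_group p c P ->
  block_bpair p c (P, e) -> max_block_bpair p c (P, e).
Proof.
move=> [e' [[bPe' le'] mx']] [bPe le]; split=> // y [bY le_y] le_ey.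
have [[_ _ pc] _ _] := bp_leP le.
pose L : {group H} := 'C([set (1%g : H)])%G.
have LT A : A \subset L.
  by apply/subsetP => x _; apply/centP => y1 /set1P ->; exact: commute1.
have [_ _ /= sPy] := bp_leP le_ey.
have [y' le_y' my'] := bp_le_max_in (L := L) bY (LT _) (LT _).
have mP : max_bpair_in p L (P, e').
  split=> // z nz _; have [_ bz _ _ _] := nz.
  suff -> : z = (P, e') by [].
  apply: mx'; last exact: t_step.
  by split=> //; apply: bp_le_trans le' (t_step _ _ _ _ nz).
have [Zc _ _ _] := pc; have [_ fc] := (center_galg_on L c).1 Zc.
have up z : bp_le p ([set 1%g], c) z -> Br z.1 c * z.2 = z.2.
  move=> le_z; apply: (bp_le_Br_up hp le_z); first exact: fixed_byS fc.
  have [/ZkCP [Cc _] _ cc _] := pc.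
  by rewrite /= Br_id.
have [l lL ely] := max_bpair_conj hp pc mP my' (up _ le') (up _ (bp_le_trans
  le_y le_y')).
have [_ _ syy'] := bp_leP le_y'.
have cy : #|y.1| = #|P|.
  apply/eqP; rewrite eqn_leq (subset_leq_card sPy) andbT.
  by apply: leq_trans (subset_leq_card syy') _; rewrite ely /= cardJg.
have eyP : P = y.1 by apply/eqP; rewrite eqEcard sPy cy /=.
case: y eyP le_ey {bY le_y le_y' sPy syy' cy} => Q f /= <- le_ey.
by rewrite (bp_le_eq hp le_ey).
Qed.

End MaximalExtension.

(** * A Sylow theorem for Brauer pairs *)

Section SylowPairs.
Variables (k : closedFieldType) (p : nat) (hp : p \in [pchar k]%R).
Variables (H K : finGroupType) (nu : {morphism [set: H] >-> K}).
Implicit Types (a e f u al be : galg k H) (A P Q R : {set H}) (g h : H).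
Local Open Scope group_scope.
Local Open Scope ring_scope.

(** A form of Sylow's theorem for Brauer pairs above [(Q, u)]: with [M] the
    preimage of the centraliser of the image of [Q], both pairs belong to the
    block of [QM] determined by [u]; maximal pairs of this block are conjugate in
    [QM], and intersecting them with the normal subgroup [Q * 'ker nu] of [QM]
    recovers [A] and [B]. *)
Theorem sylow_bpair_conj (Q A B : {group H}) u al be :
    bp_le p (Q : {set H}, u) (A : {set H}, al) ->
    bp_le p (Q : {set H}, u) (B : {set H}, be) ->
    p.-Sylow(nu @*^-1 (nu @* Q)) A -> p.-Sylow(nu @*^-1 (nu @* Q)) B ->
  exists2 m, nu m \in 'C(nu @* Q) &
    bp_conj (A : {set H}, al) m = (B : {set H}, be).
Proof.
move=> leA leB sylA sylB.
pose W := (nu @*^-1 (nu @* Q))%G; pose M := (nu @*^-1 'C(nu @* Q))%G.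
have inM h : (h \in M) = (nu h \in 'C(nu @* Q)) by rewrite !inE.
have nMQ : Q \subset 'N(M).
  apply/subsetP => q qQ; rewrite inE; apply/subsetP => _ /imsetP [h hM ->].
  rewrite inM in hM; suff : (h ^ q : H)%g \in M by []. 
  rewrite inM morphJ ?inE // memJ_norm //.
  apply: (subsetP (norms_cent (normG _))).
  by apply: mem_morphim; rewrite ?inE.
pose L := (Q <*> M)%G.
have LE : L = (Q * M)%g :> {set H} by rewrite [LHS]norm_joinEl.
have sQL : Q \subset L by exact: joing_subl.
have sML : M \subset L by exact: joing_subr.
have sCM : 'C(Q) \subset M.
  apply/subsetP => h hC; rewrite inM; apply/centP => _ /morphimP [x _ xQ ->].
  by rewrite /commute -!morphM ?inE // (centP hC).
have WE : W = ('ker nu * Q)%g :> {set H} by rewrite [LHS]morphimK ?subsetT.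
have sQW : Q \subset W by rewrite WE mulG_subr.
have sWL : W \subset L.
  rewrite WE mul_subG //; apply: subset_trans sML.
  by apply/subsetP => h /kerP h1; rewrite inM h1 ?inE ?group1.
have nWL : L \subset 'N(W).
  rewrite LE mul_subG //; first exact: subset_trans sQW (normG W).
  apply/subsetP => h hM; rewrite inE; apply/subsetP => _ /imsetP [w wW ->].
  move: wW; rewrite !inE /= => wQ; rewrite morphJ ?inE //.
  rewrite inM in hM.
  by rewrite conjgE -(centP hM _ wQ) mulKg.
have [bQ bA sQA] := bp_leP leA; have [_ bB sQB] := bp_leP leB.
have sCL (X : {group H}) : Q \subset X -> 'C(X) \subset L.
  by move=> sQX; apply: subset_trans (centS sQX) (subset_trans sCM sML).
have sXL (X : {group H}) : p.-Sylow(W) X -> X \subset L.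
  by move=> sylX; apply: subset_trans (pHall_sub sylX) sWL.
have [[A1 al1] leA1 mA] := bp_le_max_in bA (sXL _ sylA) (sCL A sQA).
have [[B1 be1] leB1 mB] := bp_le_max_in bB (sXL _ sylB) (sCL B sQB).
have hZ := comm_subalg_center k L.
have th1 : Br Q 1 * u <> 0 by rewrite Br1 mul1r; have [_ _ [_ u0 _ _]] := bQ.
have thD : forall a b, Br Q (a + b) * u = Br Q a * u + Br Q b * u.
  by move=> a b; rewrite raddfD mulrDl.
have [c pc [_ cu]] := primitive_idem_exists hZ thD (comm_subalg1 hZ) (mulr1 1)
  th1.
have [/center_galg_on [_ fc] _ cc _] := pc.
have cQ : Br Q c * u = u.
  have [_ pQ pu] := bQ; have hQ := comm_subalg_ZkC k Q.
  have Zb : ZkC Q (Br Q c) by apply: Br_ZkC; apply: fixed_byS fc; apply: sCL.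
  have bb : Br Q c * Br Q c = Br Q c.
    by rewrite -(BrM hp) ?cc //; apply: fixed_byS fc.
  have [Zu _ _ _] := pu.
  rewrite (comm_subalgC hQ Zb Zu) in cu *.
  by have [|//] := primitive_idem_dich hQ pu Zb bb.
have up y : bp_le p (Q : {set H}, u) y -> y.1 \subset L -> Br y.1 c * y.2 = y.2.
  by move=> le syL; apply: (bp_le_Br_up hp le) => //; apply: fixed_byS fc.
have [_ sA1L _ _] := mA; have [_ sB1L _ _] := mB.
have [l lL [eB1 ebe1]] := max_bpair_conj hp pc mA mB
  (up _ (bp_le_trans leA leA1) sA1L) (up _ (bp_le_trans leB leB1) sB1L).
have cut X1 (x1 x : galg k H) (X : {group H}) : bp_le p (X : {set H}, x) (X1,
  x1) ->
    p.-Sylow(W) X -> X1 :&: W = X.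
  move=> le sylX; have [_ [/= gX1 pX1 _] /= sX] := bp_leP le.
  pose XX := (Group gX1 :&: W)%G.
  have sXX : X \subset XX by rewrite subsetI sX (pHall_sub sylX).
  have pXX : p.-group XX by exact: (pgroupS (subsetIl (Group gX1) W) pX1).
  by have := sub_pHall sylX pXX sXX (subsetIr _ _).
have eAB : A :^ l = B.
  rewrite -(cut _ _ _ _ leA1 sylA) conjIg (normP (subsetP nWL _ lL)) -eB1.
  exact: (cut _ _ _ _ leB1 sylB).
have conjl : bp_conj (A : {set H}, al) l = (B : {set H}, be).
  have le1 : bp_le p (B : {set H}, galg_conj l al) (B1, be1).
    have := bp_le_conj l leA1; rewrite /bp_conj /= -eB1 -ebe1.
    by rewrite eAB.
  rewrite /bp_conj /= (bp_le_unique hp le1 leB1).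
  by congr pair.
move: lL; rewrite LE => /mulsgP [q m qQ mM lqm].
exists m; first by rewrite -inM.
rewrite -conjl lqm bp_conj_comp; congr (bp_conj _ _).
have [_ _ _ fal _] := bp_normal_refl bA.
have qA : q \in A := subsetP sQA _ qQ.
by rewrite /bp_conj /= (fal _ qA) conjGid.
Qed.

End SylowPairs.

(** * Brauer pairs of a group and of its quotients *)

Section Covering.
Local Open Scope group_scope.
Local Open Scope ring_scope.
Variables (k : closedFieldType) (p : nat) (hp : p \in [pchar k]%R).
Variables (H K : finGroupType) (nu : {morphism [set: H] >-> K}).
Hypothesis nu_surj : nu @* [set: H] = [set: K].
Implicit Types (a b e f : galg k H) (c : galg k K) (g h : H).
Implicit Types (P Q R : {group H}).

Lemma morphTM : {morph nu : x y / (x * y)%g}.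
Proof. by move=> x y; rewrite morphM ?inE. Qed.

Lemma morphTJ : {morph nu : x y / (x ^ y)%g}.
Proof. by move=> x y; rewrite morphJ ?inE. Qed.

Lemma mem_morphimT x (A : {set H}) : x \in A -> nu x \in nu @* A.
Proof. by move=> xA; apply: mem_morphim; rewrite ?inE. Qed.

Lemma morph_surj y : exists x, nu x = y.
Proof.
have : y \in nu @* [set: H] by rewrite nu_surj inE.
by case/morphimP => x _ _ ->; exists x.
Qed.

Lemma push_conj g a : push nu (galg_conj g a) = galg_conj (nu g) (push nu a).
Proof.
apply/ffunP => y; rewrite galg_conjE !ffunE.
rewrite (reindex_inj (conjg_inj g)) /=; apply: eq_big => x.
  by rewrite morphTJ (can2_eq (conjgK _) (conjgKV _)).
by rewrite galg_conjE conjgK.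
Qed.

Lemma push_on (A : {set H}) a : galg_on A a -> galg_on (nu @* A) (push nu a).
Proof.
move=> Aa y yA; rewrite ffunE big1 // => x /eqP xy; apply: Aa.
by apply: contra yA => /mem_morphimT; rewrite xy.
Qed.

Lemma push_fixed (A : {set H}) a :
  fixed_by A a -> fixed_by (nu @* A) (push nu a).
Proof. by move=> fa _ /morphimP [g _ gA ->]; rewrite -push_conj fa. Qed.

(** The terms of a fibre not centralised by [Q] cancel. *)
Lemma push_Br Q a : p.-group Q -> fixed_by Q a ->
  push nu (Br Q a) = Br (nu @* Q) (push nu a).
Proof.
move=> pQ fa; apply/ffunP => y; rewrite !ffunE; case: ifPn => yC.
  rewrite big_mkcond [RHS]big_mkcond /=.
  rewrite [RHS](pgroup_sum_cent hp pQ) => [|q x qQ].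
    rewrite [RHS]big_mkcond /=; apply: eq_bigr => x _; rewrite ffunE.
    by case: ifP; case: ifP.
  have yq : (y ^ nu q = y)%g.
    by rewrite conjgE (centP yC (nu q)) ?mem_morphimT // mulKg.
  by rewrite (fixed_byE _ fa qQ) morphTJ -{1}yq (inj_eq (conjg_inj _)).
rewrite big1 // => x /eqP xy; rewrite ffunE; case: ifP => // xC.
case/negP: yC; rewrite -xy; apply/centP => _ /morphimP [q _ qQ ->].
by rewrite /commute -!morphTM (centP xC).
Qed.

(** For primitive [e] and [c] this amounts to [nu_minus nu P c * e <> 0], see
    [nu_minus_covers]. *)
Definition covers (P : {set H}) c e : Prop :=
  push nu (orbit_sum (CQN nu P) e) * c = c.

Local Notation N := ('ker nu).

Definition Sylow_kernel (P : {set H}) : Prop :=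
  p.-group P /\ p.-Sylow(N) (P :&: N).

Lemma preim_image P : nu @*^-1 (nu @* P) = (P * N)%g.
Proof.
rewrite morphimK ?subsetT // [RHS]normC //.
exact: subset_trans (subsetT P) (ker_norm nu).
Qed.

Lemma sub_preim_image P : P \subset nu @*^-1 (nu @* P).
Proof. by rewrite preim_image mulG_subl. Qed.

Lemma Sylow_preim P : Sylow_kernel P -> p.-Sylow(nu @*^-1 (nu @* P)) P.
Proof.
move=> [pP sylP]; rewrite /pHall sub_preim_image pP /= preim_image.
rewrite indexMg -indexgI.
by case/and3P: sylP; rewrite setIC.
Qed.

Lemma Sylow_kernelS P R : P \subset R -> p.-group R -> Sylow_kernel P ->
  Sylow_kernel R /\ R :&: N = P :&: N.
Proof.
move=> sPR pR [pP sylP].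
have e : R :&: N = P :&: N.
  apply: (sub_pHall sylP); rewrite ?subsetIr ?setSI //.
  exact: pgroupS (subsetIl _ _) pR.
by split; first by split; rewrite ?e.
Qed.

Lemma Sylow_kernel_preim P R : P \subset R -> p.-group R -> Sylow_kernel P ->
  R :&: nu @*^-1 (nu @* P) = P.
Proof.
move=> sPR pR syl.
apply: (sub_pHall (Sylow_preim syl)); rewrite ?subsetIr //.
  exact: pgroupS (subsetIl _ _) pR.
by rewrite subsetI sPR sub_preim_image.
Qed.

Lemma Sylow_kernel_conj P g : Sylow_kernel P -> Sylow_kernel (P :^ g).
Proof.
move=> [pP sylP]; split; first by rewrite /pgroup cardJg.
have nN : N :^ g = N by apply: normP; apply: (subsetP (ker_norm nu));
  rewrite inE.
by rewrite -{2}nN -conjIg -{1}nN pHallJ2.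
Qed.

(** In particular [CQN nu P] is a group. *)
Lemma CQN_E P : CQN nu P = 'N(P) :&: nu @*^-1 'C(nu @* P).
Proof.
apply/setP => g; rewrite !inE /=.
have com x : [~ g, x]%g = ((x^-1) ^ g * x)%g.
  by rewrite commgEl conjgE conjgE !mulgA.
apply/forall_inP/andP => [h|[gN gC] x xP].
  have gN : g \in 'N(P).
    rewrite inE; apply/subsetP => _ /imsetP [x xP ->].
    have /andP [] := h _ (groupVr xP).
    by rewrite com invgK groupMr ?groupV.
  split; first by rewrite inE in gN.
  apply/centP => _ /morphimP [x _ xP ->].
  have /andP [_ /eqP] := h _ xP.
  rewrite com morphTM morphTJ // => /eqP; rewrite -eq_invg_mul morphV ?inE //.
  rewrite conjVg invgK => /eqP h1.
  by rewrite /commute -{1}h1 conjgE mulKVg.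
have gN' : g \in 'N(P) by rewrite inE.
rewrite com groupMr // memJ_norm // groupV xP /=.
rewrite morphTM morphTJ morphV ?inE // conjVg.
rewrite conjgE -(centP gC) ?mem_morphimT // mulKg mulVg //.
Qed.

Definition CQN_group P : {group H} := ('N(P) :&: nu @*^-1 'C(nu @* P))%G.

Lemma CQN_groupP P g :
  reflect (g \in 'N(P) /\ nu g \in 'C(nu @* P)) (g \in CQN_group P).
Proof.
apply: (iffP setIP) => -[gN gC]; split=> //; first by case/morphpreP: gC.
by apply/morphpreP; rewrite inE.
Qed.

(** Frattini argument in the preimage of [nu @* P], where [P] is Sylow. *)
Lemma CQN_surj P : Sylow_kernel P -> nu @* CQN nu P = 'C(nu @* P).
Proof.
move=> syl; have sylW := Sylow_preim syl.
apply/eqP; rewrite eqEsubset; apply/andP; split.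
  apply/subsetP => _ /morphimP [g _ gC ->].
  by move: gC; rewrite CQN_E => /setIP [_]; rewrite !inE.
apply/subsetP => y yC; have [h hy] := morph_surj y.
have eim : nu @* (P :^ h) = nu @* P.
  by rewrite morphimJ ?inE // hy; apply/normP; apply: (subsetP (cent_sub _)).
have sylh : p.-Sylow(nu @*^-1 (nu @* P)) (P :^ h)%G.
  rewrite -eim; apply: (@Sylow_preim (P :^ h)%G).
  exact: Sylow_kernel_conj.
have [w wW ePw] := Sylow_trans sylW sylh.
move: wW; rewrite /= preim_image => /mulsgP [x n xP nN ewn].
have {}ePw : P :^ h = P :^ n by rewrite [LHS]ePw ewn conjsgM conjGid.
have nuhn : nu (h * n^-1)%g = y.
  by rewrite morphTM morphV ?inE // (mker nN) invg1 mulg1.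
rewrite -nuhn; apply: mem_morphimT; rewrite CQN_E inE.
apply/andP; split; last by rewrite !inE /= nuhn.
by apply/normP; rewrite conjsgM ePw conjsgK.
Qed.

Lemma primitive_idem_CQN P e g : primitive_idem (ZkC P) e ->
  g \in CQN_group P ->
  primitive_idem (ZkC P) (galg_conj g e).
Proof.
by move=> pe /setIP [gN _]; have := primitive_idem_conj g pe;
  rewrite (normP gN).
Qed.

Lemma coversE P c e :
  covers P c e <-> push nu (orbit_sum (CQN_group P) e) * c = c.
Proof. by rewrite /covers CQN_E. Qed.

Lemma orbit_sum_CQN_idem P e : primitive_idem (ZkC P) e ->
  orbit_sum (CQN_group P) e * orbit_sum (CQN_group P) e = orbit_sum (CQN_group
    P) e.
Proof.
move=> pe; have prim g := @primitive_idem_CQN P e g pe.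
exact: (orbit_sum_idem (comm_subalg_ZkC k P) prim).
Qed.

(** Both [nu_minus nu P c] and the orbit sum of [e] are primitive in the algebra of
    fixed points, so that they are equal as soon as their product is non-zero;
    conversely the orbit sum of a covering [e] shows that [nu_minus] does not take
    its default value. *)
Lemma nu_minus_covers P c e : primitive_idem (ZkC P) e ->
  primitive_idem (ZkC (nu @* P)) c ->
  (nu_minus nu P c * e <> 0 <-> covers P c e).
Proof.
move=> pe pc; have prim g := @primitive_idem_CQN P e g pe.
have hZ := comm_subalg_ZkC k P; have hZ' := comm_subalg_fixed (CQN_group P) hZ.
have ps := orbit_sum_primitive hZ prim.
have [_ c0 _ _] := pc.
rewrite coversE; set s := orbit_sum _ _ in ps *.
have se : s * e = e := orbit_sum_mul1 hZ prim.
have [Ze e0 _ _] := pe.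
have uniq_ f : primitive_idem (ZkC P `&` fixed_by (CQN nu P))%classic f ->
    f * e <> 0 -> f = s.
  rewrite CQN_E => pf fe; apply: (primitive_idem_eq hZ' pf ps) => fs.
  by apply: fe; rewrite -se mulrA fs mul0r.
rewrite /nu_minus; set X := [set f | _]%classic.
have [[f Xf]|none] := pselect (exists f, X f); last first.
  rewrite (xgetPN _ ((forallNP _).2 none)) mul0r; split=> // cov.
  by case: none; exists s; split; rewrite ?CQN_E.
have {f Xf} [pf fc] : X (xget 0 X) := xgetPex 0 (ex_intro _ f Xf).
move: (xget 0 X) pf fc => f pf fc; split=> [/(uniq_ _ pf) <- //|cov].
suff -> : f = s by rewrite se.
rewrite CQN_E in pf; apply: (primitive_idem_eq hZ' pf ps) => fs.
by apply: c0; rewrite -fc -cov mulrA -(pushM morphTM) fs raddf0 mul0r.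
Qed.

Lemma covers_conj P c e g :
  covers P c e -> covers (P :^ g) (galg_conj (nu g) c) (galg_conj g e).
Proof.
rewrite !coversE => cov.
have -> : CQN_group (P :^ g) = CQN_group P :^ g :> {set H}.
  by rewrite /= normJ morphimJ ?inE // centJ conjIg morphpreJ ?inE.
by rewrite orbit_sum_conj push_conj -rmorphM /= cov.
Qed.

Lemma push_orbit_sum_ZkC P e : Sylow_kernel P -> primitive_idem (ZkC P) e ->
  ZkC (nu @* P) (push nu (orbit_sum (CQN_group P) e)).
Proof.
move=> syl pe; have prim g := @primitive_idem_CQN P e g pe.
have /ZkCP [Cs _] := orbit_sum_mem (comm_subalg_ZkC k P) prim.
apply/ZkCP; split.
  by apply: galg_onS (push_on Cs); exact: morphim_cent.
rewrite -(CQN_surj syl) CQN_E; apply: push_fixed; exact: orbit_sum_fixed.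
Qed.

End Covering.

Section CoveringOrder.
Local Open Scope group_scope.
Local Open Scope ring_scope.
Variables (k : closedFieldType) (p : nat) (hp : p \in [pchar k]%R).
Variables (H K : finGroupType) (nu : {morphism [set: H] >-> K}).
Hypothesis nu_surj : nu @* [set: H] = [set: K].
Implicit Types (a b e f : galg k H) (c : galg k K) (g h : H).
Implicit Types (P Q R : {group H}).

Local Notation N := ('ker nu).
Local Notation Sylow_kernel := (Sylow_kernel p nu).
Local Notation covers := (covers nu).

(** Suppose the image of the orbit sum [s] of [e] kills [c]. By normality [s] is
    fixed by [R] and [Br_R s] fixes the conjugates of [f]; since
    [push nu] commutes with the Brauer maps and [f] covers [d], the image of
    [push nu s * c] under the Brauer map of [nu @* R] fixes [d <> 0], a
    contradiction. *)
Lemma covers_normal P R c d e f :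
    bp_normal p (P : {set H}, e) (R : {set H}, f) ->
    bp_normal p (nu @* P, c) (nu @* R, d) ->
  Sylow_kernel P -> covers R d f -> covers P c e.
Proof.
move=> nH nK sylP; rewrite !(coversE nu) => covR.
have [[_ pP /= pe] [_ /= pR pf] /andP [/= sPR nPR] /= fe be] := nH.
have [[_ _ /= pc] [_ _ /= pd] _ /= fc bc] := nK.
have hZ := comm_subalg_ZkC k P.
have hK := comm_subalg_ZkC k (nu @* P).
have prim g := primitive_idem_CQN (nu := nu) (g := g) pe.
set s := orbit_sum (CQN_group nu P) e;
  set t := orbit_sum (CQN_group nu R) f in covR.
have Zs : ZkC (nu @* P) (push nu s) := push_orbit_sum_ZkC nu_surj sylP pe.
have ss : s * s = s := orbit_sum_CQN_idem nu pe.
have pss : push nu s * push nu s = push nu s by rewrite -(pushM (morphTM nu))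
  ss.
have [Zc c0 _ _] := pc; have [_ d0 _ _] := pd.
have fs : fixed_by R s.
  move=> r rR; rewrite /s -orbit_sum_conj fe //; congr (orbit_sum _ _).
  rewrite /= conjIg -normJ (normsP nPR _ rR) -morphpreJ ?inE //= -centJ.
  by rewrite -morphimJ ?inE // (normsP nPR _ rR).
have sCC : CQN_group nu R \subset CQN_group nu P.
  apply/subsetP => h /CQN_groupP [hN hC]; apply/CQN_groupP.
  have hCP : nu h \in 'C(nu @* P) := subsetP (centS (morphimS nu sPR)) _ hC.
  split=> //; rewrite inE; apply/subsetP => _ /imsetP [x xP ->].
  rewrite -(Sylow_kernel_preim sPR pR sylP) inE memJ_norm // (subsetP sPR) //=.
  apply/morphpreP; rewrite inE; split=> //; rewrite morphTJ.
  by rewrite conjgE -(centP hCP) ?mem_morphimT // mulKg mem_morphimT.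
have fsC : fixed_by (CQN_group nu P) s by exact: orbit_sum_fixed.
have bsf : Br R s * f = f.
  by rewrite -{1}be mulrA -(BrM hp) // (orbit_sum_mul1 hZ prim) be.
have bst : Br R s * t = t.
  rewrite /t /orbit_sum big_distrr /= big_seq [RHS]big_seq; apply: eq_bigr => x.
  case/mem_conj_orbit => h hC ->; case/CQN_groupP: (hC) => hN _.
  have fsh : galg_conj h (Br R s) = Br R s.
    by rewrite Br_conj (normP hN) (fsC h (subsetP sCC _ hC)).
  by rewrite -{1}fsh -rmorphM /= bsf.
have bpd : Br (nu @* R) (push nu s) * d = d.
  rewrite -(push_Br hp nu (a := s) pR fs) -[in LHS]covR mulrA.
  by rewrite -(pushM (morphTM nu)) bst.
rewrite (comm_subalgC hK Zs Zc).
have [sc0|//] := primitive_idem_dich hK pc Zs pss.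
case: d0; rewrite -bpd -bc mulrA.
have pnR : p.-group (nu @* R) by exact: morphim_pgroup.
rewrite -(BrM hp (Q := (nu @* R)%G)) //; last exact: push_fixed.
by rewrite (comm_subalgC hK Zs Zc) sc0 raddf0 mul0r.
Qed.

(** Induction on the chain from [x] to [y]: its intermediate groups are images of
    subgroups of [R] containing [P], on which pairs below [(R, f)] exist. *)
Lemma covers_le x y : bp_le p x y -> forall P R e f,
    bp_le p (P : {set H}, e) (R : {set H}, f) -> Sylow_kernel P ->
    nu @* P = x.1 -> nu @* R = y.1 ->
  covers R y.2 f -> covers P x.2 e.
Proof.
elim=> {x y} [[P' c] [R' d] /= xy|x y z xy IH yz IH'] P R e f le sylP nP nR
  covR.
  have [[_ pP _] [_ /= pR _] /= sPR] := bp_leP le.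
  rewrite -nP -nR in xy; have [_ _ /= nPR _ _] := xy.
  apply: (covers_normal (R := R) (d := d) (f := f) _ xy) => //.
  apply: (bp_le_normal hp le) => /=; apply/andP; split=> //.
  have /andP [_ nn] := nPR.
  rewrite -(Sylow_kernel_preim sPR pR sylP).
  apply/subsetP => r rR; rewrite inE conjIg conjGid //.
  rewrite setIS // -morphpreJ ?inE //.
  by rewrite (normsP nn) ?mem_morphimT // rR.
have [_ bR /= sPR] := bp_leP le; have [_ pR _] := bR.
have [_ [gy _ _] sxy] := bp_leP xy; have [_ _ syz] := bp_leP yz.
pose Q := (R :&: nu @*^-1 (Group gy))%G.
have sQR : Q \subset R := subsetIl _ _.
have sPQ : P \subset Q.
  by rewrite subsetI sPR /= -sub_morphim_pre ?subsetT // nP.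
have nQ : nu @* Q = y.1.
  apply/setP => w; apply/morphimP/idP => [[q _ /setIP [_ /morphpreP [_ qy]] ->
    //]|wy].
  have : w \in nu @* R by rewrite nR (subsetP syz _ wy).
  case/morphimP => r _ rR wr; exists r => //; apply/setIP; split=> //.
  by apply/morphpreP; rewrite inE -wr.
have [q leq] := bp_le_exists hp (P := Q) bR sQR.
have [sylQ _] := Sylow_kernelS sPQ (pgroupS sQR pR) sylP.
apply: (IH P Q e q) => //; first exact: (bp_le_between hp le leq sPQ).
exact: (IH' Q R q f).
Qed.

Lemma push_le_neq0 (x y : bpair k H) : bp_le p x y -> push nu y.2 <> 0 ->
  push nu x.2 <> 0.
Proof.
elim=> {x y} [x y [_ [gy py _] _ fe be]|x y z _ IH _ IH' /IH' /IH //] yN0 x0.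
apply: yN0; rewrite -be (pushM (morphTM nu)).
have -> : push nu (Br y.1 x.2) = 0; last by rewrite mul0r.
by rewrite (push_Br hp nu (Q := Group gy)) // x0 raddf0.
Qed.

(** Conjugations between the images lift: Sylow's theorem aligns the groups, and
    the two idempotents over the conjugate of [c] are conjugate under an element
    acting trivially modulo the kernel. *)
Lemma covers_lift P R c d e f y :
    is_bpair p (P : {set H}, e) -> is_bpair p (R : {set H}, f) ->
    Sylow_kernel P -> Sylow_kernel R -> covers P c e -> covers R d f ->
    bp_le p (bp_conj (nu @* P, c) y) (nu @* R, d) ->
  exists2 g, bp_le p (bp_conj (P : {set H}, e) g) (R : {set H}, f) &
    forall x, x \in P -> nu (x ^ g)%g = (nu x ^ y)%g.
Proof.
move=> bP bR sylP sylR covP covR le.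
have [pP _] := sylP; have [bcP [_ pR _] /= sPR] := bp_leP le.
have [g0 ng0] := morph_surj nu_surj y.
have sW : P :^ g0 \subset nu @*^-1 (nu @* R).
  by rewrite -sub_morphim_pre ?subsetT // morphimJ ?inE // ng0.
have pPg : p.-group (P :^ g0) by rewrite /pgroup cardJg.
have [w wW sPw] := Sylow_subJ (Sylow_preim sylR) sW pPg.
move: wW; rewrite /= preim_image => /mulsgP [r n rR nN ew].
pose g1 := (g0 * n^-1)%g.
have ng1 : nu g1 = y by rewrite morphTM morphV ?inE // (mker nN) invg1 mulg1.
pose P1 := (P :^ g1)%G.
have sP1R : P1 \subset R.
  rewrite /= conjsgM sub_conjgV; apply: subset_trans sPw _.
  by rewrite ew conjsgM (conjGid rR).
have [e' le'] := bp_le_exists hp (P := P1) bR sP1R.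
have syl1 : Sylow_kernel P1 := Sylow_kernel_conj g1 sylP.
have nP1 : nu @* P1 = (bp_conj (nu @* P, c) y).1.
  by rewrite /= morphimJ ?inE // ng1.
have cov1 : covers P1 (galg_conj y c) e' by exact: (covers_le le le' syl1 nP1
  erefl).
have cov2 : covers P1 (galg_conj y c) (galg_conj g1 e).
  by rewrite -ng1; apply: covers_conj.
have [[_ _ /= pe'] _ _] := bp_leP le'; have [_ _ /= pe] := bP.
have pe1 : primitive_idem (ZkC P1) (galg_conj g1 e) by apply:
  primitive_idem_conj.
have [_ _ [_ c0 _ _]] := bcP.
have [h hC e'h] : exists2 h, h \in CQN_group nu P1 & e' = galg_conj (g1 * h)%g
  e.
  apply: contrapT => ne; apply: c0 => /=.
  move/(coversE nu): cov1 => <-; move/(coversE nu): cov2 => <-.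
  rewrite mulrA -(pushM (morphTM nu)).
  set s1 := orbit_sum _ e'; set s2 := orbit_sum _ _.
  suff -> : s1 * s2 = 0 by rewrite raddf0 mul0r.
  rewrite /s1 /s2.
  rewrite /orbit_sum big_distrl /= big_seq big1 // =>
    _ /mem_conj_orbit [h1 hC1 ->].
  rewrite big_distrr /= big_seq big1 // => _ /mem_conj_orbit [h2 hC2 ->].
  apply: contrapT => /(primitive_idem_eq (comm_subalg_ZkC k P1)
    (primitive_idem_CQN pe' hC1) (primitive_idem_CQN pe1 hC2)) eh.
  apply: ne; exists (h2 * h1^-1)%g; first by rewrite groupM ?groupV.
  by rewrite 2!galg_conj_comp -eh galg_conjK.
case/CQN_groupP: hC => hN hCn.
exists (g1 * h)%g.
  by rewrite /bp_conj /= -e'h conjsgM (normP hN).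
move=> x xP; rewrite conjgM morphTJ conjgE -(centP hCn); last first.
  by apply: mem_morphimT; rewrite memJ_conjg.
by rewrite mulKg morphTJ ng1.
Qed.

Variables (J : finGroupType) (mu : {morphism [set: K] >-> J}).

(** If the centralisers of [P] and of its image have the same image in [J], then
    the conjugates of [e] under [CQN nu P] have the same image in [kJ]. *)
Lemma covers_push P c e : primitive_idem (ZkC P) e ->
    mu @* 'C(nu @* P) \subset mu @* (nu @* 'C(P)) -> covers P c e ->
  push mu (push nu e) * push mu c = push mu c.
Proof.
move=> pe sC /(coversE nu) cov.
have [/ZkCP [_ fe] _ ee _] := pe.
set ep := push mu (push nu e).
have epep : ep * ep = ep by rewrite -!(pushM (@morphTM _ _ _)) ee.
have im g : g \in CQN_group nu P -> push mu (push nu (galg_conj g e)) = ep.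
  case/CQN_groupP => _ gC.
  have /(subsetP sC)/morphimP [_ _ /morphimP [z _ zC ->] mz] :=
    mem_morphimT mu gC.
  by rewrite !push_conj mz -!push_conj fe.
have := congr1 (push mu) cov; rewrite (pushM (morphTM mu)) => h.
rewrite -[in LHS]h mulrA -[RHS]h; congr (_ * _).
rewrite /orbit_sum !raddf_sum big_distrr /= big_seq [RHS]big_seq.
by apply: eq_bigr => _ /mem_conj_orbit [g gC ->]; rewrite im // epep.
Qed.

Lemma covers_push_neq0 P c e : covers P c e ->
  push mu c <> 0 -> push mu (push nu e) <> 0.
Proof.
move=> /(coversE nu) cov c0 e0; apply: c0; rewrite -cov (pushM (morphTM mu)).
rewrite /orbit_sum !raddf_sum big_distrl /= big_seq big1 // =>
  _ /mem_conj_orbit [g gC ->].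
by rewrite !push_conj e0 raddf0 mul0r.
Qed.

(** The image of [c'] is fixed by that of [e], which is the image of [c]; so
    [c * c'] is not zero. *)
Lemma covers_stable P c c' e : primitive_idem (ZkC P) e ->
    primitive_idem (ZkC (nu @* P)) c -> primitive_idem (ZkC (nu @* P)) c' ->
    mu @* 'C(nu @* P) \subset mu @* (nu @* 'C(P)) ->
    push mu (push nu e) = push mu c -> push mu c' <> 0 ->
  covers P c' e -> c' = c.
Proof.
move=> pe pc pc' sC stab c'0 cov.
have := covers_push pe sC cov; rewrite stab => h.
apply/esym/(primitive_idem_eq (comm_subalg_ZkC k (nu @* P)) pc pc') => cc.
by apply: c'0; rewrite -h -(pushM (morphTM mu)) cc raddf0.
Qed.

End CoveringOrder.

(** * Profinite groups and their finite quotients *)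

Section Topology.
Local Open Scope group_scope.
Local Open Scope classical_set_scope.
Variable G : profiniteGroupType.
Implicit Types (x y g : G) (M : openNormal G).
Local Notation closed := topology_structure.closed.

Lemma qproj1 M : qproj M 1 = 1.
Proof. by []. Qed.

Lemma qprojVg M x : qproj M x^-1 = (qproj M x)^-1.
Proof. exact: qprojV. Qed.

Lemma qprojJ M x g : qproj M (x ^ g) = qproj M x ^ qproj M g.
Proof. by rewrite !conjgE !qprojMg qprojVg. Qed.

Lemma qproj_surj M (u : quo M) : exists x, qproj M x = u.
Proof. by eexists; apply: qreprK. Qed.

Lemma qproj_ker M x : qproj M x = 1 <-> on_set M x.
Proof.
rewrite -qproj1 qproj_eq mulg1; split=> [/onV|/onV //].
by rewrite invgK.
Qed.

Lemma open_qproj_preim M (U : set (quo M)) : open (qproj M @^-1` U).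
Proof.
have -> : qproj M @^-1` U =
    \bigcup_(y in qproj M @^-1` U) ((fun x => y^-1 * x) @^-1` M).
  apply/seteqP; split=> [x Ux|x [y Uy /= Myx]] /=.
    by exists x => //=; rewrite mulVg; apply: on1.
  by have /qproj_eq <- := Myx.
apply: bigcup_open => y _; apply: open_comp; last exact: on_open.
move=> x _.
apply: (@continuous2_cvg _ _ _ _ _ _ (fun=> y^-1) id
  (fun a b : G => a * b)); [exact: (mulg_continuous (_, _)) | exact: cvg_cst |].
exact: cvg_id.
Qed.

Lemma closed_qproj_preim M (U : set (quo M)) : closed (qproj M @^-1` U).
Proof.
rewrite -[U]classical_sets.setCK preimage_setC; apply: open_closedC.
exact: (@open_qproj_preim M (~` U)).
Qed.

(** A cluster point of any sequence of points of the [C n] belongs to all of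
    them. *)
Lemma closed_nested_nonempty (C : nat -> set G) :
    (forall n, closed (C n)) -> (forall n, C n !=set0) ->
    (forall n, C n.+1 `<=` C n) ->
  exists x, forall n, C n x.
Proof.
move=> clC C0 decC.
have mono m n : (m <= n)%N -> C n `<=` C m.
  elim: n => [|n IH]; first by rewrite leqn0 => /eqP ->.
  rewrite leq_eqVlt => /orP [/eqP -> //|]; rewrite ltnS => /IH sub.
  exact: classical_sets.subset_trans (decC n) sub.
have [x_ hx] := choice C0.
have [x [_ clx]] := @profinite_compact G (x_ @ \oo) _ filterT.
exists x => n; apply: (clC n) => B nB.
have [|y [Cy By]] := clx (C n) B _ nB; last by exists y.
by exists n => // m /= nm; apply: mono nm _ (hx m).
Qed.

Variable N : nat -> openNormal G.
Hypothesis N_chain : forall i, N i.+1 `<=` N i.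
Hypothesis N_triv : \bigcap_i (N i : set G) = [set 1].

Lemma chain_le i j : (i <= j)%N -> N j `<=` N i.
Proof.
elim: j => [|j IH]; first by rewrite leqn0 => /eqP ->.
rewrite leq_eqVlt => /orP [/eqP -> //|]; rewrite ltnS => /IH sub.
exact: classical_sets.subset_trans (@N_chain j) sub.
Qed.

Lemma closed_on M : closed M.
Proof.
have -> : M = qproj M @^-1` [set 1] :> set G; last exact: closed_qproj_preim.
by apply/seteqP; split=> x /=; rewrite qproj_ker.
Qed.

Lemma chain_sub_open (U : set G) : open U -> U 1 -> exists i, N i `<=` U.
Proof.
move=> oU U1; apply: contrapT => /forallNP nU.
have [i|i|i|x hx] := @closed_nested_nonempty (fun i => N i `&` ~` U).
- by apply: closedI; [exact: closed_on|exact: open_closedC].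
- by have /existsNP [x /not_implyP [Nx Ux]] := nU i; exists x.
- by move=> x [/N_chain Nx Ux].
have : (\bigcap_i (N i : set G)) x by move=> i _; case: (hx i).
by rewrite N_triv => /= x1; case: (hx 0%N) => _; rewrite x1.
Qed.

Lemma qproj_inj x y i0 : (forall i, (i0 <= i)%N ->
  qproj (N i) x = qproj (N i) y) -> x = y.
Proof.
move=> xy; apply/eqP; rewrite -(inj_eq (mulgI x^-1)) mulVg eq_sym; apply/eqP.
suff : (\bigcap_i (N i : set G)) (x^-1 * y) by rewrite N_triv.
move=> i _; apply: (chain_le (leq_maxl i i0)).
by apply/qproj_eq/xy; rewrite leq_maxr.
Qed.

Lemma closed_levels (C : set G) x i0 : closed C ->
  (forall i, (i0 <= i)%N -> (qproj (N i) @` C) (qproj (N i) x)) -> C x.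
Proof.
move=> clC hx.
have [i|i|i|y hy] := @closed_nested_nonempty
    (fun i => C `&` (qproj (N (i0 + i)) @^-1` [set qproj (N (i0 + i)) x])).
- by apply: closedI => //; exact: closed_qproj_preim.
- by have [y Cy yx] := hx _ (leq_addr i i0); exists y.
- move=> y [Cy /= /qproj_eq yx]; split=> //=; apply/qproj_eq.
  by move: yx; rewrite addnS; apply: N_chain.
rewrite (@qproj_inj x y i0); first by case: (hy 0%N).
by move=> i /subnKC <-; case: (hy (i - i0)%N).
Qed.

End Topology.

Section Images.
Local Open Scope group_scope.
Local Open Scope classical_set_scope.
Variable G : profiniteGroupType.
Implicit Types (x y g : G) (M : openNormal G) (P Q D : set G).

Section Subgroup.
Variables (A : set G) (sA : subgroup A).

Lemma subgroup1 : A 1. Proof. by case: sA. Qed.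

Lemma subgroupV x : A x -> A x^-1.
Proof. by move=> Ax; rewrite -[x^-1]mul1g; apply: sA.2 => //;
  apply: subgroup1. Qed.

Lemma subgroupM x y : A x -> A y -> A (x * y).
Proof. by move=> Ax Ay; rewrite -[y]invgK; apply: sA.2 => //;
  apply: subgroupV. Qed.

End Subgroup.

Lemma mem_qimg M D u :
  reflect (exists2 x, D x & qproj M x = u) (u \in qimg M D).
Proof.
by rewrite /qimg /asfin inE; apply: (iffP idP) => [/set_mem|h] //;
  apply/mem_set.
Qed.

Lemma mem_qproj M D x : D x -> qproj M x \in qimg M D.
Proof. by move=> Dx; apply/mem_qimg; exists x. Qed.

Lemma qimgS M P Q : P `<=` Q -> qimg M P \subset qimg M Q.
Proof.
move=> sPQ; apply/subsetP => u /mem_qimg [x Px <-].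
exact/mem_qproj/sPQ.
Qed.

Lemma qimg_group_set M D : subgroup D -> group_set (qimg M D).
Proof.
move=> sD; apply/group_setP; split.
  by rewrite -(qproj1 M); apply: mem_qproj; apply: subgroup1.
move=> u v /mem_qimg [x Dx <-] /mem_qimg [y Dy <-].
by rewrite -qprojMg; apply: mem_qproj; apply: subgroupM.
Qed.

Definition qgrp M D (sD : subgroup D) : {group quo M} :=
  Group (qimg_group_set M sD).

Lemma qimg_conj M P g : qimg M (conj_set P g) = qimg M P :^ qproj M g.
Proof.
apply/setP => u; apply/idP/imsetP =>
  [/mem_qimg [_ [x Px <-] <-]|[v /mem_qimg [x Px <-] ->]].
  by exists (qproj M x); [exact: mem_qproj|rewrite qprojJ].
by rewrite -qprojJ; apply: mem_qproj; exists x.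
Qed.

Section Natural.
Variables (M M' : openNormal G) (sMM' : M `<=` M').

Definition qmorph : {morphism [set: quo M]%SET >-> quo M'} :=
  Morphism (in2W (qmapM sMM')).

Lemma qmorphE x : qmorph (qproj M x) = qproj M' x.
Proof. exact: qmapE. Qed.

Lemma qmorph_surj : qmorph @* [set: quo M]%SET = [set: quo M']%SET.
Proof.
apply/eqP; rewrite eqEsubset subsetT; apply/subsetP => u _.
have [x <-] := qproj_surj u; rewrite -qmorphE.
by apply: mem_morphim; rewrite inE.
Qed.

Lemma qmorph_qimg D : qmorph @* qimg M D = qimg M' D.
Proof.
apply/setP => u; apply/morphimP/mem_qimg =>
  [[_ _ /mem_qimg [x Dx <-] ->]|[x Dx <-]].
  by exists x; rewrite ?qmorphE.
by exists (qproj M x); [rewrite inE|apply: mem_qproj|rewrite qmorphE].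
Qed.

Lemma qmorph_ker : 'ker qmorph = qimg M M'.
Proof.
apply/setP => u; apply/idP/mem_qimg => [/kerP|[x M'x <-]].
  by have [x <-] := qproj_surj u; rewrite qmorphE inE qproj_ker => h; exists x;
    [exact: h|].
by apply/kerP; rewrite ?inE // qmorphE; apply/qproj_ker.
Qed.

Lemma qimg_ker D : qimg M D :&: 'ker qmorph = qimg M (D `&` M').
Proof.
apply/setP => u; apply/setIP/mem_qimg =>
  [[/mem_qimg [x Dx <-]]|[x [Dx M'x] <-]].
  move/kerP; rewrite inE => /(_ isT); rewrite qmorphE => /qproj_ker M'x.
  by exists x.
split; first exact: mem_qproj.
by apply/kerP; rewrite ?inE // qmorphE; apply/qproj_ker.
Qed.

End Natural.

Lemma qmorph_comp (M1 M2 M3 : openNormal G)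
    (s12 : M1 `<=` M2) (s23 : M2 `<=` M3) (s13 : M1 `<=` M3) u :
  qmorph s23 (qmorph s12 u) = qmorph s13 u.
Proof. by have [x <-] := qproj_surj u; rewrite !qmorphE. Qed.

Lemma push_qmorph_comp (k : closedFieldType) (M1 M2 M3 : openNormal G)
    (s12 : M1 `<=` M2) (s23 : M2 `<=` M3) (s13 : M1 `<=` M3) (a : galg k (quo
      M1)) :
  push (qmorph s23) (push (qmorph s12) a) = push (qmorph s13) a.
Proof.
apply/ffunP => y; rewrite !ffunE.
under eq_bigr do rewrite ffunE.
rewrite (exchange_big_dep xpredT) //= [RHS]big_mkcond /=; apply: eq_bigr => x _.
have e : qmap M3 (qmap M2 x) = qmap M3 x by exact: (qmorph_comp s12 s23 s13).
case: ifP => xy.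
  rewrite (big_pred1 (qmap M2 x)) // => u.
  by apply/andP/eqP => [[_ /eqP <-]|->] //; rewrite /= e xy eqxx.
rewrite big_pred0 // => u; apply: contraFF xy => /andP [/eqP <- /eqP <-].
by rewrite /= e.
Qed.

End Images.

(** * Monotone sequences of ranks and idempotents *)

Section Stabilisation.
Local Open Scope ring_scope.

Lemma nonincreasing_stable (f : nat -> nat) : (forall n, (f n.+1 <= f n)%N) ->
  exists m, forall n, (m <= n)%N -> f n.+1 = f n.
Proof.
move=> dec; have [n] := ubnP (f 0%N); elim: n f dec => // n IH f dec lt0.
have [h|/existsNP [m hm]] := pselect (forall n, f n.+1 = f n);
  first by exists 0%N.
have mono a : (f a <= f 0)%N.
  by elim: a => // a IHa; apply: leq_trans (dec a) IHa.
have [|//|m' hm'] := IH (fun n => f (n + m.+1)%N); first by move=> a;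
  apply: dec.
  rewrite add0n -ltnS; apply: leq_trans lt0; rewrite ltnS.
  apply: leq_trans (mono m); rewrite ltn_neqAle dec andbT.
  by apply/eqP.
exists (m' + m.+1)%N => a ma; have sa : (m.+1 <= a)%N by apply: leq_trans ma;
  apply: leq_addl.
by rewrite -(subnK sa) -addSn hm' // leq_subRL // addnC.
Qed.

(** Each term lies in the ideal generated by the next one, so the ranks grow
    and become constant. *)
Lemma increasing_idem_stable (k : closedFieldType) (H : finGroupType)
    (ep : nat -> galg k H) : (forall n, ep n.+1 * ep n = ep n) ->
    (forall n, ep n * ep n.+1 = ep n.+1 * ep n) ->
    (forall n, ep n * ep n = ep n) ->
  exists m, forall n, (m <= n)%N -> ep n.+1 = ep n.
Proof.
move=> inc com idem.
have bnd n : (galg_rank (ep n) <= #|H|)%N by apply: rank_leq_row.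
have le n : (galg_rank (ep n) <= galg_rank (ep n.+1))%N.
  by rewrite -{1}inc; apply: galg_rank_mul.
have [n|m hm] := @nonincreasing_stable (fun n => #|H| - galg_rank (ep n))%N.
  exact: leq_sub2l.
exists m => n /hm er.
have {}er : galg_rank (ep n.+1) = galg_rank (ep n).
  by rewrite -(subKn (bnd n.+1)) er subKn.
have [|y ey] := @galg_rank_ge k H (ep n.+1) (ep n); first by rewrite inc er.
rewrite inc in ey.
by rewrite -[RHS](inc n) -com {2}ey mulrA idem -ey.
Qed.

End Stabilisation.

(** * Brauer pairs at successive levels *)

Section Levels.
Local Open Scope group_scope.
Local Open Scope classical_set_scope.
Local Open Scope ring_scope.
Variables (k : closedFieldType) (p : nat) (hp : p \in [pchar k]%R).
Variables (G : profiniteGroupType) (N : nat -> openNormal G).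
Hypothesis N_chain : forall i, N i.+1 `<=` N i.
Variables (D : set G) (sD : subgroup D) (e : idem_seq k N).
Hypothesis bD : forall i, is_bpair p (qimg (N i) D, e i).
Implicit Types (Q R : set G) (g x : G) (i j n m : nat).

Local Notation Nle := (chain_le N_chain).

(** By [sub_idem_le], the default value is not taken when [Q] is a subgroup of
    [D]. *)
Definition sub_idem Q : idem_seq k N := fun i =>
  xget 0 [set u | bp_le p (qimg (N i) Q, u) (qimg (N i) D, e i)].

Lemma sub_idem_le Q i : subgroup Q -> Q `<=` D ->
  bp_le p (qimg (N i) Q, sub_idem Q i) (qimg (N i) D, e i).
Proof.
move=> sQ sQD.
have [u le_u] := bp_le_exists hp (P := qgrp (N i) sQ) (bD i) (qimgS _ sQD).
exact: (@xgetI _ 0 [set u | bp_le p (qimg (N i) Q, u) (qimg (N i) D, e i)] u).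
Qed.

Lemma sub_idem_unique Q i u : bp_le p (qimg (N i) Q, u) (qimg (N i) D, e i) ->
  u = sub_idem Q i.
Proof.
move=> le; apply: (bp_le_unique hp le).
exact: (@xgetI _ 0 [set u | bp_le p (qimg (N i) Q, u) (qimg (N i) D, e i)] u).
Qed.

(** These are the subgroups of [D] that can be recovered from their images at
    level [i], see [between_eq]; in particular they are finite in number. *)
Definition between i Q := [/\ subgroup Q, Q `<=` D & D `&` N i `<=` Q].

Lemma between_eq i Q R : between i Q -> between i R ->
  qimg (N i) Q = qimg (N i) R -> Q = R.
Proof.
move=> bQ bR eQR; have half A B : between i A -> between i B ->
    qimg (N i) A = qimg (N i) B -> A `<=` B.
  move=> [_ AD _] [sB BD DB] eAB x Ax.
  have : qproj (N i) x \in qimg (N i) B by rewrite -eAB; apply: mem_qproj.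
  case/mem_qimg => y By /qproj_eq yx.
  rewrite -(mulKVg y x); apply: subgroupM => //; apply: DB; split=> //.
  by apply: subgroupM => //; [apply: subgroupV => //; apply: BD|apply: AD].
by apply/seteqP; split; apply: half.
Qed.

Variable i0 : nat.
Hypothesis sylD : forall i j (sij : N j `<=` N i), (i0 <= i <= j)%N ->
  Sylow_kernel p (qmorph sij) (qimg (N j) D).
Hypothesis covD : forall i, (i0 <= i)%N ->
  covers (qmorph (@N_chain i)) (qimg (N i.+1) D) (e i) (e i.+1).

Lemma between_Sylow i Q a b (sab : N b `<=` N a) :
  (i0 <= i)%N -> (i <= a <= b)%N -> between i Q ->
  Sylow_kernel p (qmorph sab) (qimg (N b) Q).
Proof.
move=> i0i /andP [ia ab] [sQ QD DQ].
have [pD sylDD] := sylD sab (introT andP (conj (leq_trans i0i ia) ab)).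
split; first exact: (pgroupS (G := qgrp (N b) sD) (H :=
  qgrp (N b) sQ) (qimgS _ QD) pD).
move: sylDD; rewrite !qimg_ker.
suff -> : D `&` N a = Q `&` N a by [].
apply/seteqP; split=> x [Qx Nx]; split=> //; last exact: QD.
by apply: DQ; split=> //; apply: (Nle ia).
Qed.

(** Inherited from [D] through [covers_le]. *)
Lemma between_covers i Q j : (i0 <= i <= j)%N -> between i Q ->
  covers (qmorph (@N_chain j)) (qimg (N j.+1) Q) (sub_idem Q j) (sub_idem Q
    j.+1).
Proof.
move=> /andP [i0i ij] bQ; have [sQ QD DQ] := bQ.
apply: (covers_le hp (qmorph_surj (@N_chain j)) (sub_idem_le j sQ QD)
  (P := qgrp _ sQ) (R := qgrp _ sD) (sub_idem_le j.+1 sQ QD)).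
- by apply: (between_Sylow (i := i)); rewrite // ij leqnSn.
- exact: qmorph_qimg.
- exact: qmorph_qimg.
- exact: covD (leq_trans i0i ij).
Qed.

Definition transports Q R j g : Prop :=
  bp_le p (bp_conj (qimg (N j) Q, sub_idem Q j) (qproj (N j) g))
          (qimg (N j) R, sub_idem R j).

Lemma transports_lift i Q R j g : (i0 <= i <= j)%N -> between i Q ->
  between i R ->
  transports Q R j g -> exists2 g', transports Q R j.+1 g' &
    forall x, Q x -> qproj (N j) (x ^ g')%g = qproj (N j) (x ^ g)%g.
Proof.
move=> hij bQ bR; have [sQ QD DQ] := bQ; have [sR RD DR] := bR.
have /andP [i0i ij] := hij.
have [bpQ _ _] := bp_leP (sub_idem_le j.+1 sQ QD).
have [bpR _ _] := bp_leP (sub_idem_le j.+1 sR RD).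
have syl A : between i A -> Sylow_kernel p (qmorph (@N_chain j)) (qimg (N j.+1)
  A).
  by apply: between_Sylow => //; rewrite ij leqnSn.
have im A := qmorph_qimg (@N_chain j) A.
move=> tr; have tr' : bp_le p
    (bp_conj (qmorph (@N_chain j) @* qgrp (N j.+1) sQ, sub_idem Q j) (qproj (N
      j) g))
    (qmorph (@N_chain j) @* qgrp (N j.+1) sR, sub_idem R j).
  by rewrite /= !im.
have [u le_u hu] := covers_lift hp (qmorph_surj (@N_chain j))
  (P := qgrp _ sQ) (R := qgrp _ sR) bpQ bpR (syl _ bQ) (syl _ bR)
  (between_covers hij bQ) (between_covers hij bR) tr'.
have [g' eg'] := qproj_surj u.
exists g'; first by rewrite /transports eg'.
move=> x Qx; have := hu _ (mem_qproj (N j.+1) Qx).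
by rewrite -eg' -qprojJ !qmorphE -qprojJ.
Qed.

Lemma sub_idem_prim Q j : subgroup Q -> Q `<=` D ->
  primitive_idem (ZkC (qimg (N j) Q)) (sub_idem Q j).
Proof. by move=> sQ QD; have [[]] := bp_leP (sub_idem_le j sQ QD). Qed.

Local Notation up n i := (qmorph (Nle (leq_addl n i))).

(** At level [i] itself the map is the identity, and an idempotent covering one
    with non-zero image has non-zero image. *)
Lemma sub_idem_push_neq0 i Q n : (i0 <= i)%N -> between i Q ->
  push (up n i) (sub_idem Q (n + i)) <> 0.
Proof.
move=> i0i bQ; have [sQ QD _] := bQ; elim: n => [|n IH].
  have -> : push (up 0 i) (sub_idem Q i) = sub_idem Q i.
    apply/ffunP => u; rewrite ffunE (big_pred1 u) // => v.
    by have [x <-] := qproj_surj v; rewrite /= qmapE.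
  by have [_ e0 _ _] := sub_idem_prim i sQ QD.
rewrite -(push_qmorph_comp (@N_chain (n + i)) (Nle (leq_addl n i))).
apply: (covers_push_neq0 (P := qgrp _ sQ)) IH;
  apply: (between_covers (i := i)) => //.
by rewrite i0i leq_addl.
Qed.

(** The images of the centralisers in [G/N_i] decrease, and those of the
    idempotents increase, with the level. *)
Lemma images_stabilise i Q : (i0 <= i)%N -> between i Q ->
  exists m, forall n, (m <= n)%N ->
    up n i @* 'C(qimg (N (n + i)) Q) \subset
      up n i @* (qmorph (@N_chain (n + i)) @* 'C(qimg (N (n + i).+1) Q)) /\
    push (up n i) (push (qmorph (@N_chain (n + i))) (sub_idem Q (n + i).+1)) =
      push (up n i) (sub_idem Q (n + i)).
Proof.
move=> i0i bQ; have [sQ QD _] := bQ.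
pose A n := up n i @* 'C(qimg (N (n + i)) Q).
pose B n := up n i @* (qmorph (@N_chain (n + i)) @* 'C(qimg (N (n + i).+1) Q)).
have AB n : A n.+1 = B n.
  apply/setP => w; apply/morphimP/morphimP.
    move=> [u _ uC ->]; exists (qmorph (@N_chain (n + i)) u);
      rewrite ?in_setT //.
      exact: mem_morphimT.
    exact/esym/qmorph_comp.
  move=> [_ _ /morphimP [u _ uC ->] ->]; exists u; rewrite ?in_setT //.
  exact: qmorph_comp.
have BA n : B n \subset A n.
  by apply: morphimS; rewrite -(qmorph_qimg (@N_chain (n + i)));
    apply: morphim_cent.
have [n|m1 hm1] := @nonincreasing_stable (fun n => #|A n|).
  by rewrite AB; apply: subset_leq_card.
have sAB n : (m1 <= n)%N -> A n \subset B n.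
  move=> mn; have : B n == A n by rewrite eqEcard BA -AB hm1 /=.
  by move/eqP=> ->.
pose ep n := push (up n i) (sub_idem Q (n + i)).
have epS n : ep n.+1 =
    push (up n i) (push (qmorph (@N_chain (n + i))) (sub_idem Q (n + i).+1)).
  exact/esym/push_qmorph_comp.
have inc n : (m1 <= n)%N -> ep n.+1 * ep n = ep n.
  move=> mn; rewrite epS /ep.
  apply: (covers_push (P := qgrp _ sQ)).
  - exact: sub_idem_prim.
  - by rewrite /= qmorph_qimg; apply: sAB.
  - by apply: (between_covers (i := i)); rewrite // i0i leq_addl.
have idem n : ep n * ep n = ep n.
  rewrite /ep -(pushM (@morphTM _ _ _)).
  by have [_ _ -> _] := sub_idem_prim (n + i) sQ QD.
have com n : (m1 <= n)%N -> ep n * ep n.+1 = ep n.+1 * ep n.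
  move=> mn; have /ZkCP [C1 f1] : ZkC (qimg (N (n + i).+1) Q) (sub_idem Q (n +
    i).+1).
    by have [] := sub_idem_prim (n + i).+1 sQ QD.
  have /ZkCP [C0 _] : ZkC (qimg (N (n + i)) Q) (sub_idem Q (n + i)).
    by have [] := sub_idem_prim (n + i) sQ QD.
  have [|_ cB] := (center_galg_on (up n i @* (qmorph (@N_chain (n + i)) @*
    'C(qimg (N (n + i).+1) Q)))%G (ep n.+1)).2.
    by rewrite epS; split; [do 2!apply: push_on|do 2!apply: push_fixed].
  by apply/esym/cB; apply: galg_onS (sAB n mn) _; apply: push_on.
have [n|n|n|m2 hm2] := @increasing_idem_stable k _ (fun n => ep (n + m1)%N).
- by apply: inc; apply: leq_addl.
- by apply: com; apply: leq_addl.
- exact: idem.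
exists (m2 + m1)%N => n mn; have m1n : (m1 <= n)%N.
  by apply: leq_trans mn; apply: leq_addl.
split; first exact: sAB.
rewrite -epS -/(ep n) -(subnK m1n); apply: hm2.
by rewrite leq_subRL // addnC.
Qed.

(** Past the stable level, a transporting element transports at the level below
    as well: the idempotent found below [R] there is covered by a conjugate of
    that of [Q], and has to be the expected one by stability. *)
Lemma transports_mono i Q : (i0 <= i)%N -> between i Q ->
  exists m, forall j, (m <= j)%N -> forall R, between i R -> forall g,
    transports Q R j.+1 g -> transports Q R j g.
Proof.
move=> i0i bQ; have [m hm] := images_stabilise i0i bQ; have [sQ QD _] := bQ.
exists (m + i)%N => j mj R bR g tr; have [sR RD _] := bR.
have ij : (i <= j)%N by apply: leq_trans mj; apply: leq_addl.
have mn : (m <= j - i)%N by rewrite leq_subRL // addnC.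
move: tr; rewrite -(subnK ij); move: (j - i)%N mn => n mn {j mj ij} tr.
have [stC stE] := hm n mn.
have hij : (i0 <= i <= n + i)%N by rewrite i0i leq_addl.
pose nu := qmorph (@N_chain (n + i)); pose gq := qproj (N (n + i).+1) g.
have ngq : nu gq = qproj (N (n + i)) g by rewrite /nu qmorphE.
have im A : nu @* qimg (N (n + i).+1) A = qimg (N (n + i)) A by apply:
  qmorph_qimg.
pose Q1 := qgrp (N (n + i).+1) sQ; pose R1 := qgrp (N (n + i).+1) sR.
have imQ : nu @* (Q1 :^ gq)%G = qimg (N (n + i)) Q :^ qproj (N (n + i)) g.
  by rewrite /= morphimJ ?in_setT // im ngq.
have [_ _ /= sQR1] := bp_leP tr.
have sQR : (qgrp (N (n + i)) sQ :^ qproj (N (n + i)) g)%G \subset qimg (N (n +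
  i)) R.
  by rewrite /= -imQ; have := morphimS nu sQR1; rewrite im.
have leR := sub_idem_le (n + i) sR RD; have [bR' _ _] := bp_leP leR.
have [c le_c] := bp_le_exists hp bR' sQR.
have sylQ : Sylow_kernel p nu (Q1 :^ gq).
  apply: Sylow_kernel_conj; apply: (between_Sylow (i := i)) => //.
  by rewrite leq_addl leqnSn.
have cov : covers nu (Q1 :^ gq) c (galg_conj gq (sub_idem Q (n + i).+1)).
  apply: (covers_le hp (qmorph_surj _) le_c (P := (Q1 :^ gq)%G) (R :=
    R1) tr) => //.
    exact: im.
  exact: between_covers hij bR.
have := covers_conj gq^-1%g cov.
rewrite conjsgK galg_conjK morphV ?in_setT // ngq => cov'.
have c0 : push (up n i) c <> 0.
  apply: (push_le_neq0 (nu := up n i) hp le_c).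
  exact: sub_idem_push_neq0.
have ec : galg_conj (qproj (N (n + i)) g)^-1%g c = sub_idem Q (n + i).
  apply: (covers_stable (P := Q1) (e := sub_idem Q (n + i).+1)
            _ _ _ _ stE _ cov').
  - exact: sub_idem_prim.
  - by rewrite im; apply: sub_idem_prim.
  - have [[_ _ /= pc] _ _] := bp_leP le_c.
    by rewrite im -[qimg _ Q](conjsgK (qproj (N (n + i)) g));
      apply: primitive_idem_conj.
  - by rewrite im.
  - rewrite push_conj => h; apply: c0.
    by rewrite -[push _ c](galg_conjKV (up n i (qproj (N (n + i))
      g)^-1%g)^-1%g) invgK h raddf0.
by rewrite /transports /bp_conj /= -ec galg_conjKV.
Qed.

(** * The fusion systems of the levels and of the profinite group *)

Definition stable_from i m := (i <= m)%N /\ forall j, (m <= j)%N ->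
  forall Q R, between i Q -> between i R -> forall g,
  transports Q R j.+1 g -> transports Q R j g.

(** Only finitely many subgroups lie between [D n N_i] and [D]. *)
Lemma stable_from_exists i : (i0 <= i)%N -> exists m, stable_from i m.
Proof.
move=> i0i; pose P (U : {set quo (N i)}) m := forall Q, between i Q ->
  qimg (N i) Q = U -> forall j, (m <= j)%N -> forall R, between i R -> forall g,
  transports Q R j.+1 g -> transports Q R j g.
have /choice [f hf] : forall U, exists m, P U m.
  move=> U; have [[Q [bQ QU]]|nex] :=
    pselect (exists Q, between i Q /\ qimg (N i) Q = U).
    have [m hm] := transports_mono i0i bQ; exists m => Q' bQ' Q'U.
    by rewrite (between_eq bQ' bQ) // Q'U QU.
  by exists 0%N => Q bQ QU; case: nex; exists Q.
exists (maxn i (\max_U f U)%N); split; first exact: leq_maxl.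
move=> j mj Q R bQ bR g; apply: (hf (qimg (N i) Q)) => //.
apply: leq_trans mj; apply: leq_trans (leq_maxr _ _).
exact: (leq_bigmax (F := f)).
Qed.

Lemma transports_down i m Q R j j' g : stable_from i m -> between i Q ->
  between i R ->
  (m <= j' <= j)%N -> transports Q R j g -> transports Q R j' g.
Proof.
move=> [_ st] bQ bR /andP [mj' /subnK <-]; elim: (j - j')%N => // n IH.
rewrite addSn => /st tr; apply: IH; apply: tr => //.
by apply: leq_trans mj' _; apply: leq_addl.
Qed.

Local Notation closed := topology_structure.closed.

Lemma closed_transports Q R j : closed [set g | transports Q R j g].
Proof.
exact: (@closed_qproj_preim _ (N j) [set u | bp_le p
  (bp_conj (qimg (N j) Q, sub_idem Q j) u) (qimg (N j) R, sub_idem R j)]).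
Qed.

Lemma closed_induces Q i (f : quo (N i) -> quo (N i)) :
  closed [set g | forall x, Q x -> qproj (N i) (x ^ g)%g = f (qproj (N i) x)].
Proof.
have := @closed_qproj_preim _ (N i) [set u | forall x, Q x ->
  (qproj (N i) x ^ u)%g = f (qproj (N i) x)].
congr closed; apply/seteqP.
by split=> g h x Qx /=; have := h x Qx; rewrite /= qprojJ.
Qed.

(** Conjugations at a stable level lift to all higher levels; by compactness they
    lift to [G]. *)
Lemma transports_limit i m Q R g : (i0 <= i)%N -> stable_from i m ->
    between i Q -> between i R -> transports Q R m g ->
  exists g', (forall j, (m <= j)%N -> transports Q R j g') /\
    forall x, Q x -> qproj (N i) (x ^ g')%g = qproj (N i) (x ^ g)%g.
Proof.
move=> i0i st bQ bR tr; have [im _] := st.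
(* Agreement with [g] is required only modulo [N_i], where it is preserved by
   each of the lifts. *)
pose C n := [set h | transports Q R (n + m) h] `&`
  [set h | forall x, Q x -> qproj (N i) (x ^ h)%g = (qproj (N i) x ^ qproj (N
    i) g)%g].
have [n|n|n|g' hg'] := @closed_nested_nonempty G C.
- apply: closedI; first exact: closed_transports.
  exact: (@closed_induces Q i (fun u => u ^ qproj (N i) g)%g).
- elim: n => [|n [h [trh ih]]].
    by exists g; split=> // x _; rewrite qprojJ.
  have hij : (i0 <= i <= n + m)%N by rewrite i0i (leq_trans im) ?leq_addl.
  have [h' trh' ih'] := transports_lift hij bQ bR trh.
  exists h'; split=> // x Qx; rewrite -(ih x Qx); apply/qproj_eq.
  have /andP [_ inm] := hij; apply: (Nle inm).
  exact/qproj_eq/ih'.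
- move=> h [trh ih]; split=> //=.
  exact: (st.2 (n + m)%N (leq_addl n m) Q R bQ bR h trh).
exists g'; split=> [j /subnK <-|x Qx]; first by case: (hg' (j - m)%N).
by rewrite [RHS]qprojJ; case: (hg' 0%N) => _; apply.
Qed.

Hypothesis N_triv : \bigcap_i (N i : set G) = [set 1%g].
Hypothesis pbD : is_pbpair p D e.
Hypothesis clD : closed D.

Lemma open_subgroup_between Q : open_subgroup_of D Q ->
  exists i1, forall i, (i1 <= i)%N -> between i Q.
Proof.
move=> [sQ [U oU QDU]]; have U1 : U 1%g.
  by have := subgroup1 sQ; rewrite QDU => -[].
have [i1 NU] := chain_sub_open N_chain N_triv oU U1.
exists i1 => i /Nle sub; split=> //; first by rewrite QDU => x [].
by rewrite QDU => x [Dx Nx]; split=> //; apply/NU/sub.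
Qed.

Lemma between_open_subgroup i Q : between i Q -> open_subgroup_of D Q.
Proof.
move=> [sQ QD DQ]; split=> //.
exists (qproj (N i) @^-1` (qproj (N i) @` Q)); first exact: open_qproj_preim.
apply/seteqP; split=> [x Qx|x [Dx [y Qy /qproj_eq yx]]].
  by split; [exact: QD|exists x].
rewrite -(mulKVg y x); apply: subgroupM => //; apply: DQ; split=> //.
by apply: subgroupM => //; apply: subgroupV => //; apply: QD.
Qed.

Lemma open_subgroup_sub Q : open_subgroup_of D Q -> subgroup Q /\ Q `<=` D.
Proof. by move=> [sQ [U _ QDU]]; split=> [//|x]; rewrite QDU => -[]. Qed.

(** The linking condition holds at the levels at which [Q] contains [D n N_i]. *)
Lemma sub_idem_pbpair Q : open_subgroup_of D Q -> is_pbpair p Q (sub_idem Q).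
Proof.
move=> oQ; have [sQ QD] := open_subgroup_sub oQ.
have [[S sylS [_ [U oU DSU]]] _ _] := pbD.
have [_ [U' oU' QDU]] := oQ.
split.
- exists S => //; split=> //; exists (U `&` U'); first exact: openI.
  by rewrite QDU DSU classical_sets.setIA.
- by move=> i; apply: sub_idem_prim.
have [i1 bQ] := open_subgroup_between oQ.
exists (maxn i0 i1) => // i /=; rewrite geq_max => /andP [i0i i1i] _.
apply/(nu_minus_covers (nu := qmorph (@N_chain i)) (P := qgrp _ sQ)).
- exact: sub_idem_prim.
- by rewrite /= qmorph_qimg; apply: sub_idem_prim.
by apply: (between_covers (i := i)); rewrite ?i0i ?leqnn //; apply: bQ.
Qed.

Lemma sub_idem_pbp_le Q : open_subgroup_of D Q -> pbp_le p Q (sub_idem Q) D e.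
Proof.
move=> /open_subgroup_sub [sQ QD].
by exists 0%N => // i _; apply: sub_idem_le.
Qed.

Lemma profinite_homP Q R phi : fus_hom (profinite_fusion p D e) Q R phi <->
  [/\ open_subgroup_of D Q, open_subgroup_of D R & exists g,
    (\forall j \near \oo, transports Q R j g) /\ forall x, Q x ->
      phi x = (x ^ g)%g].
Proof.
split=> [[g [eP [eQ [[oQ oR] [_ leP] [_ leQ] tr hphi]]]]|[oQ oR [g [tr hphi]]]].
  split=> //; exists g; split=> //.
  near=> j; rewrite /transports /bp_conj /= -qimg_conj.
  have <- : eP j = sub_idem Q j by apply: sub_idem_unique; near: j.
  have <- : eQ j = sub_idem R j by apply: sub_idem_unique; near: j.
  by near: j.
exists g, (sub_idem Q), (sub_idem R); split=> //.
- by split; [exact: sub_idem_pbpair|exact: sub_idem_pbp_le].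
- by split; [exact: sub_idem_pbpair|exact: sub_idem_pbp_le].
near=> j; rewrite qimg_conj.
by have : transports Q R j g by near: j.
Unshelve. all: by end_near.
Qed.

Lemma level_homP Q R m f : subgroup Q -> subgroup R -> Q `<=` D -> R `<=` D ->
  fus_hom (level_fusion p D e m) (qproj (N m) @` Q) (qproj (N m) @` R) f <->
  exists g, transports Q R m g /\
    forall x, Q x -> f (qproj (N m) x) = qproj (N m) (x ^ g)%g.
Proof.
move=> sQ sR QD RD; split=> [[u [eP [eQ [leP leQ tr hf]]]]|[g [tr hf]]].
  have [g gu] := qproj_surj u; exists g; split.
    by rewrite /transports gu -(sub_idem_unique leP) -(sub_idem_unique leQ).
  by move=> x Qx; rewrite hf ?qprojJ ?gu //; exists x.
exists (qproj (N m) g), (sub_idem Q m), (sub_idem R m); split=> //.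
- exact: sub_idem_le.
- exact: sub_idem_le.
by move=> _ [x Qx <-]; rewrite hf // qprojJ.
Qed.

(** The inverse image of [P] in [D] contains [D n N_i]. *)
Lemma level_objP i m P : (i <= m)%N -> fus_obj (level_fusion p D e m) P ->
  level_ker N D m i `<=` P -> exists2 Q, between i Q & P = qproj (N m) @` Q.
Proof.
move=> im [sP PD] kP; exists (D `&` qproj (N m) @^-1` P).
  split.
  - split=> [|x y [Dx Px] [Dy Py]].
      by split; [exact: sD.1|rewrite /= qproj1; exact: sP.1].
    split; first exact: sD.2.
    by rewrite /= qprojMg qprojVg; apply: sP.2.
  - by move=> x [].
  - by move=> x [Dx Nx]; split=> //=; apply: kP; exists x.
apply/seteqP; split=> [u Pu|_ [x [Dx Px] <-] //].
have : u \in qimg (N m) D by apply: PD.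
by case/mem_qimg => x Dx xu; exists x => //; split=> //=; rewrite xu.
Qed.

Lemma between_level_obj i m Q : between i Q ->
  fus_obj (level_fusion p D e m) (qproj (N m) @` Q) /\
  level_ker N D m i `<=` qproj (N m) @` Q.
Proof.
move=> [sQ QD DQ]; split; last by move=> _ [x Dx <-]; exists x => //; apply: DQ.
split; last by move=> _ [x Qx <-]; apply/mem_qproj/QD.
split; first by exists 1%g; rewrite ?qproj1 //; apply: subgroup1.
move=> _ _ [x Qx <-] [y Qy <-]; exists (x * y^-1)%g; first exact: sQ.2.
by rewrite qprojMg qprojVg.
Qed.

(** Morphisms of the profinite fusion system are visible at level [m] by stability;
    those of level [m] come from elements of [G] by [transports_limit]. *)
Theorem quot_fusion_level i m : (i0 <= i)%N -> stable_from i m ->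
  quot_fusion (qproj (N i)) (D `&` N i) (profinite_fusion p D e) =
  level_quot p D e m i.
Proof.
move=> i0i st; have [im _] := st.
have qE x : qmap (N i) (qproj (N m) x) = qproj (N i) x by apply: qmapE;
  apply: Nle.
have qI A : qmap (N i) @` (qproj (N m) @` A) = qproj (N i) @` A.
  apply/seteqP; split=> [_ [_ [x Ax <-] <-]|_ [x Ax <-]].
    by exists x; rewrite ?qE.
  by exists (qproj (N m) x); [exists x|rewrite qE].
have bet Q : open_subgroup_of D Q -> D `&` N i `<=` Q -> between i Q.
  by move=> /open_subgroup_sub [].
rewrite /level_quot /quot_fusion; congr Fusion.
- rewrite -qI; congr (_ @` _); apply/seteqP; split=> u /=.
    by move=> [x Dx <-]; apply: mem_qproj.
  by case/mem_qimg => x Dx <-; exists x.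
- apply/seteqP; split=> [_ [Q [oQ DQ ->]]|_ [P [oP kP ->]]].
    have [o1 k1] := between_level_obj m (bet _ oQ DQ).
    by exists (qproj (N m) @` Q); rewrite qI.
  have [Q bQ ->] := level_objP im oP kP; exists Q; rewrite qI; split=> //.
    exact: between_open_subgroup bQ.
  by case: bQ.
apply/funext => Qb; apply/funext => Rb; apply/seteqP; split.
  move=> fb [Q [R [f [[oQ oR] [DQ DR] [-> ->] /profinite_homP [_ _ [g [tr hf]]]
    hfb]]]].
  have bQ := bet _ oQ DQ; have bR := bet _ oR DR.
  have [oQ1 kQ1] := between_level_obj m bQ;
    have [oR1 kR1] := between_level_obj m bR.
  have [sQ QD _] := bQ; have [sR RD _] := bR.
  have trm : transports Q R m g.
    have [j0 _ hj] := tr; have := hj (maxn j0 m) (leq_maxl _ _).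
    by apply: (transports_down st) => //; rewrite leqnn leq_maxr.
  exists (qproj (N m) @` Q), (qproj (N m) @` R), (fun u => u ^ qproj (N m) g)%g.
  split=> //.
    by apply/level_homP => //; exists g; split=> // x _; rewrite qprojJ.
  by move=> _ [x Qx <-]; rewrite -qprojJ !qE hfb // hf.
move=> fb [P [S [f [[oP oS] [kP kS] [-> ->] hom hfb]]]].
have [Q bQ eP] := level_objP im oP kP; have [R bR eS] := level_objP im oS kS.
subst P S; have [sQ QD DQ] := bQ; have [sR RD DR] := bR.
have [g [trm hf]] := (level_homP f sQ sR QD RD).1 hom.
have [g' [tr' ig']] := transports_limit i0i st bQ bR trm.
have oQ := between_open_subgroup bQ; have oR := between_open_subgroup bR.
exists Q, R, (fun x => x ^ g')%g; rewrite !qI; split=> //.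
  apply/profinite_homP; split=> //; exists g'; split=> //.
  by exists m.
move=> x Qx; rewrite -qE hfb; last by exists x.
by rewrite hf // qE ig'.
Qed.

(** The subgroup [Q (D n N_i)]. *)
Definition saturate i Q : set G := D `&` qproj (N i) @^-1` (qproj (N i) @` Q).

Lemma saturate_image i Q : Q `<=` D ->
  qproj (N i) @` saturate i Q = qproj (N i) @` Q.
Proof.
move=> QD; apply/seteqP; split=> [_ [x [_ Qx] <-] //|_ [x Qx <-]].
by exists x => //; split; [exact: QD|exists x].
Qed.

Lemma sub_saturate i Q : Q `<=` D -> Q `<=` saturate i Q.
Proof. by move=> QD x Qx; split; [exact: QD|exists x]. Qed.

Lemma saturate_between i Q : subgroup Q -> Q `<=` D -> between i (saturate i Q).
Proof.
move=> sQ QD; split=> [|x []//|x [Dx Nx]]; last first.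
  split=> //; exists 1%g; first exact: sQ.1.
  by rewrite qproj1; apply/esym/qproj_ker.
split; first by split; [exact: sD.1|exists 1%g => //; exact: sQ.1].
move=> x y [Dx [x' Qx' ex]] [Dy [y' Qy' ey]]; split; first exact: sD.2.
exists (x' * y'^-1)%g; first exact: sQ.2.
by rewrite !qprojMg !qprojVg ex ey.
Qed.

(** Sylow's theorem for pairs applies to the conjugate of [Q (D n N_i)] by [g] and
    to the Sylow subgroup of its span with [N_i] that lies in [R (D n N_i)]; the
    element correcting [g] centralises the conjugate of [Q] modulo [N_i]. *)
Lemma transports_saturate i j Q R g : (i0 <= i <= j)%N ->
    subgroup Q -> Q `<=` D -> subgroup R -> R `<=` D -> transports Q R j g ->
  exists2 g', transports (saturate i Q) (saturate i R) j g' &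
    forall x, Q x -> qproj (N i) (x ^ g')%g = qproj (N i) (x ^ g)%g.
Proof.
move=> /andP [i0i ij] sQ QD sR RD tr.
set Q' := saturate i Q; set R' := saturate i R.
have bQ' : between i Q' by apply: saturate_between.
have bR' : between i R' by apply: saturate_between.
have [sQ' QD' _] := bQ'; have [sR' RD' _] := bR'.
pose nu := qmorph (Nle ij); pose gq := qproj (N j) g.
have im A : nu @* qimg (N j) A = qimg (N i) A by apply: qmorph_qimg.
have imsat A : A `<=` D -> qimg (N i) (saturate i A) = qimg (N i) A.
  by move=> AD; rewrite /qimg saturate_image.
pose Qq := (qgrp (N j) sQ :^ gq)%G; pose A := (qgrp (N j) sQ' :^ gq)%G.
pose u := galg_conj gq (sub_idem Q j); pose al := galg_conj gq (sub_idem Q' j).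
have leQA : bp_le p (Qq : {set _}, u) (A : {set _}, al).
  apply: (bp_le_conj gq (x := (_, _)) (y := (_, _))).
  apply: (bp_le_between hp (sub_idem_le j sQ QD) (sub_idem_le j sQ' QD')).
  by apply: qimgS; apply: sub_saturate.
have leQR : bp_le p (Qq : {set _}, u) (qimg (N j) R', sub_idem R' j).
  apply: bp_le_trans tr _.
  apply: (bp_le_between hp (sub_idem_le j sR RD) (sub_idem_le j sR' RD')).
  by apply: qimgS; apply: sub_saturate.
have imA : nu @* A = nu @* Qq.
  by rewrite /= !morphimJ ?in_setT // !im imsat.
have sylA : p.-Sylow(nu @*^-1 (nu @* Qq)) A.
  rewrite -imA; apply/Sylow_preim/Sylow_kernel_conj.
  by apply: (between_Sylow (i := i)); rewrite // leqnn ij.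
have [_ bpR' /= sQR'] := bp_leP leQR.
have [pR' sylR'] : Sylow_kernel p nu (qimg (N j) R').
  by apply: (between_Sylow (i := i)); rewrite // leqnn ij.
pose B := (qgrp (N j) sR' :&: nu @*^-1 (nu @* Qq))%G.
have sBR : B \subset qgrp (N j) sR' := subsetIl _ _.
have sQB : Qq \subset B by rewrite subsetI sQR' sub_preim_image.
have imB : nu @* B = nu @* Qq.
  apply/eqP; rewrite eqEsubset (morphimS nu sQB) andbT.
  by rewrite sub_morphim_pre ?subsetT // subsetIr.
have sylB : p.-Sylow(nu @*^-1 (nu @* Qq)) B.
  rewrite -imB; apply: Sylow_preim; split; first exact: pgroupS sBR pR'.
  suff -> : B :&: 'ker nu = qimg (N j) R' :&: 'ker nu by [].
  rewrite /= -finset.setIA; congr (_ :&: _); apply/setIidPr.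
  apply/subsetP => z zk; apply/morphpreP; split; first by rewrite in_setT.
  by rewrite (mker zk); exact: (group1 (nu @* Qq)%G).
have [be leB] := bp_le_exists hp bpR' sBR.
have leQB := bp_le_between hp leQR leB sQB.
have [m mC eAB] := sylow_bpair_conj hp leQA leQB sylA sylB.
have [h hm] := qproj_surj m.
exists (g * h)%g.
  rewrite /transports qprojMg hm bp_conj_comp -/gq.
  by rewrite [bp_conj (bp_conj _ _) _]eAB.
move=> x Qx; have nE y : qproj (N i) y = nu (qproj (N j) y) by rewrite /nu
  qmorphE.
rewrite conjgM !nE (qprojJ _ _ h) hm morphTJ conjgE -(centP mC) ?mulKg //.
by apply: mem_morphimT; rewrite qprojJ memJ_conjg; apply: mem_qproj.
Qed.

Lemma level_quot_hom i m Q R g : (i <= m)%N -> between i Q -> between i R ->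
  transports Q R m g ->
  fus_hom (level_quot p D e m i) (qproj (N i) @` Q) (qproj (N i) @` R)
    (fun v => v ^ qproj (N i) g)%g.
Proof.
move=> im bQ bR tr; have [sQ QD _] := bQ; have [sR RD _] := bR.
have [oQ kQ] := between_level_obj m bQ; have [oR kR] := between_level_obj m bR.
have qE x : qmap (N i) (qproj (N m) x) = qproj (N i) x by apply: qmapE;
  apply: Nle.
have qI A : qproj (N i) @` A = qmap (N i) @` (qproj (N m) @` A).
  apply/seteqP; split=> [_ [x Ax <-]|_ [_ [x Ax <-] <-]].
    by exists (qproj (N m) x); [exists x|rewrite qE].
  by exists x; rewrite ?qE.
exists (qproj (N m) @` Q), (qproj (N m) @` R), (fun u => u ^ qproj (N m) g)%g.
split=> //.
  by apply/level_homP => //; exists g; split=> // x _; rewrite qprojJ.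
by move=> _ [x Qx <-]; rewrite -qprojJ !qE qprojJ.
Qed.

(** The functor extends a morphism to the products with [D n N_i]
    ([transports_saturate], at a large level) and then passes to level [m]. *)
Lemma fusion_morphism_level i m : (i0 <= i)%N -> stable_from i m ->
  fusion_morphism (profinite_fusion p D e) (level_quot p D e m i) (qproj (N i)).
Proof.
move=> i0i st; have [im _] := st; split.
- by move=> x y _ _; rewrite qprojMg.
- by rewrite -(quot_fusion_level i0i st).
- move=> R /open_subgroup_sub [sR RD]; rewrite -(quot_fusion_level i0i st).
  have bR := saturate_between i sR RD.
  exists (saturate i R); rewrite saturate_image //; split=> //.
    exact: between_open_subgroup bR.
  by case: bR.
move=> R S f oR oS /profinite_homP [_ _ [g [[j0 _ hj] hf]]].
have [sR RD] := open_subgroup_sub oR; have [sS SD] := open_subgroup_sub oS.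
have tr : transports R S (maxn j0 m) g := hj _ (leq_maxl _ _).
have hij : (i0 <= i <= maxn j0 m)%N by rewrite i0i (leq_trans im) ?leq_maxr.
have [g' tr' ig'] := transports_saturate hij sR RD sS SD tr.
have bR := saturate_between i sR RD; have bS := saturate_between i sS SD.
have trm : transports (saturate i R) (saturate i S) m g'.
  by apply: (transports_down st) tr'; rewrite ?leqnn ?leq_maxr.
exists (fun v => v ^ qproj (N i) g')%g.
  by have := level_quot_hom im bR bS trm; rewrite !saturate_image.
by move=> x Rx; rewrite -qprojJ ig' // hf.
Qed.

Lemma level_ker_strongly_closed i m : (i <= m)%N ->
  strongly_closed (level_fusion p D e m) (level_ker N D m i).
Proof.
move=> im; have kE := level_kerE D (Nle im); split.
- split.
    by exists 1%g; rewrite ?qproj1 //; split; [exact: sD.1|exact: on1].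
  move=> _ _ [x [Dx Nx] <-] [y [Dy Ny] <-]; exists (x * y^-1)%g.
    by split; [exact: sD.2|apply: onM => //; exact: onV].
  by rewrite qprojMg qprojVg.
- by rewrite kE => u [].
move=> Q f oQ Qk [w [eP [eQ [_ _ le hf]]]] _ [x Qx <-]; rewrite hf // kE /=.
have := Qk _ Qx; rewrite kE /= => -[_ kx]; split.
  have [_ _ /= /subsetP sub] := bp_leP le.
  have : (x ^ w)%g \in asfin [set` qimg (N m) D].
    by apply: sub; rewrite memJ_conjg /asfin inE; apply/mem_set.
  by rewrite /asfin inE => /set_mem.
have /= -> := morphTJ (qmorph (Nle im)) x w.
by rewrite kx conj1g.
Qed.

(** An element of [D] conjugated into the image of [D] at almost all levels is
    conjugated into [D], which is closed. *)
Lemma profinite_strongly_closed i :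
  strongly_closed (profinite_fusion p D e) (D `&` N i).
Proof.
split.
- split; first by split; [exact: sD.1|exact: on1].
  move=> x y [Dx Nx] [Dy Ny]; split; first exact: sD.2.
  by apply: onM => //; exact: onV.
- by move=> x [].
move=> Q f _ Qk /profinite_homP [_ _ [g [[j0 _ tr] hf]]] _ [x Qx <-].
rewrite hf //; have [_ Nx] := Qk _ Qx; split; last exact: on_normal.
apply: (closed_levels N_chain N_triv (i0 := j0) clD) => j j0j.
have [_ _ /= /subsetP sub] := bp_leP (tr j j0j).
have : qproj (N j) (x ^ g)%g \in qimg (N j) D.
  by apply: sub; rewrite qprojJ memJ_conjg; apply: mem_qproj.
by case/mem_qimg => y Dy yx; exists y.
Qed.

(** A compatible family of morphisms from [R] to [S] is realised, for each large
    [i], by some element in a closed set [X] of transporters that does not depend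
    on [i]; compactness gives one element for all [i]. *)
Theorem profinite_fusion_invlim (mu : nat -> nat) :
    (forall i, (i0 <= i)%N -> stable_from i (mu i)) ->
  is_invlim i0 (fun i => qproj (N i)) (fun j i => @qmap G (N j) (N i))
    (profinite_fusion p D e) (fun i => level_quot p D e (mu i) i).
Proof.
move=> st.
have mor i : (i0 <= i)%N -> fusion_morphism (profinite_fusion p D e)
    (level_quot p D e (mu i) i) (qproj (N i)).
  by move=> i0i; apply: fusion_morphism_level (st i i0i).
have qF i : (i0 <= i)%N -> level_quot p D e (mu i) i =
    quot_fusion (qproj (N i)) (D `&` N i) (profinite_fusion p D e).
  by move=> i0i; rewrite (quot_fusion_level i0i (st i i0i)).
have qE i j x : (i <= j)%N -> qmap (N i) (qproj (N j) x) = qproj (N i) x.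
  by move=> ij; apply: qmapE; apply: Nle.
have qI i j A : (i <= j)%N -> qmap (N i) @` (qproj (N j) @` A) = qproj (N i) @`
  A.
  move=> ij; apply/seteqP; split=> [_ [_ [x Ax <-] <-]|_ [x Ax <-]].
    by exists x; rewrite ?qE.
  by exists (qproj (N j) x); [exists x|rewrite qE].
split.
- move=> i j /andP [i0i ij]; have i0j := leq_trans i0i ij.
  have [_ _ morO morH] := mor i i0i; rewrite (qF j i0j); split.
  + by move=> x y _ _; apply: (qmapM (Nle ij)).
  + by rewrite (qF i i0i) /= qI.
  + by move=> _ [Q [oQ _ ->]]; rewrite qI //; apply: morO.
  move=> _ _ fb _ _ [Q [R [f [[oQ oR] _ [-> ->] homf hfb]]]].
  have [f' homf' hf'] := morH Q R f oQ oR homf.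
  exists f'; first by rewrite !qI.
  by move=> _ [x Qx <-]; rewrite qE // hf' // hfb // qE.
- by move=> i j x /andP [_ ij] _; apply: qE.
- move=> u Du cu.
  have [n|n|n|x hx] := @closed_nested_nonempty G
      (fun n => D `&` qproj (N (n + i0)) @^-1` [set u (n + i0)%N]).
  + by apply: closedI => //; exact: closed_qproj_preim.
  + have := Du (n + i0)%N (leq_addl _ _); rewrite qF ?leq_addl // => -[x Dx xu].
    by exists x.
  + move=> x [Dx /= xu]; split=> //=.
    have hc : (i0 <= n + i0 <= n.+1 + i0)%N by rewrite leq_addl addSn leqnSn.
    by have /andP [_ le] := hc; rewrite -(cu _ _ hc) -xu qE.
  exists x; split.
    split; first by case: (hx 0%N).
    by move=> i i0i; case: (hx (i - i0)%N) => _; rewrite /= subnK.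
  move=> y [Dy hy]; apply: (qproj_inj N_chain N_triv (i0 := i0)) => i i0i.
  by rewrite hy // -(subnK i0i); case: (hx (i - i0)%N).
- exact: mor.
move=> R S oR oS f [fhom fcomp].
have [r br] := open_subgroup_between oR;
  have [s bs] := open_subgroup_between oS.
(* From level [i1] on, [R] and [S] are determined by their images. *)
pose i1 := maxn i0 (maxn r s).
have i01 : (i0 <= i1)%N by apply: leq_maxl.
have bR i : (i1 <= i)%N -> between i R.
  by move=> h; apply: br; apply: leq_trans h; rewrite /i1 !leq_max leqnn orbT.
have bS i : (i1 <= i)%N -> between i S.
  by move=> h; apply: bs; apply: leq_trans h; rewrite /i1 !leq_max leqnn !orbT.
have st1 := st i1 i01.
pose X g := forall j, (mu i1 <= j)%N -> transports R S j g.
have lift i : (i1 <= i)%N -> exists2 g, X g &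
    forall x, R x -> qproj (N i) (x ^ g)%g = f i (qproj (N i) x).
  move=> i1i; have i0i := leq_trans i01 i1i.
  have := fhom i i0i; rewrite qF // =>
    -[Q [T [phi [[oQ oT] [DQ DT] [eQ eT] hphi hf]]]].
  have bet A B : between i A -> open_subgroup_of D B -> D `&` N i `<=` B ->
      qproj (N i) @` A = qproj (N i) @` B -> B = A.
    move=> bA /open_subgroup_sub [sB BD] DB eAB.
    by apply: (@between_eq i) => //; rewrite /qimg eAB.
  have eQR := bet R Q (bR i i1i) oQ DQ eQ;
    have eTS := bet S T (bS i i1i) oT DT eT.
  subst Q T; have /profinite_homP [_ _ [g [[j0 _ tr] hg]]] := hphi.
  exists g; last by move=> x Rx; rewrite hf // hg.
  move=> j mj; apply: (transports_down (j :=
    maxn j0 j) st1 (bR i1 _) (bS i1 _)) => //.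
    by rewrite mj leq_maxr.
  by apply: tr; rewrite /= leq_maxl.
have [n|n|n|g hg] := @closed_nested_nonempty G (fun n => [set g | X g] `&`
    [set g | forall x, R x -> qproj (N (n + i1)) (x ^ g)%g =
                              f (n + i1)%N (qproj (N (n + i1)) x)]).
- apply: closedI; last exact: (@closed_induces R _ (f (n + i1)%N)).
  have -> : [set g | X g] = \bigcap_(j in
    [set j | (mu i1 <= j)%N]) [set g | transports R S j g].
    by apply/seteqP; split=> g h j mj; exact: h.
  by apply: closed_bigI => j _; exact: closed_transports.
- by have [g Xg hg] := lift (n + i1)%N (leq_addl _ _); exists g.
- move=> g [Xg hg]; split=> //= x Rx.
  have le1 : (i0 <= n + i1 <= n.+1 + i1)%N.
    by rewrite (leq_trans i01) ?leq_addl // addSn leqnSn.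
  have /andP [_ le2] := le1.
  rewrite -(qE _ _ _ le2) hg // -(fcomp _ _ _ le1); last by exists x.
  by rewrite qE.
have Xg : X g by case: (hg 0%N).
have hgi i x : (i1 <= i)%N -> R x ->
  qproj (N i) (x ^ g)%g = f i (qproj (N i) x).
  by move=> i1i Rx; rewrite -(subnK i1i); case: (hg (i - i1)%N) => _; apply.
have hall i x : (i0 <= i)%N -> R x ->
  f i (qproj (N i) x) = qproj (N i) (x ^ g)%g.
  move=> i0i Rx; pose j := maxn i i1.
  have ij : (i0 <= i <= j)%N by rewrite i0i leq_maxl.
  have /andP [_ ij'] := ij.
  rewrite -(qE _ _ x ij') (fcomp _ _ _ ij); last by exists x.
  by rewrite -hgi ?leq_maxr // qE.
exists (fun x => x ^ g)%g => /=; split.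
  split=> //; apply/profinite_homP; split=> //; exists g; split=> //.
  by exists (mu i1).
move=> psi [_ hpsi] x Rx; apply: (qproj_inj N_chain N_triv (i0 := i0)) => i i0i.
by rewrite -hpsi // hall.
Qed.

End Levels.

(** * Verification of the hypotheses at large levels *)

Section ProfiniteSylow.
Local Open Scope group_scope.
Local Open Scope classical_set_scope.
Variables (p : nat) (G : profiniteGroupType).
Implicit Types (M K : openNormal G) (S : set G).

Lemma openNormalI_proof M K : [/\ open ((M : set G) `&` K),
  subgroup ((M : set G) `&` K) &
  forall x g, (on_set M x /\ on_set K x) ->
    on_set M (x ^ g) /\ on_set K (x ^ g)].
Proof.
split; first by apply: openI; apply: on_open.
  split; first by split; apply: on1.
  by move=> x y [Mx Kx] [My Ky]; split; apply: onM => //; apply: onV.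
by move=> x g [Mx Kx]; split; apply: on_normal.
Qed.

Definition openNormalI M K : openNormal G :=
  let: And3 o s n := openNormalI_proof M K in OpenNormal o s n.

Lemma openNormalIE M K : openNormalI M K = M `&` K :> set G.
Proof. by rewrite /openNormalI; case: openNormalI_proof. Qed.

(** In the quotient by [M n K] the image of [K] is normal and meets that of [S] in
    a Sylow subgroup, which is the image of [S n K]; then map down to [G/M]. *)
Lemma Sylow_openNormal S K M : profinite_Sylow p [set: G] S ->
  p.-Sylow(qimg M K) (qimg M (S `&` K)).
Proof.
move=> [sS _ _ sylS]; pose L := openNormalI M K.
have sLM : L `<=` M by rewrite openNormalIE => x [].
have sLK : L `<=` K by rewrite openNormalIE => x [].
have sK := on_subgroup K.
have sSK : subgroup (S `&` K).
  split; first by split; [exact: sS.1|exact: on1].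
  by move=> x y [Sx Kx] [Sy Ky]; split; [exact: sS.2|apply: onM => //;
    apply: onV].
have sT : subgroup [set: G] by [].
have nK : qgrp L sK <| qgrp L sT.
  apply/andP; split; first exact: qimgS.
  by rewrite -[X in _ \subset 'N(X)](qmorph_ker sLK);
    apply: subset_trans (subsetT _) (ker_norm _).
have := Sylow_setI_normal nK (sylS L : p.-Sylow(qgrp L sT) (qgrp L sS)).
have -> : qgrp L sK :&: qgrp L sS = qimg L (S `&` K).
  by rewrite -(qimg_ker sLK) qmorph_ker finset.setIC.
move/(morphim_pHall (qmorph sLM) (H := qgrp L sSK) (subsetT _)).
by rewrite !(qmorph_qimg sLM).
Qed.

End ProfiniteSylow.

Section LevelConditions.
Local Open Scope group_scope.
Local Open Scope classical_set_scope.
Variables (k : closedFieldType) (p : nat) (hp : p \in [pchar k]%R).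
Variables (G : profiniteGroupType) (N : nat -> openNormal G).
Hypothesis N_chain : forall i, N i.+1 `<=` N i.
Hypothesis N_triv : \bigcap_i (N i : set G) = [set 1].
Variables (D : set G) (e : idem_seq k N).
Hypothesis sD : subgroup D.
Hypothesis pD : pro_p p D.
Hypothesis pbD : is_pbpair p D e.

Lemma level_bpair i : is_bpair p (qimg (N i) D, e i).
Proof. by split; [exact: qimg_group_set|exact: pD|case: pbD]. Qed.

Lemma pbpair_trace : exists S i1, profinite_Sylow p [set: G] S /\
  forall i, (i1 <= i)%N -> D `&` N i = S `&` N i.
Proof.
have [[S sylS [_ [U oU DSU]]] _ _] := pbD.
have U1 : U 1 by have := sD.1; rewrite DSU => -[].
have [i1 NU] := chain_sub_open N_chain N_triv oU U1.
exists S, i1; split=> // i /(chain_le N_chain) sub.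
apply/seteqP; split=> x [+ Nx]; rewrite DSU; first by move=> [].
by move=> Sx; split=> //; split=> //; apply/NU/sub.
Qed.

(** [D] agrees with a Sylow subgroup of [G] inside small [N_i], so that the proviso
    in the linking condition of [(D, e)] is satisfied. *)
Lemma level_conditions : exists i0,
  (forall i j (sij : N j `<=` N i), (i0 <= i <= j)%N ->
     Sylow_kernel p (qmorph sij) (qimg (N j) D)) /\
  (forall i, (i0 <= i)%N ->
     covers (qmorph (@N_chain i)) (qimg (N i.+1) D) (e i) (e i.+1)).
Proof.
have [S [i1 [sylS DS]]] := pbpair_trace.
have [_ pe [i2 _ hnu]] := pbD.
have sylN i M : (i1 <= i)%N -> p.-Sylow(qimg M (N i)) (qimg M (D `&` N i)).
  by move=> i1i; rewrite DS //; apply: Sylow_openNormal.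
exists (maxn i1 i2); split=> [i j sij /andP [+ ij]|i];
  rewrite geq_max => /andP [i1i i2i].
  split; first exact: pD.
  by rewrite qimg_ker qmorph_ker; apply: sylN.
apply/(nu_minus_covers (nu := qmorph (@N_chain i)) (P := qgrp _ sD)).
- exact: pe.
- by rewrite /= qmorph_qimg; apply: pe.
have [_ sclS _ _] := sylS.
apply: hnu => //; split.
- split; first by split; [exact: on1|exact: sD.1].
  by move=> x y [Nx Dx] [Ny Dy]; split; [apply: onM => //;
    apply: onV|exact: sD.2].
- by rewrite classical_sets.setIC DS //; apply: closedI => //; exact: closed_on.
- by move=> x [].
- by move=> M; rewrite classical_sets.setIC; apply: sylN.
Qed.

End LevelConditions.

Lemma strictly_increasing_above (f : nat -> nat) : exists mu : nat -> nat,
  (forall i j, (i < j)%N -> (mu i < mu j)%N) /\ forall i, (f i <= mu i)%N.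
Proof.
pose mu i := (i + \sum_(j < i.+1) f j)%N; exists mu; split=> [i j|i].
  have step n : (mu n < mu n.+1)%N.
    by rewrite /mu [in ltnRHS]big_ord_recr /= addnA addSn ltnS leq_addr.
  elim: j => // j IH; rewrite ltnS leq_eqVlt => /orP [/eqP -> //|/IH lt].
  exact: ltn_trans lt (step j).
by rewrite /mu big_ord_recr /= addnA leq_addl.
Qed.

(** * The fusion system of a profinite block as an inverse limit *)

Local Open Scope classical_set_scope.

Theorem theorem3p9 (k : closedFieldType) (p : nat) (hp : p \in [pchar k]%R)
    (G : profiniteGroupType) (hG : @second_countable G)
    (N : nat -> openNormal G)
    (N_chain : forall i, N i.+1 `<=` N i)
    (N_triv : \bigcap_i (N i : set G) = [set 1%g])
    (b : cgalg k G) (hb : block_idem b)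
    (D : set G) (N0 : openNormal G) (b0 : galg k (quo N0))
    (hD : defect_group p b D b0)
    (e : idem_seq k N) (he : max_block_pbpair p b0 D e) :
  let F := profinite_fusion p D e in
  (\forall i \near \oo, level_defined p b0 D e i) /\
  exists (mu : nat -> nat) (i0 : nat),
    [/\ forall i j, (i < j)%N -> (mu i < mu j)%N,
        forall i, (i0 <= i)%N ->
          [/\ level_defined p b0 D e (mu i),
              strongly_closed (level_fusion p D e (mu i))
                              (level_ker N D (mu i) i) &
              strongly_closed F (D `&` N i)],
        is_invlim i0 (fun i => qproj (N i))
          (fun j i => @qmap G (N j) (N i))
          F (fun i => level_quot p D e (mu i) i) &
        forall i, (i0 <= i)%N ->
          quot_fusion (qproj (N i)) (D `&` N i) F =
          level_quot p D e (mu i) i].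
Proof.
have [[sD clD] pD _ defD] := hD.
have [[pbD [i1 _ blk]] _] := he.
have bD := level_bpair sD pD pbD.
have [i2 N2] := chain_sub_open N_chain N_triv (on_open N0) (on1 N0).
have [i3 [sylD covD]] := level_conditions N_chain N_triv sD pD pbD.
have def i : (maxn i1 i2 <= i)%N -> level_defined p b0 D e i.
  rewrite geq_max => /andP [i1i i2i].
  have sub : N i `<=` N0 by move=> x /(chain_le N_chain i2i)/N2.
  split=> //; apply: (block_bpair_defect_max hp (defD _ sub)).
  by split; [exact: bD|exact: blk].
pose i0 := maxn i3 (maxn i1 i2).
have i30 i : (i0 <= i)%N -> (i3 <= i)%N by rewrite geq_max => /andP [].
have {}sylD i j (sij : N j `<=` N i) : (i0 <= i <= j)%N ->
    Sylow_kernel p (qmorph sij) (qimg (N j) D).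
  by move=> /andP [/i30 h ij]; apply: sylD; rewrite h.
have {}covD i : (i0 <= i)%N ->
    covers (qmorph (@N_chain i)) (qimg (N i.+1) D) (e i) (e i.+1).
  by move/i30; apply: covD.
split; first by exists (maxn i1 i2).
have /choice [f hf] : forall i, exists m, (i0 <= i)%N -> stable_from p D e i m.
  move=> i; have [i0i|] := boolP (i0 <= i)%N; last by exists 0%N.
  by have [m hm] := stable_from_exists hp sD bD sylD covD i0i; exists m.
have [mu [mu_inc f_mu]] := strictly_increasing_above f.
have st i : (i0 <= i)%N -> stable_from p D e i (mu i).
  move=> /hf [ifi stf]; split; first exact: leq_trans ifi (f_mu i).
  by move=> j mj; apply: stf; apply: leq_trans mj.
exists mu, i0; split=> //.
- move=> i i0i; have [imu _] := st i i0i; split.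
  + by apply: def; apply: leq_trans (leq_trans i0i imu); apply: leq_maxr.
  + exact: level_ker_strongly_closed.
  + exact: (profinite_strongly_closed hp sD bD sylD covD N_triv pbD clD).
- exact: (profinite_fusion_invlim hp sD bD sylD covD N_triv pbD clD).
- by move=> i i0i; apply: (quot_fusion_level hp sD bD sylD covD N_triv pbD i0i
  (st i i0i)).
Qed.
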